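(* Let $0\le r<q$, suppose $\Sigma_0\succeq0$ has rank $s\le r$, and let the LAN assumption and the local set convergence and localisation assumption (both stated in the context) hold. Let $t\mapsto\theta(t)\in\Theta_0$ be a null path such that $$\theta(t)=\theta_0+t(a,H)+o(t),\qquad t\downarrow0,$$ with $a\in\mathbb R^{d_\psi}$, $H\in\mathbb S^q$, and put $\theta_n=\theta(n^{-1/2})$. Then, under $\Pr_{\theta_n}$, $$\Lambda_n\Rightarrow\Delta_{s,r}^{\mathrm{tr}}(P_s;H):=\operatorname{dist}_F^2\{Y+\mu_s(H),\mathcal D_{P_s,m_s}\}-\operatorname{dist}_F^2\{Y+\mu_s(H),\mathcal C_{P_s}\},$$ where $Y$ is a standard Gaussian element of $\mathbb S^{k_s}$ and $\mu_s(H)=\mathcal S_{P_s}^{-1/2}\mathcal A_{P_s}(H)$. Necessarily $\mathcal A_{P_s}(H)\in\mathcal K_{m_s}^{k_s}$; conversely, every element of $\mathcal K_{m_s}^{k_s}$ occurs as the active first-order increment $\mathcal A_{P_s}(H)$ of such a null path.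
   Context: Spaces. $\mathbb S^d$ is the space of real symmetric $d\times d$ matrices with Frobenius inner product $\langle A,B\rangle_F=\operatorname{tr}(AB)$ and norm $\|\cdot\|_F$; $\mathbb S_+^d$ is its positive-semidefinite cone. $\mathcal E=\mathbb R^{d_\psi}\oplus\mathbb S^q$ with inner product $\langle(a,A),(b,B)\rangle=a^\top b+\langle A,B\rangle_F$. For a nonempty closed set $A$, $\operatorname{dist}_F(X,A)=\inf_{Z\in A}\|X-Z\|_F$. A standard Gaussian element of $\mathbb S^d$ has independent $N(0,1)$ coordinates in the Frobenius-orthonormal basis $E_{ii}$, $F_{ij}=(E_{ij}+E_{ji})/\sqrt2$, $i<j$. Experiment. The parameter is $\theta=(\psi,\Sigma)\in\mathcal E$, with $\psi$ a nuisance parameter; $\Pr_\theta$ is the law of the data and $\ell_n(\theta)$ the sample log-likelihood at sample size $n$. The model admits a regular local extension to an open neighbourhood of the parameter $\theta_0=(\psi_0,\Sigma_0)$. The null and alternative parameter sets $\Theta_0\subseteq\Theta_1$ have the following restrictions on the matrix component: $\Sigma\succeq0$ and $\operatorname{rank}(\Sigma)\le r$ for $\Theta_0$; $\Sigma\succeq0$ for $\Theta_1$ (the nuisance component is locally unrestricted). The parameter $\theta_0$ lies in $\Theta_0$. The likelihood-ratio statistic is $\Lambda_n=2\{\sup_{\theta\in\Theta_1}\ell_n(\theta)-\sup_{\theta\in\Theta_0}\ell_n(\theta)\}$. Active block. $K_s=\ker(\Sigma_0)$, $k_s=q-s$, $m_s=r-s$, $P_s$ is the orthogonal projector onto $K_s$,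 $U_s\in\mathbb R^{q\times k_s}$ has orthonormal columns spanning $K_s$; $\mathcal A_{P_s}(H)=U_s^\top HU_s$ and $\mathcal A_{P_s}^*(B)=U_sBU_s^\top$. For $0\le m\le k$, $\mathcal K_m^k=\{B\in\mathbb S_+^k:\operatorname{rank}(B)\le m\}$. Put $T_1(P_s)=\{H\in\mathbb S^q:\mathcal A_{P_s}(H)\succeq0\}$ and $T_{0,s}^{(r)}(P_s)=\{H\in\mathbb S^q:\mathcal A_{P_s}(H)\in\mathcal K_{m_s}^{k_s}\}$. LAN assumption. There exist random elements $Z_n\in\mathcal E$ and a self-adjoint positive-definite operator $\mathcal I$ on $\mathcal E$ such that, under $\Pr_{\theta_0}$, for every compact $C\subset\mathcal E$, $\sup_{h\in C}|\ell_n(\theta_0+n^{-1/2}h)-\ell_n(\theta_0)-\langle h,Z_n\rangle+\frac12\langle h,\mathcal Ih\rangle|\to0$ in probability, and $Z_n\Rightarrow Z\sim\mathcal N_{\mathcal E}(0,\mathcal I)$. Local set convergence and localisation assumption. The rescaled sets $\{h:\theta_0+n^{-1/2}h\in\Theta_0\}$ and $\{h:\theta_0+n^{-1/2}h\in\Theta_1\}$ converge on bounded sets (i.e. in Hausdorff distance after intersection with every closed bounded ball) to $\mathbb R^{d_\psi}\oplus T_{0,s}^{(r)}(P_s)$ and $\mathbb R^{d_\psi}\oplus T_1(P_s)$, respectively, and the corresponding local constrained maximisers of $h\mapsto\ell_n(\theta_0+n^{-1/2}h)$ over these rescaled sets are stochastically bounded. Reduced covariance. Partition $\mathcal I$ according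 to $\mathcal E=\mathbb R^{d_\psi}\oplus\mathbb S^q$ and set $\mathcal I_{\mathrm{eff}}=\mathcal I_{\Sigma\Sigma}-\mathcal I_{\Sigma\psi}\mathcal I_{\psi\psi}^{-1}\mathcal I_{\psi\Sigma}$ (positive definite on $\mathbb S^q$), $\mathcal S_{P_s}=\mathcal A_{P_s}\mathcal I_{\mathrm{eff}}^{-1}\mathcal A_{P_s}^*$ (a self-adjoint positive-definite operator on $\mathbb S^{k_s}$), $\mathcal C_{P_s}=\mathcal S_{P_s}^{-1/2}(\mathbb S_+^{k_s})$, $\mathcal D_{P_s,m_s}=\mathcal S_{P_s}^{-1/2}(\mathcal K_{m_s}^{k_s})$. *)

(* Defs.v *)
From HB Require Import structures.
From mathcomp Require Import all_boot all_order all_algebra.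
From mathcomp Require Import all_classical all_reals all_analysis.

Set Implicit Arguments.
Unset Strict Implicit.
Unset Printing Implicit Defensive.

Import Order.TTheory GRing.Theory Num.Theory.
Import numFieldNormedType.Exports.

Local Open Scope classical_set_scope.
Local Open Scope ring_scope.

Definition symv (R : realType) (q : nat) : {vspace 'M[R]_q} :=
  lker (\1 - linfun (@trmx R q q))%VF.

Lemma mem_symv (R : realType) (q : nat) (A : 'M[R]_q) :
  (A \in symv R q) = (A^T == A).
Proof. by rewrite memv_ker add_lfunE opp_lfunE !lfunE /= subr_eq0 eq_sym. Qed.

Definition symmx (R : realType) (q : nat) : Type := subvs_of (symv R q).

HB.instance Definition _ (R : realType) (q : nat) :=
  Vector.copy (symmx R q) (subvs_of (symv R q)).

Definition symval (R : realType) (q : nat) : symmx R q -> 'M[R]_q := vsval.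

Lemma symval_is_linear (R : realType) (q : nat) : linear (@symval R q).
Proof. by move=> a x y; rewrite /symval linearP. Qed.

HB.instance Definition _ (R : realType) (q : nat) :=
  GRing.isLinear.Build R (symmx R q) 'M[R]_q _ (@symval R q)
    (@symval_is_linear R q).

HB.instance Definition _ (R : realType) (q : nat) :=
  Topological.copy (symmx R q) (initial_topology (@symval R q)).

(* [vsproj] is only a packaging device: it is the identity on [symv]
   ([vsprojK]), and is applied to symmetric matrices throughout. *)
Definition tosym (R : realType) (q : nat) : 'M[R]_q -> symmx R q :=
  vsproj (symv R q).

Lemma tosym_is_linear (R : realType) (q : nat) : linear (@tosym R q).
Proof. by move=> a x y; rewrite /tosym linearP. Qed.

HB.instance Definition _ (R : realType) (q : nat) :=
  GRing.isLinear.Build R 'M[R]_q (symmx R q) _ (@tosym R q)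
    (@tosym_is_linear R q).

Lemma tosymK (R : realType) (q : nat) (A : 'M[R]_q) :
  A^T = A -> symval (tosym A) = A.
Proof. by move=> As; rewrite /symval /tosym vsprojK// mem_symv As. Qed.

Definition frob (R : realType) (q : nat) (A B : symmx R q) : R :=
  \tr (symval A *m symval B).

Definition frob_norm (R : realType) (q : nat) (A : symmx R q) : R :=
  Num.sqrt (frob A A).

Definition dist_F (R : realType) (q : nat) (X : symmx R q)
    (A : set (symmx R q)) : R :=
  inf [set frob_norm (X - Z) | Z in A].

Definition psd (R : realType) (q : nat) (A : symmx R q) : Prop :=
  forall x : 'cV[R]_q, 0 <= (x^T *m symval A *m x) 0 0.

Definition psd_cone (R : realType) (q : nat) : set (symmx R q) :=
  [set A | psd A].

Definition psd_rank (R : realType) (q m : nat) : set (symmx R q) :=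
  [set A | psd A /\ (\rank (symval A) <= m)%N].

Definition param (R : realType) (d q : nat) : Type :=
  ('cV[R]_d * symmx R q)%type.

HB.instance Definition _ (R : realType) (d q : nat) :=
  Vector.copy (param R d q) ('cV[R]_d * symmx R q)%type.
HB.instance Definition _ (R : realType) (d q : nat) :=
  Topological.copy (param R d q) ('cV[R]_d * symmx R q)%type.

Definition inner (R : realType) (d q : nat) (x y : param R d q) : R :=
  (x.1^T *m y.1) 0 0 + frob x.2 y.2.

Definition enorm (R : realType) (d q : nat) (x : param R d q) : R :=
  Num.sqrt (inner x x).

Definition selfadjoint (R : realType) (V : vectType R) (ip : V -> V -> R)
    (F : 'End(V)) : Prop :=
  forall x y, ip (F x) y = ip x (F y).

Definition posdef (R : realType) (V : vectType R) (ip : V -> V -> R)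
    (F : 'End(V)) : Prop :=
  forall x, x != 0 -> 0 < ip x (F x).

(** The unique self-adjoint positive-definite square root (for a self-adjoint
    positive-definite argument). *)
Definition pd_sqrt (R : realType) (k : nat) (F : 'End(symmx R k)) :
    'End(symmx R k) :=
  xget 0 [set G : 'End(symmx R k) |
    [/\ selfadjoint (@frob R k) G, posdef (@frob R k) G & (G \o G)%VF = F]].

Definition inj_psi (R : realType) (d q : nat) (a : 'cV[R]_d) : param R d q :=
  (a, 0).
Definition inj_sigma (R : realType) (d q : nat) (A : symmx R q) :
  param R d q := (0, A).
Definition proj_psi (R : realType) (d q : nat) (x : param R d q) : 'cV[R]_d :=
  x.1.
Definition proj_sigma (R : realType) (d q : nat) (x : param R d q) :
  symmx R q := x.2.

Lemma inj_psi_is_linear (R : realType) (d q : nat) : linear (@inj_psi R d q).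
Proof.
move=> a x y; rewrite /inj_psi; apply/eqP.
by rewrite xpair_eqE /= scaler0 addr0 !eqxx.
Qed.
HB.instance Definition _ (R : realType) (d q : nat) :=
  GRing.isLinear.Build R 'cV[R]_d (param R d q) _ (@inj_psi R d q)
    (@inj_psi_is_linear R d q).

Lemma inj_sigma_is_linear (R : realType) (d q : nat) :
  linear (@inj_sigma R d q).
Proof.
move=> a x y; rewrite /inj_sigma; apply/eqP.
by rewrite xpair_eqE /= scaler0 addr0 !eqxx.
Qed.
HB.instance Definition _ (R : realType) (d q : nat) :=
  GRing.isLinear.Build R (symmx R q) (param R d q) _ (@inj_sigma R d q)
    (@inj_sigma_is_linear R d q).

Lemma proj_psi_is_linear (R : realType) (d q : nat) : linear (@proj_psi R d q).
Proof. by []. Qed.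
HB.instance Definition _ (R : realType) (d q : nat) :=
  GRing.isLinear.Build R (param R d q) 'cV[R]_d _ (@proj_psi R d q)
    (@proj_psi_is_linear R d q).

Lemma proj_sigma_is_linear (R : realType) (d q : nat) :
  linear (@proj_sigma R d q).
Proof. by []. Qed.
HB.instance Definition _ (R : realType) (d q : nat) :=
  GRing.isLinear.Build R (param R d q) (symmx R q) _ (@proj_sigma R d q)
    (@proj_sigma_is_linear R d q).

Definition info_psipsi (R : realType) (d q : nat) (I : 'End(param R d q)) :
    'End('cV[R]_d) :=
  (linfun (@proj_psi R d q) \o I \o linfun (@inj_psi R d q))%VF.
Definition info_psisigma (R : realType) (d q : nat) (I : 'End(param R d q)) :
    'Hom(symmx R q, 'cV[R]_d) :=
  (linfun (@proj_psi R d q) \o I \o linfun (@inj_sigma R d q))%VF.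
Definition info_sigmapsi (R : realType) (d q : nat) (I : 'End(param R d q)) :
    'Hom('cV[R]_d, symmx R q) :=
  (linfun (@proj_sigma R d q) \o I \o linfun (@inj_psi R d q))%VF.
Definition info_sigmasigma (R : realType) (d q : nat) (I : 'End(param R d q)) :
    'End(symmx R q) :=
  (linfun (@proj_sigma R d q) \o I \o linfun (@inj_sigma R d q))%VF.

Definition info_eff (R : realType) (d q : nat) (I : 'End(param R d q)) :
    'End(symmx R q) :=
  (info_sigmasigma I
   - (info_sigmapsi I \o (info_psipsi I)^-1 \o info_psisigma I))%VF.

Definition orthonormal_kernel_basis (R : realType) (q k : nat) (S : symmx R q)
    (U : 'M[R]_(q, k)) : Prop :=
  U^T *m U = 1%:M /\
  forall x : 'cV[R]_q,
    symval S *m x = 0 <-> exists y : 'cV[R]_k, x = U *m y.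

Definition active (R : realType) (q k : nat) (U : 'M[R]_(q, k)) :
    'Hom(symmx R q, symmx R k) :=
  linfun (@tosym R k \o (mulmxr U \o (mulmx U^T \o @symval R q))).

Lemma activeE (R : realType) (q k : nat) (U : 'M[R]_(q, k)) (H : symmx R q) :
  active U H = tosym (U^T *m symval H *m U).
Proof. by rewrite lfunE. Qed.

Definition active_adj (R : realType) (q k : nat) (U : 'M[R]_(q, k)) :
    'Hom(symmx R k, symmx R q) :=
  linfun (@tosym R q \o (mulmxr U^T \o (mulmx U \o @symval R k))).

Lemma active_adjE (R : realType) (q k : nat) (U : 'M[R]_(q, k)) (B : symmx R k) :
  active_adj U B = tosym (U *m symval B *m U^T).
Proof. by rewrite lfunE. Qed.

Definition tangent1 (R : realType) (q k : nat) (U : 'M[R]_(q, k)) :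
    set (symmx R q) :=
  [set H | psd (active U H)].

Definition tangent0 (R : realType) (q k m : nat) (U : 'M[R]_(q, k)) :
    set (symmx R q) :=
  [set H | @psd_rank R k m (active U H)].

Definition cov_red (R : realType) (d q k : nat) (I : 'End(param R d q))
    (U : 'M[R]_(q, k)) : 'End(symmx R k) :=
  (active U \o (info_eff I)^-1 \o active_adj U)%VF.

Definition cov_red_inv_sqrt (R : realType) (d q k : nat)
    (I : 'End(param R d q)) (U : 'M[R]_(q, k)) : 'End(symmx R k) :=
  pd_sqrt ((cov_red I U)^-1)%VF.

Definition cone_C (R : realType) (d q k : nat) (I : 'End(param R d q))
    (U : 'M[R]_(q, k)) : set (symmx R k) :=
  cov_red_inv_sqrt I U @` @psd_cone R k.

Definition cone_D (R : realType) (d q k m : nat) (I : 'End(param R d q))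
    (U : 'M[R]_(q, k)) : set (symmx R k) :=
  cov_red_inv_sqrt I U @` @psd_rank R k m.

Definition active_shift (R : realType) (d q k : nat) (I : 'End(param R d q))
    (U : 'M[R]_(q, k)) (H : symmx R q) : symmx R k :=
  cov_red_inv_sqrt I U (active U H).

Definition limit_stat (R : realType) (d q k m : nat) (I : 'End(param R d q))
    (U : 'M[R]_(q, k)) (H : symmx R q) (Y : symmx R k) : R :=
  dist_F (Y + active_shift I U H) (cone_D m I U) ^+ 2
  - dist_F (Y + active_shift I U H) (cone_C I U) ^+ 2.

Definition random_element (dT : measure_display) (T : measurableType dT)
    (S : topologicalType) (X : T -> S) : Prop :=
  forall A : set S, open A -> measurable (X @^-1` A).

(** Weak convergence, tested on bounded continuous functions.  The maps [X n]
    need not be measurable: the integral of a nonnegative function is a supremum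
    over measurable simple minorants, i.e. the inner expectation, so (splitting
    into positive and negative parts) this is Hoffmann-Jorgensen convergence,
    and it is the usual notion when the [X n] are measurable. *)
Definition cvg_in_law (R : realType) (S : topologicalType)
    (dT : nat -> measure_display) (T : forall n, measurableType (dT n))
    (P : forall n, probability (T n) R) (X : forall n, T n -> S)
    (dO : measure_display) (O : measurableType dO) (Q : probability O R)
    (Y : O -> S) : Prop :=
  forall f : S -> R, continuous f -> (exists M : R, forall x, `|f x| <= M) ->
    (\int[P n]_w (f (X n w))%:E)%E @[n --> \oo]
      --> (\int[Q]_w (f (Y w))%:E)%E.

(** Centred Gaussian law with covariance [I], [I] being positive definite (so
    that every functional in a direction [h != 0] has positive variance).  The
    second parameter of [normal_prob] is the standard deviation. *)
Definition gaussian (R : realType) (d q : nat) (I : 'End(param R d q))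
    (dO : measure_display) (O : measurableType dO) (Q : probability O R)
    (Z : O -> param R d q) : Prop :=
  random_element Z /\
  forall (h : param R d q) (B : set R), h != 0 -> measurable B ->
    Q [set w | B (inner h (Z w))]
      = normal_prob 0 (Num.sqrt (inner h (I h))) B.

Definition frob_basis (R : realType) (k : nat) (i j : 'I_k) : symmx R k :=
  tosym (if i == j then delta_mx i i
         else (Num.sqrt 2)^-1 *: (delta_mx i j + delta_mx j i)).

Definition std_gaussian (R : realType) (k : nat)
    (dO : measure_display) (O : measurableType dO) (Q : probability O R)
    (Y : O -> symmx R k) : Prop :=
  random_element Y /\
  forall B : 'I_k -> 'I_k -> set R, (forall i j, measurable (B i j)) ->
    Q [set w | forall i j : 'I_k, (i <= j)%N ->
                 B i j (frob (Y w) (frob_basis R i j))]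
      = (\prod_(ij : 'I_k * 'I_k | (ij.1 <= ij.2)%N)
            normal_prob 0 1 (B ij.1 ij.2))%E.

(** Outer measures make sense of probabilities of events defined by uncountable
    suprema or selections; on measurable sets they agree with [P n]. *)
Definition asymp_negligible (R : realType)
    (dT : nat -> measure_display) (T : forall n, measurableType (dT n))
    (P : forall n, probability (T n) R) (A : forall n, set (T n)) : Prop :=
  ((P n)^*)%mu (A n) @[n --> \oo] --> 0%E.

Section experiment.
Context (R : realType) (d q : nat).
Context (dT : nat -> measure_display) (T : forall n, measurableType (dT n)).

(** [D] is the set of genuine parameters: [Pr] and [f] are junk outside it. *)
Definition is_model (nu : forall n, {measure set (T n) -> \bar R})
    (Pr : forall n, param R d q -> probability (T n) R)
    (f : forall n, param R d q -> T n -> R) (D : set (param R d q)) : Prop :=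
  forall n theta, D theta ->
    [/\ forall w, 0 <= f n theta w,
        measurable_fun setT (f n theta)
      & forall A, measurable A ->
          Pr n theta A = (\int[nu n]_(w in A) (f n theta w)%:E)%E].

(** Extended real valued: equal to [-oo] where the density vanishes. *)
Definition loglik (f : forall n, param R d q -> T n -> R) (n : nat)
    (theta : param R d q) (w : T n) : \bar R :=
  lne (f n theta w)%:E.

Definition LR_stat (f : forall n, param R d q -> T n -> R)
    (Theta1 Theta0 : set (param R d q)) (n : nat) (w : T n) : \bar R :=
  (2%:E * (ereal_sup [set loglik f theta w | theta in Theta1]
           - ereal_sup [set loglik f theta w | theta in Theta0]))%E.

Definition rate (n : nat) : R := (Num.sqrt n%:R)^-1.

Definition LAN (Pr : forall n, param R d q -> probability (T n) R)
    (f : forall n, param R d q -> T n -> R) (theta0 : param R d q)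
    (I : 'End(param R d q)) (Z : forall n, T n -> param R d q) : Prop :=
  forall C : set (param R d q), compact C -> forall eps : R, 0 < eps ->
    asymp_negligible (fun n => Pr n theta0) (fun n =>
      [set w | (eps%:E <= ereal_sup
        [set `| loglik f (theta0 + rate n *: h)%R w - loglik f theta0 w
                - (inner h (Z n w))%:E + (2^-1 * inner h (I h))%R%:E |
           | h in C])%E]).

(** [Theta] restricts the matrix component to [K], and in a neighbourhood of
    [theta0] this is the only restriction. *)
Definition restricted_to (K : set (symmx R q)) (theta0 : param R d q)
    (Theta : set (param R d q)) : Prop :=
  (forall theta, Theta theta -> K theta.2) /\
  (\forall theta \near theta0, K theta.2 -> Theta theta).

Definition local_set (theta0 : param R d q) (Theta : set (param R d q))
    (n : nat) : set (param R d q) :=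
  [set h | Theta (theta0 + rate n *: h)].

Definition edist (x : param R d q) (A : set (param R d q)) : \bar R :=
  ereal_inf [set (enorm (x - y))%:E | y in A].

(** Extended real valued, so that it is meaningful for empty sets too. *)
Definition hausdorff (A B : set (param R d q)) : \bar R :=
  maxe (ereal_sup [set edist x B | x in A]) (ereal_sup [set edist y A | y in B]).

Definition eball (M : R) : set (param R d q) := [set h | enorm h <= M].

Definition cvg_on_bounded (A : nat -> set (param R d q))
    (B : set (param R d q)) : Prop :=
  forall M : R, 0 < M ->
    hausdorff (A n `&` eball M) (B `&` eball M) @[n --> \oo] --> 0%E.

(** With probability tending to one [h n] maximises the log-likelihood over the
    rescaled parameter set, and [h n] is bounded in probability. *)
Definition localised (Pr : forall n, param R d q -> probability (T n) R)
    (f : forall n, param R d q -> T n -> R) (theta0 : param R d q)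
    (Theta : set (param R d q)) : Prop :=
  exists h : forall n, T n -> param R d q,
    asymp_negligible (fun n => Pr n theta0) (fun n =>
      [set w | ~ (local_set theta0 Theta n (h n w) /\
        forall g, local_set theta0 Theta n g ->
          (loglik f (theta0 + rate n *: g)%R w
             <= loglik f (theta0 + rate n *: h n w)%R w)%E)]) /\
    forall eps : R, 0 < eps -> exists M : R, \forall n \near \oo,
      (((Pr n theta0)^*)%mu [set w | (M < enorm (h n w))%R] <= eps%:E)%E.

Definition null_path (Theta : set (param R d q)) (theta0 h : param R d q)
    (theta : R -> param R d q) : Prop :=
  (\forall t \near 0^'+, Theta (theta t)) /\
  enorm (theta t - theta0 - t *: h) / t @[t --> 0^'+] --> 0.

End experiment.

(* Main.v *)
Require Import Defs.
From HB Require Import structures.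
From mathcomp Require Import all_boot all_order all_algebra.
From mathcomp Require Import all_classical all_reals all_analysis.
From mathcomp Require Import ring lra zify measurable_realfun.
From mathcomp.real_closed Require complex.
Set Implicit Arguments.
Unset Strict Implicit.
Unset Printing Implicit Defensive.
Import Order.TTheory GRing.Theory Num.Theory.
Import numFieldNormedType.Exports.
Local Open Scope classical_set_scope.
Local Open Scope ring_scope.

(** Write [L h] for the active part [active U h.2] of a direction [h], [S] for
    [cov_red I U], and [y z = S^(-1/2) (L (I^-1 z))] for the reduced score.

    _The statistic is a function of the score._  In local coordinates the
    log-likelihood is, up to a constant and an error that vanishes uniformly on
    balls, the quadratic [<h, Z_n> - <h, I h> / 2].  The maximisers are bounded
    in probability and the rescaled parameter sets converge to the cones
    [L h \in K], where [K] is the positive semidefinite cone or its part of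
    bounded rank, so the suprema of the log-likelihood are those of the quadratic
    over the cones.  The least value of [<v, I v>] subject to [L v = b] is
    [|S^(-1/2) b|^2] ([info_ge_active], [active_solution]); hence, completing the
    square, the supremum over [L h \in K] is
    [<z, I^-1 z> / 2 - dist^2 (y z, S^(-1/2) K) / 2].  The first term cancels in
    the likelihood ratio, which is therefore
    [dist^2 (y Z_n, D) - dist^2 (y Z_n, C)] up to a negligible error
    ([LR_stat_approximation]).

    _Change of measure._  At the local alternatives the likelihood ratio is
    asymptotically [exp (<h, Z_n> - <h, I h> / 2)], and its limit has expectation
    one.  Le Cam's third lemma ([third_lemma]) then gives, for a bounded
    continuous [F] of the statistic, the limit of its expectation as an
    expectation under the Gaussian limit [Z] weighted by this exponential.  The
    lemma is proved here by one-sided bounds: the liminf of the inner integral of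
    a nonnegative [G] is at least the expected limit, and applying this to [G]
    and to [M - G] forces convergence.  In this form it tolerates a statistic
    that need not be measurable.

    _Identification of the limit._  Tilting a Gaussian by the exponential of a
    linear form shifts its mean, so under the weight [y Z] becomes a standard
    Gaussian element shifted by [S^(-1/2) (L h)].  The one-dimensional
    marginals of [Z] and the independence of the coordinates of [Y] determine the
    two Laplace transforms, which agree ([reduced_score_law]).  That Laplace transforms
    determine expectations of bounded continuous functions
    ([same_integral_bounded]) is proved by passing from exponentials to powers
    times exponentials by differentiation, to sines and cosines by power series,
    and to arbitrary functions by Bernstein polynomials in sines of the
    coordinates.

    _Directions of null paths._  The local coordinates of a null path converge to
    its direction [h] and lie in the rescaled null set, so [h] is a limit of
    points of the tangent cone, and the bounded-rank cone is closed
    ([null_path_active]).  Conversely [theta0 + t (0, U B U^T)] stays in the null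
    set, because the rank of a sum is at most the sum of the ranks
    ([null_path_exists]). *)

(** * Inner products on finite-dimensional spaces *)

Section InnerProduct.
Variables (R : realType) (V : vectType R) (ip : V -> V -> R).

Record inner_product : Prop := InnerProduct {
  ipC : forall x y, ip x y = ip y x;
  ip_linl : forall a x y z, ip (a *: x + y) z = a * ip x z + ip y z;
  ip_gt0 : forall x, x != 0 -> 0 < ip x x }.

Hypothesis hip : inner_product.

Lemma ip0l z : ip 0 z = 0.
Proof. by have := ip_linl hip (-1) 0 0 z; rewrite scaler0 addr0; lra. Qed.
Lemma ipDl x y z : ip (x + y) z = ip x z + ip y z.
Proof. by rewrite -[x]scale1r (ip_linl hip) mul1r scale1r. Qed.
Lemma ipZl a x z : ip (a *: x) z = a * ip x z.
Proof. by rewrite -[_ *: _]addr0 (ip_linl hip) ip0l addr0. Qed.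
Lemma ipNl x z : ip (- x) z = - ip x z.
Proof. by rewrite -scaleN1r ipZl mulN1r. Qed.
Lemma ipBl x y z : ip (x - y) z = ip x z - ip y z.
Proof. by rewrite ipDl ipNl. Qed.
Lemma ip0r z : ip z 0 = 0.
Proof. by rewrite (ipC hip) ip0l. Qed.
Lemma ipDr x y z : ip z (x + y) = ip z x + ip z y.
Proof. by rewrite (ipC hip) ipDl !(ipC hip z). Qed.
Lemma ipZr a x z : ip z (a *: x) = a * ip z x.
Proof. by rewrite (ipC hip) ipZl (ipC hip z). Qed.
Lemma ipNr x z : ip z (- x) = - ip z x.
Proof. by rewrite (ipC hip) ipNl (ipC hip z). Qed.
Lemma ipBr x y z : ip z (x - y) = ip z x - ip z y.
Proof. by rewrite ipDr ipNr. Qed.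
Lemma ip_suml I (r : seq I) P (F : I -> V) z :
  ip (\sum_(i <- r | P i) F i) z = \sum_(i <- r | P i) ip (F i) z.
Proof. by apply: (big_morph (ip^~ z)) => [x y|]; rewrite ?ipDl ?ip0l. Qed.
Lemma ip_sumr I (r : seq I) P (F : I -> V) z :
  ip z (\sum_(i <- r | P i) F i) = \sum_(i <- r | P i) ip z (F i).
Proof. by apply: (big_morph (ip z)) => [x y|]; rewrite ?ipDr ?ip0r. Qed.
Lemma ip_ge0 x : 0 <= ip x x.
Proof. by have [->|/(ip_gt0 hip)/ltW//] := eqVneq x 0; rewrite ip0l. Qed.
Lemma ip_eq0 x : (ip x x == 0) = (x == 0).
Proof.
have [->|xn0] := eqVneq x 0; first by rewrite ip0l eqxx.
by rewrite gt_eqF ?(ip_gt0 hip).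
Qed.

Definition ipnorm x := Num.sqrt (ip x x).

Lemma ipnorm_ge0 x : 0 <= ipnorm x. Proof. exact: sqrtr_ge0. Qed.
Lemma ipnorm_sqr x : ipnorm x ^+ 2 = ip x x.
Proof. by rewrite sqr_sqrtr ?ip_ge0. Qed.
Lemma ipnormZ a x : ipnorm (a *: x) = `|a| * ipnorm x.
Proof. by rewrite /ipnorm ipZl ipZr mulrA -expr2 sqrtrM ?sqr_ge0// sqrtr_sqr. Qed.
Lemma ipnormN x : ipnorm (- x) = ipnorm x.
Proof. by rewrite -scaleN1r ipnormZ normrN normr1 mul1r. Qed.
Lemma ipnorm0 : ipnorm 0 = 0. Proof. by rewrite /ipnorm ip0l sqrtr0. Qed.
Lemma ipnormB x y : ipnorm (x - y) = ipnorm (y - x).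
Proof. by rewrite -ipnormN opprB. Qed.

(** The quadratic form [ip] is nonnegative on [ip y y *: x - ip x y *: y]. *)
Lemma cauchy_schwarz x y : `|ip x y| <= ipnorm x * ipnorm y.
Proof.
have [->|yn0] := eqVneq y 0; first by rewrite ip0r normr0 mulr_ge0 ?ipnorm_ge0.
rewrite -sqrtrM ?ip_ge0// -sqrtr_sqr ler_wsqrtr//.
have := ip_ge0 (ip y y *: x - ip x y *: y).
rewrite ipBl !ipBr !ipZl !ipZr (ipC hip y x) => h.
by rewrite -subr_ge0 -(pmulr_rge0 _ (ip_gt0 hip yn0)); lra.
Qed.

Lemma ipnormD x y : ipnorm (x + y) <= ipnorm x + ipnorm y.
Proof.
rewrite -(ler_pXn2r (n:=2))// ?nnegrE ?addr_ge0 ?ipnorm_ge0//.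
rewrite sqrrD !ipnorm_sqr ipDl !ipDr (ipC hip y x).
have := cauchy_schwarz x y; have := ler_norm (ip x y); lra.
Qed.
Lemma ipnorm_triangle y x z : ipnorm (x - z) <= ipnorm (x - y) + ipnorm (y - z).
Proof. by rewrite (le_trans _ (ipnormD _ _))// addrA subrK. Qed.

(** The orthogonal complement of a sequence is encoded as the kernel of the map
    of inner products, so that its dimension is given by the rank theorem. *)
Definition orthv_map (s : seq V) (x : V) : 'rV[R]_(size s) :=
  \row_i ip x s`_i.

Lemma orthv_map_linear s : linear (orthv_map s).
Proof. by move=> a x y; apply/rowP => i; rewrite !mxE (ip_linl hip). Qed.
HB.instance Definition _ s := GRing.isLinear.Build R V 'rV[R]_(size s) *:%R
  (orthv_map s) (@orthv_map_linear s).

Definition orthv (s : seq V) : {vspace V} := lker (linfun (orthv_map s)).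

Lemma mem_orthv s x :
  reflect (forall i, (i < size s)%N -> ip x s`_i = 0) (x \in orthv s).
Proof.
rewrite memv_ker lfunE /=; apply: (iffP eqP) => [/rowP xs i si|xs].
  by have := xs (Ordinal si); rewrite !mxE.
by apply/rowP => i; rewrite !mxE xs.
Qed.

Lemma orthv_gt0 s : (size s < \dim {:V})%N -> (0 < \dim (orthv s))%N.
Proof.
move=> ss; have := limg_ker_dim (linfun (orthv_map s)) {:V}.
rewrite capfv -/(orthv s) => E; move: ss; rewrite -E.
have := dimvS (subvf (linfun (orthv_map s) @: {:V})).
by rewrite dimvf /dim /= mul1n; lia.
Qed.

End InnerProduct.

Section Eigenvector.
Import complex passmx.
Variables (R : realType) (V : vectType R) (ip : V -> V -> R).
Hypothesis hip : inner_product ip.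

(** Complexifying the matrix of [F] gives an eigenvalue [a + i b] with
    eigenvector [u + i w]; self-adjointness makes [b (|u|^2 + |w|^2)] vanish. *)
Lemma selfadjoint_eigenvector (F : 'End(V)) : selfadjoint ip F ->
  (0 < \dim {:V})%N -> exists a (x : V), x != 0 /\ F x = a *: x.
Proof.
move=> sF n0; set n := \dim _ in n0 *.
pose e := vbasis {:V}; have eb : basis_of {:V} e := vbasisP _.
pose M := passmx.mxof e e F.
have FM (u : 'rV_n) : F (passmx.vecof e u) = passmx.vecof e (u *m M).
  by rewrite passmx.mul_mxof passmx.rVofK.
pose C := [the fieldType of complex R].
pose toC (x : R) : C := Complex x 0.
have [a /eigenvalueP[v vM v0]] := @Theorem7' R n (map_mx toC M) n0.
pose u := map_mx (@Re R) v; pose w := map_mx (@Im R) v.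
have ReD (x y : C) : Re (x + y) = Re x + Re y by case: x y => [? ?] [].
have ImD (x y : C) : Im (x + y) = Im x + Im y by case: x y => [? ?] [].
have uM : u *m M = Re a *: u - Im a *: w.
  apply/rowP => i; have := congr1 (fun z : 'rV[C]_n => Re (z 0 i)) vM.
  rewrite !mxE (big_morph _ ReD (erefl _)) => E.
  transitivity (Re (a * v 0 i)); last by case: a (v 0 i) {vM E} => [? ?] [].
  rewrite -E; apply: eq_bigr => j _; rewrite !mxE.
  by case: (v 0 j) => x y /=; rewrite mulr0 subr0.
have wM : w *m M = Im a *: u + Re a *: w.
  apply/rowP => i; have := congr1 (fun z : 'rV[C]_n => Im (z 0 i)) vM.
  rewrite !mxE (big_morph _ ImD (erefl _)) => E.
  transitivity (Im (a * v 0 i)).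
    rewrite -E; apply: eq_bigr => j _; rewrite !mxE.
    by case: (v 0 j) => x y /=; rewrite mulr0 add0r.
  by case: a (v 0 i) {vM E uM} => [? ?] [? ?] /=; rewrite addrC.
set U := passmx.vecof e u; set W := passmx.vecof e w.
have FU : F U = Re a *: U - Im a *: W.
  by rewrite FM uM linearB !linearZ.
have FW : F W = Im a *: U + Re a *: W.
  by rewrite FM wM linearD !linearZ.
have UW0 : (U != 0) || (W != 0).
  rewrite !passmx.vecof_eq0// -negb_and; apply: contra v0 => /andP[/eqP u0 /eqP w0].
  apply/eqP/rowP => i; move/rowP: u0 => /(_ i); move/rowP: w0 => /(_ i).
  by rewrite !mxE; case: (v 0 i) => x y /= -> ->.
have b0 : Im a = 0.
  have := sF U W; rewrite FU FW (ipBl hip) (ipDr hip) !(ipZl hip) !(ipZr hip) => E.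
  have /eqP : Im a * (ip U U + ip W W) = 0 by lra.
  rewrite mulf_eq0 => /orP[/eqP//|].
  by rewrite paddr_eq0 ?(ip_ge0 hip)// !(ip_eq0 hip) => /andP[/eqP U0 /eqP W0]; rewrite U0 W0 eqxx in UW0.
move: UW0; case/orP => [U0|W0]; [exists (Re a), U|exists (Re a), W].
  by rewrite FU b0 scale0r subr0.
by rewrite FW b0 scale0r add0r.
Qed.

End Eigenvector.

Section Spectral.
Variables (R : realType) (V : vectType R) (ip : V -> V -> R).
Hypothesis hip : inner_product ip.

Definition ip_on (W : {vspace V}) (x y : subvs_of W) : R := ip (vsval x) (vsval y).

Lemma inner_product_on W : inner_product (@ip_on W).
Proof.
split=> [x y|a x y z|x x0]; rewrite /ip_on; first exact: (ipC hip).
  by rewrite linearP (ip_linl hip).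
apply: (ip_gt0 hip); apply: contra x0 => /eqP x0.
by apply/eqP/val_inj; rewrite /= x0.
Qed.

(** The eigenvector of the restriction of [F] to [W], normalised. *)
Lemma stable_eigenvector (F : 'End(V)) (W : {vspace V}) : selfadjoint ip F ->
  (forall x, x \in W -> F x \in W) -> (0 < \dim W)%N ->
  exists a (x : V), [/\ x \in W, ip x x = 1 & F x = a *: x].
Proof.
move=> sF FW W0; pose F' : 'End(subvs_of W) := linfun (vsproj W \o F \o vsval).
have F'E x : vsval (F' x) = F (vsval x).
  by rewrite lfunE /= vsprojK// FW// subvsP.
have [||a [x [x0 Fx]]] := selfadjoint_eigenvector (inner_product_on W) (F := F').
- by move=> x y; rewrite /ip_on !F'E sF.
- by rewrite dimvf.
have x1 := ip_gt0 (inner_product_on W) x0; rewrite /ip_on in x1.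
exists a, ((Num.sqrt (ip (vsval x) (vsval x)))^-1 *: vsval x); split.
- by rewrite memvZ// subvsP.
- rewrite (ipZl hip) (ipZr hip) mulrA -expr2 exprVn sqr_sqrtr ?(ip_ge0 hip)//.
  by rewrite mulVf// gt_eqF.
- by rewrite linearZ /= -F'E Fx linearZ /= !scalerA mulrC.
Qed.

Lemma orthonormal_eigenvectors (F : 'End(V)) n : selfadjoint ip F ->
  (n <= \dim {:V})%N -> exists s : seq V, [/\ size s = n,
    forall i j, (i < n)%N -> (j < n)%N -> ip s`_i s`_j = (i == j)%:R &
    forall i, (i < n)%N -> exists a, F s`_i = a *: s`_i].
Proof.
move=> sF; elim: n => [|n IH] nV; first by exists [::].
have [s [sn so sE]] := IH (ltnW nV).
have [||a [x [/(mem_orthv hip) xW x1 Fx]]] := @stable_eigenvector F (orthv ip s) sF.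
- move=> x /(mem_orthv hip) xs; apply/(mem_orthv hip) => i si.
  have si' := si; rewrite sn in si'; have [a Fi] := sE i si'.
  by rewrite sF Fi (ipZr hip) xs// mulr0.
- by apply: orthv_gt0; rewrite sn.
exists (rcons s x); rewrite size_rcons sn; split=> //.
- move=> i j; rewrite !ltnS !nth_rcons !sn.
  rewrite (leq_eqVlt i) (leq_eqVlt j) => /predU1P[->|ni] /predU1P[->|nj].
  + by rewrite ltnn eqxx x1.
  + by rewrite ltnn eqxx nj xW ?sn// gtn_eqF.
  + by rewrite ltnn eqxx ni (ipC hip) xW ?sn// ltn_eqF.
  + by rewrite ni nj so.
- move=> i; rewrite ltnS nth_rcons sn leq_eqVlt => /predU1P[->|ni].
    by rewrite ltnn eqxx; exists a.
  by rewrite ni; exact: sE.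
Qed.

(** The eigenvectors are found one at a time: the orthogonal complement of those
    already found is stable under [F]. *)
Theorem spectral_theorem (F : 'End(V)) : selfadjoint ip F ->
  exists (e : 'I_(\dim {:V}) -> V) (a : 'I_(\dim {:V}) -> R),
  [/\ forall i j, ip (e i) (e j) = (i == j)%:R,
      forall x, x = \sum_i ip x (e i) *: e i
    & forall i, F (e i) = a i *: e i].
Proof.
move=> sF; have [s [sn so sE]] := orthonormal_eigenvectors sF (leqnn _).
have st : size s == \dim {:V} by rewrite sn.
pose t : (\dim {:V}).-tuple V := Tuple st.
have tfree : free t.
  apply/freeP => k k0 i; have := congr1 (ip^~ t`_i) k0.
  rewrite (ip0l hip) (ip_suml hip) (bigD1 i)//= (ipZl hip) so// eqxx mulr1.
  rewrite big1 ?addr0// => j ji.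
  by rewrite (ipZl hip) so// val_eqE (negbTE ji) mulr0.
have tb : basis_of {:V} t by rewrite basisEfree tfree subvf size_tuple leqnn.
have [a aE] : exists a : 'I_(\dim {:V}) -> R, forall i : 'I_(\dim {:V}), F s`_i = a i *: s`_i.
  pose c (i : 'I_(\dim {:V})) := cid (sE i (ltn_ord i)).
  by exists (fun i => projT1 (c i)) => i; exact: projT2 (c i).
exists (fun i => s`_i), a; split=> //.
  by move=> i j; rewrite so.
move=> x; rewrite {1}(coord_basis tb (memvf x)); apply: eq_bigr => i _.
congr (_ *: _); rewrite {2}(coord_basis tb (memvf x)) (ip_suml hip) (bigD1 i)//=.
rewrite (ipZl hip) so// eqxx mulr1 big1 ?addr0// => j ji.
by rewrite (ipZl hip) so// val_eqE (negbTE ji) mulr0.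
Qed.

Lemma parseval n (e : 'I_n -> V) x : (forall x, x = \sum_i ip x (e i) *: e i) ->
  ip x x = \sum_i ip x (e i) ^+ 2.
Proof.
move=> eb; rewrite {2}(eb x) (ip_sumr hip).
by apply: eq_bigr => i _; rewrite (ipZr hip) expr2.
Qed.

Lemma exists_orthonormal_basis : exists e : 'I_(\dim {:V}) -> V,
  (forall i j, ip (e i) (e j) = (i == j)%:R) /\
  (forall x, x = \sum_i ip x (e i) *: e i).
Proof.
have [|e [a [eo eb _]]] := @spectral_theorem \1%VF; first by move=> x y; rewrite !lfunE.
by exists e.
Qed.

Lemma posdef_lker (F : 'End(V)) : posdef ip F -> lker F == 0%VS.
Proof.
move=> pF; apply/eqP/vspaceP => x; rewrite memv_ker memv0.
have [->|x0] := eqVneq x 0; first by rewrite linear0 eqxx.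
by apply/eqP => Fx; have := pF x x0; rewrite Fx (ip0r hip) ltxx.
Qed.

(** The smallest eigenvalue is a lower bound of the Rayleigh quotient. *)
Lemma posdef_lower_bound (F : 'End(V)) : selfadjoint ip F -> posdef ip F ->
  exists2 l : R, 0 < l & forall x, l * ip x x <= ip x (F x).
Proof.
move=> sF pF; have [e [a [eo eb aE]]] := spectral_theorem sF.
have a0 i : 0 < a i.
  have e0 : e i != 0.
    by apply/eqP => e0; have := eo i i; rewrite e0 (ip0l hip) eqxx => /eqP; rewrite eq_sym oner_eq0.
  by have := pF _ e0; rewrite aE (ipZr hip) eo eqxx mulr1.
exists (\big[Num.min/1]_i a i).
  by elim/big_ind: _ => // x y x0 y0; rewrite lt_min x0.
move=> x; rewrite (parseval x eb) [X in _ <= X](_ : _ = \sum_i a i * ip x (e i) ^+ 2).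
  rewrite mulr_sumr; apply: ler_sum => i _; apply: ler_wpM2r; first exact: sqr_ge0.
  exact: bigmin_le_cond.
rewrite {2}(eb x) linear_sum (ip_sumr hip); apply: eq_bigr => i _.
by rewrite linearZ /= aE !(ipZr hip); ring.
Qed.

(** The square root is diagonal in an orthonormal basis of eigenvectors. *)
Lemma exists_pd_sqrt (F : 'End(V)) : selfadjoint ip F -> posdef ip F ->
  exists G : 'End(V), [/\ selfadjoint ip G, posdef ip G & (G \o G)%VF = F].
Proof.
move=> sF pF; have [e [a [eo eb aE]]] := spectral_theorem sF.
have a0 i : 0 < a i.
  have e0 : e i != 0.
    by apply/eqP => e0; have := eo i i; rewrite e0 (ip0l hip) eqxx => /eqP; rewrite eq_sym oner_eq0.
  by have := pF _ e0; rewrite aE (ipZr hip) eo eqxx mulr1.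
pose g x := \sum_i (Num.sqrt (a i) * ip x (e i)) *: e i.
have gl : linear g.
  move=> c x y; rewrite /g scaler_sumr -big_split; apply: eq_bigr => i _ /=.
  by rewrite (ip_linl hip) scalerA -scalerDl; congr (_ *: _); ring.
pose gL := HB.pack_for {linear V -> V} g (GRing.isLinear.Build R V V *:%R g gl).
have gE x : linfun gL x = g x by rewrite lfunE.
have ge i : g (e i) = Num.sqrt (a i) *: e i.
  rewrite /g (bigD1 i)//= eo eqxx mulr1 big1 ?addr0// => j ji.
  by rewrite eo eq_sym (negbTE ji) mulr0 scale0r.
have ipg x y : ip (g x) y = \sum_i Num.sqrt (a i) * ip x (e i) * ip y (e i).
  by rewrite (ip_suml hip); apply: eq_bigr => i _; rewrite (ipZl hip) (ipC hip (e i)).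
exists (linfun gL); split.
- move=> x y; rewrite !gE (ipC hip x) !ipg; apply: eq_bigr => i _; ring.
- move=> x x0; rewrite gE (ipC hip) ipg lt_neqAle; apply/andP; split; last first.
    by apply: sumr_ge0 => i _; rewrite -mulrA mulr_ge0 ?sqrtr_ge0// -expr2 sqr_ge0.
  apply: contra x0; rewrite eq_sym psumr_eq0; last first.
    by move=> i _; rewrite -mulrA mulr_ge0 ?sqrtr_ge0// -expr2 sqr_ge0.
  move=> /allP x0; rewrite (eb x) big1// => i _.
  have /= := x0 i (mem_index_enum i).
  rewrite -mulrA mulf_eq0 sqrtr_eq0 leNgt a0 /= mulf_eq0 orbb => /eqP ->.
  by rewrite scale0r.
- have GGe i : (linfun gL \o linfun gL)%VF (e i) = F (e i).
    rewrite lfunE /= !gE ge -gE linearZ /= gE ge scalerA -expr2 sqr_sqrtr ?aE ?ltW//.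
  apply/lfunP => x; rewrite (eb x) !linear_sum; apply: eq_bigr => i _.
  by rewrite !linearZ /= GGe.
Qed.

End Spectral.

Lemma ipnorm_sum (R : realType) (V : vectType R) (ip : V -> V -> R) I (r : seq I)
    (F : I -> V) : inner_product ip ->
  ipnorm ip (\sum_(i <- r) F i) <= \sum_(i <- r) ipnorm ip (F i).
Proof.
move=> hip; elim/big_rec2: _ => [|i x y _ h]; first by rewrite ipnorm0.
by rewrite (le_trans (ipnormD hip _ _))// lerD2l.
Qed.

Lemma linear_bounded (R : realType) (V W : vectType R) (ipV : V -> V -> R)
    (ipW : W -> W -> R) (L : {linear V -> W}) :
  inner_product ipV -> inner_product ipW ->
  exists2 C : R, 0 < C & forall x, ipnorm ipW (L x) <= C * ipnorm ipV x.
Proof.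
move=> hV hW; have [e [eo eb]] := exists_orthonormal_basis hV.
have S0 : 0 <= \sum_i ipnorm ipW (L (e i)) by apply: sumr_ge0 => i _; exact: ipnorm_ge0.
exists (1 + \sum_i ipnorm ipW (L (e i))); first by rewrite ltr_pwDl.
move=> x; rewrite {1}(eb x) linear_sum (le_trans (ipnorm_sum _ _ hW))//.
rewrite mulrDl mul1r -[X in X <= _]add0r lerD ?ipnorm_ge0// mulr_suml.
apply: ler_sum => i _; rewrite linearZ /= (ipnormZ hW) mulrC ler_wpM2l ?ipnorm_ge0//.
rewrite (le_trans (cauchy_schwarz hV _ _))// /ipnorm eo eqxx sqrtr1 mulr1//.
Qed.

(** * The parameter space *)

Section Frobenius.
Variables (R : realType) (q : nat).
Implicit Types A B : symmx R q.

Lemma symval_tr A : (symval A)^T = symval A.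
Proof. by have := subvsP A; rewrite mem_symv => /eqP. Qed.

Lemma symval_inj : injective (@symval R q).
Proof. exact: val_inj. Qed.

Lemma frobE A B : frob A B = \sum_i \sum_j symval A i j * symval B i j.
Proof.
rewrite /frob /mxtrace; apply: eq_bigr => i _; rewrite mxE; apply: eq_bigr => j _.
by rewrite -[in X in _ * X](symval_tr B) mxE.
Qed.

Lemma frob_inner_product : inner_product (@frob R q).
Proof.
split=> [A B|a A B C|A A0]; first by rewrite /frob mxtrace_mulC.
  by rewrite /frob linearP /= mulmxDl -scalemxAl linearP.
rewrite frobE lt_neqAle sumr_ge0 ?andbT; last first.
  by move=> i _; apply: sumr_ge0 => j _; rewrite -expr2 sqr_ge0.
apply: contra A0; rewrite eq_sym psumr_eq0 => [/allP AE|i _]; last first.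
  by apply: sumr_ge0 => j _; rewrite -expr2 sqr_ge0.
apply/eqP/symval_inj/matrixP => i j; rewrite linear0 mxE.
have /= := AE i (mem_index_enum _).
rewrite psumr_eq0 => [/allP /(_ j (mem_index_enum _))/=|k _]; last by rewrite -expr2 sqr_ge0.
by rewrite mulf_eq0 orbb => /eqP.
Qed.

Lemma frob_norm_triangle A B C : frob_norm (B - C) <= frob_norm (B - A) + frob_norm (A - C).
Proof. exact: (ipnorm_triangle frob_inner_product). Qed.
Lemma frob_normB A B : frob_norm (A - B) = frob_norm (B - A).
Proof. exact: (ipnormB frob_inner_product). Qed.
Lemma frob_norm_sqr A : frob_norm A ^+ 2 = frob A A.
Proof. exact: (ipnorm_sqr frob_inner_product). Qed.
Lemma frob_norm_ge0 A : 0 <= frob_norm A. Proof. exact: sqrtr_ge0. Qed.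

Lemma entry_le_frob_norm A i j : `|symval A i j| <= frob_norm A.
Proof.
rewrite -sqrtr_sqr ler_wsqrtr// frobE (bigD1 i)//= (bigD1 j)//= -expr2 -addrA lerDl.
apply: addr_ge0; apply: sumr_ge0 => k _; first by rewrite -expr2 sqr_ge0.
by apply: sumr_ge0 => l _; rewrite -expr2 sqr_ge0.
Qed.

End Frobenius.

Section ParamSpace.
Variables (R : realType) (d q : nat).

Definition dot (x y : 'cV[R]_d) : R := (x^T *m y) 0 0.

Lemma dotE x y : dot x y = \sum_i x i 0 * y i 0.
Proof. by rewrite /dot mxE; apply: eq_bigr => i _; rewrite mxE. Qed.

Lemma dot_inner_product : inner_product dot.
Proof.
split=> [x y|a x y z|x x0]; rewrite !dotE.
- by apply: eq_bigr => i _; rewrite mulrC.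
- rewrite mulr_sumr -big_split; apply: eq_bigr => i _ /=.
  by rewrite !mxE; ring.
- rewrite lt_neqAle sumr_ge0 ?andbT; last by move=> i _; rewrite -expr2 sqr_ge0.
  apply: contra x0; rewrite eq_sym psumr_eq0 => [/allP xE|i _]; last by rewrite -expr2 sqr_ge0.
  apply/eqP/colP => i; rewrite mxE; have /= := xE i (mem_index_enum _).
  by rewrite mulf_eq0 orbb => /eqP.
Qed.

Lemma innerE (x y : param R d q) : inner x y = dot x.1 y.1 + frob x.2 y.2.
Proof. by []. Qed.

Lemma inner_inner_product : inner_product (@inner R d q).
Proof.
have hd := dot_inner_product; have hf := frob_inner_product R q.
split=> [x y|a x y z|[x A] x0]; rewrite !innerE.
- by rewrite (ipC hd) (ipC hf).
- by rewrite /= (ip_linl hd) (ip_linl hf); ring.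
- rewrite lt_neqAle addr_ge0 ?(ip_ge0 hd) ?(ip_ge0 hf)// andbT.
  apply: contra x0; rewrite eq_sym paddr_eq0 ?(ip_ge0 hd) ?(ip_ge0 hf)//=.
  by rewrite (ip_eq0 hd) (ip_eq0 hf).
Qed.

Lemma entry_le_dot_norm (x : 'cV[R]_d) i : `|x i 0| <= ipnorm dot x.
Proof.
rewrite -sqrtr_sqr ler_wsqrtr// dotE (bigD1 i)//= -expr2 lerDl.
by apply: sumr_ge0 => k _; rewrite -expr2 sqr_ge0.
Qed.

End ParamSpace.

Section Active.
Variables (R : realType) (q k : nat) (U : 'M[R]_(q, k)).

Lemma symval_active H : symval (active U H) = U^T *m symval H *m U.
Proof.
by rewrite activeE tosymK// !trmx_mul trmxK symval_tr mulmxA.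
Qed.
Lemma symval_active_adj B : symval (active_adj U B) = U *m symval B *m U^T.
Proof.
by rewrite active_adjE tosymK// !trmx_mul trmxK symval_tr mulmxA.
Qed.
Lemma active_adjP H B : frob (active U H) B = frob H (active_adj U B).
Proof.
by rewrite /frob symval_active symval_active_adj -!mulmxA mxtrace_mulC !mulmxA.
Qed.
Hypothesis UU : U^T *m U = 1%:M.
Lemma active_adjK B : active U (active_adj U B) = B.
Proof.
apply: symval_inj; rewrite symval_active symval_active_adj !mulmxA UU mul1mx.
by rewrite -mulmxA UU mulmx1.
Qed.
End Active.

Section Distance.
Variables (R : realType) (q : nat) (A : set (symmx R q)).
Hypothesis A0 : A !=set0.
Let hf := frob_inner_product R q.

Lemma dist_F_has_inf X : has_inf [set frob_norm (X - Z) | Z in A].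
Proof.
split; first by case: A0 => Z AZ; exists (frob_norm (X - Z)), Z.
by exists 0 => _ [Z _ <-]; exact: sqrtr_ge0.
Qed.
Lemma dist_F_le X Z : A Z -> dist_F X A <= frob_norm (X - Z).
Proof. by move=> AZ; apply: ge_inf; [exact: (dist_F_has_inf X).2|exists Z]. Qed.
Lemma dist_F_ge0 X : 0 <= dist_F X A.
Proof.
by apply: lb_le_inf; [exact: (dist_F_has_inf X).1|move=> _ [Z _ <-]; exact: sqrtr_ge0].
Qed.
Lemma dist_F_adherent X e : 0 < e -> exists2 Z, A Z & frob_norm (X - Z) < dist_F X A + e.
Proof.
by move=> e0; have [_ [Z AZ <-] h] := inf_adherent e0 (dist_F_has_inf X); exists Z.
Qed.
Lemma dist_F_lipschitz X Y : `|dist_F X A - dist_F Y A| <= frob_norm (X - Y).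
Proof.
have h X' Y' : dist_F X' A <= dist_F Y' A + frob_norm (X' - Y').
  apply/ler_addgt0Pr => e e0; have [Z AZ h] := dist_F_adherent Y' e0.
  have a := dist_F_le X' AZ; have b := frob_norm_triangle Y' X' Z.
  rewrite (le_trans a)// (le_trans b)// addrC addrAC lerD2r.
  exact: ltW.
have := h X Y; have := h Y X; rewrite frob_normB.
move: (dist_F X A) (dist_F Y A) (frob_norm _) => a b c ? ?.
by rewrite ler_distl; apply/andP; split; lra.
Qed.
End Distance.

(** * Information about the active block *)

Section Information.
Variables (R : realType) (d q k : nat) (I : 'End(param R d q)) (U : 'M[R]_(q, k)).
Hypothesis sI : selfadjoint (@inner R d q) I.
Hypothesis pI : posdef (@inner R d q) I.
Hypothesis UU : U^T *m U = 1%:M.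

Let hi := inner_inner_product R d q.
Let hq := frob_inner_product R q.
Let hk := frob_inner_product R k.

Lemma info_blocks a A : I (a, A) =
  (info_psipsi I a + info_psisigma I A, info_sigmapsi I a + info_sigmasigma I A).
Proof.
have -> : (a, A) = inj_psi q a + inj_sigma d A :> param R d q.
  by congr pair; rewrite /= ?addr0 ?add0r.
rewrite linearD /=; rewrite !comp_lfunE !lfunE /= /proj_psi /proj_sigma.
by case: (I (inj_psi q a)) (I (inj_sigma d A)) => [? ?] [? ?].
Qed.

(** A kernel vector of a diagonal block would be isotropic for the whole form. *)
Lemma info_psipsi_lker : lker (info_psipsi I) == 0%VS.
Proof.
apply/eqP/vspaceP => x; rewrite memv_ker memv0.
have [->|x0] := eqVneq x 0; first by rewrite linear0 eqxx.
apply/eqP => Ix; have := pI (x := (x, 0) : param R d q).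
rewrite info_blocks innerE /= Ix !linear0 addr0 (ip0l hq) addr0 (ip0r (dot_inner_product R d)).
by rewrite ltxx => H; have /H : (x, 0) != 0 :> param R d q by apply: contra x0 => /eqP[->].
Qed.

(** The direction over [A] along which the information is least: the nuisance
    coordinate is the minimiser of the quadratic form for given [A]. *)
Definition least_favourable (A : symmx R q) : param R d q :=
  (- (info_psipsi I)^-1%VF (info_psisigma I A), A).

Lemma info_least_favourable A : I (least_favourable A) = (0, info_eff I A).
Proof.
rewrite info_blocks linearN /= (lker0_lfunVK info_psipsi_lker) addNr; congr pair.
rewrite linearN addrC /info_eff add_lfunE opp_lfunE; congr (_ - _).
by rewrite [RHS]comp_lfunE [RHS]comp_lfunE.
Qed.

Lemma info_eff_lker : lker (info_eff I) == 0%VS.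
Proof.
apply/eqP/vspaceP => A; rewrite memv_ker memv0.
have [->|A0] := eqVneq A 0; first by rewrite linear0 eqxx.
apply/eqP => IA; have := pI (x := least_favourable A).
rewrite info_least_favourable IA (ip0r hi) ltxx => H.
by have /H : least_favourable A != 0 by apply: contra A0 => /eqP[_ ->].
Qed.

(** The solution of [I v = (0, c)]. *)
Definition score_solution (c : symmx R q) : param R d q :=
  least_favourable ((info_eff I)^-1%VF c).

Lemma info_score_solution c : I (score_solution c) = (0, c).
Proof. by rewrite info_least_favourable (lker0_lfunVK info_eff_lker). Qed.

(** The representer, for the information, of the linear form
    [h |-> <active U h.2, b>]; see [inner_active_direction]. *)
Definition active_direction (b : symmx R k) : param R d q :=
  score_solution (active_adj U b).

Definition active_part (h : param R d q) : symmx R k := active U h.2.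

Lemma active_directionE b : I (active_direction b) = (0, active_adj U b).
Proof. exact: info_score_solution. Qed.

Lemma inner_active_direction b h :
  inner h (I (active_direction b)) = frob (active_part h) b.
Proof.
by rewrite active_directionE innerE /= (ip0r (dot_inner_product R d)) add0r active_adjP.
Qed.

Lemma cov_redE b : cov_red I U b = active_part (active_direction b).
Proof. by rewrite /cov_red !comp_lfunE. Qed.

Lemma cov_red_selfadjoint : selfadjoint (@frob R k) (cov_red I U).
Proof.
move=> b c; rewrite !cov_redE -inner_active_direction (ipC hk b).
by rewrite -inner_active_direction -sI (ipC hi).
Qed.

Lemma cov_red_posdef : posdef (@frob R k) (cov_red I U).
Proof.
move=> b b0; rewrite cov_redE (ipC hk) -inner_active_direction; apply: pI.
apply: contra b0 => /eqP v0; have := active_directionE b; rewrite v0 linear0 => -[] E.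
by rewrite -(active_adjK UU b) -E linear0.
Qed.

Let S := cov_red I U.
Let S0 := posdef_lker hk cov_red_posdef.

Lemma inv_cov_red_selfadjoint : selfadjoint (@frob R k) (S^-1)%VF.
Proof.
move=> b c; rewrite -{2}(lker0_lfunVK S0 b) -{1}(lker0_lfunVK S0 c).
by rewrite cov_red_selfadjoint.
Qed.

Lemma inv_cov_red_posdef : posdef (@frob R k) (S^-1)%VF.
Proof.
move=> b b0; rewrite -{1}(lker0_lfunVK S0 b) (ipC hk); apply: cov_red_posdef.
by apply: contra b0 => /eqP b0; rewrite -(lker0_lfunVK S0 b) b0 linear0.
Qed.

Let G := cov_red_inv_sqrt I U.

Lemma cov_red_inv_sqrtP : [/\ selfadjoint (@frob R k) G, posdef (@frob R k) G
  & forall b, G (G b) = S^-1%VF b].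
Proof.
have [sG pG GG] : [set G : 'End(symmx R k) | [/\ selfadjoint (@frob R k) G,
    posdef (@frob R k) G & (G \o G)%VF = S^-1%VF]] G.
  apply: xgetPex.
  exact: (exists_pd_sqrt hk inv_cov_red_selfadjoint inv_cov_red_posdef).
by split=> // b; rewrite -GG comp_lfunE.
Qed.

Lemma inv_sqrt_cov_red b : G (S (G b)) = b.
Proof.
have [_ pG GG] := cov_red_inv_sqrtP; have G0 := posdef_lker hk pG.
apply: (can_inj (lker0_lfunK G0)).
by rewrite GG (lker0_lfunK S0).
Qed.

Lemma frob_norm_inv_sqrt b : frob_norm (G b) ^+ 2 = frob b (S^-1%VF b).
Proof. by have [sG _ GG] := cov_red_inv_sqrtP; rewrite frob_norm_sqr sG GG. Qed.

(** The vector is [active_direction (S^-1 b)]; [info_ge_active] shows that it has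
    the least information among those with active part [b]. *)
Lemma active_solution b : exists2 v, active_part v = b & inner v (I v) = frob_norm (G b) ^+ 2.
Proof.
exists (active_direction (S^-1%VF b)); first by rewrite -cov_redE (lker0_lfunVK S0).
by rewrite inner_active_direction -cov_redE (lker0_lfunVK S0) frob_norm_inv_sqrt.
Qed.

(** Pythagoras: [v - v0] has active part zero, hence is orthogonal to the
    minimiser [v0] for the information. *)
Lemma info_ge_active v : frob_norm (G (active_part v)) ^+ 2 <= inner v (I v).
Proof.
set b := active_part v; pose v0 := active_direction (S^-1%VF b).
have v0b : active_part v0 = b by rewrite -cov_redE (lker0_lfunVK S0).
have v0E : inner v0 (I v0) = frob_norm (G b) ^+ 2.
  by rewrite inner_active_direction v0b frob_norm_inv_sqrt.
have o : inner (v - v0) (I v0) = 0.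
  rewrite inner_active_direction /active_part /= linearB /= -/(active_part v) -/(active_part v0).
  by rewrite v0b subrr (ip0l hk).
have w0 : 0 <= inner (v - v0) (I (v - v0)).
  by have [->|/pI/ltW//] := eqVneq (v - v0) 0; rewrite (ip0l hi).
rewrite -v0E -(subrK v0 v); move: (v - v0) o w0 => w o w0.
rewrite linearD /= (ipDl hi) !(ipDr hi) -(sI v0 w) (ipC hi (I v0) w) o addr0 add0r.
by rewrite lerDr.
Qed.

(** The image of the data [z] in the metric of the cones: the active part of the
    unconstrained maximiser [I^-1 z], rescaled by [S^(-1/2)]. *)
Definition reduced_score (z : param R d q) : symmx R k := G (active_part (I^-1%VF z)).

(** The quadratic approximation of the log-likelihood ratio. *)
Definition lan_quad (h z : param R d q) : R := inner h z - 2^-1 * inner h (I h).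

(** The supremum of [lan_quad h z] over the [h] with active part in [K]; see
    [lan_quad_le] and [lan_quad_adherent]. *)
Definition profile (K : set (symmx R k)) (z : param R d q) : R :=
  2^-1 * inner z (I^-1%VF z) - 2^-1 * dist_F (reduced_score z) (G @` K) ^+ 2.

Let I0 := posdef_lker hi pI.

(** Completing the square around the unconstrained maximiser [I^-1 z]. *)
Lemma lan_quadE h z : lan_quad h z = 2^-1 * inner z (I^-1%VF z) -
  2^-1 * inner (h - I^-1%VF z) (I (h - I^-1%VF z)).
Proof.
set x := I^-1%VF z; have zE : z = I x by rewrite /x (lker0_lfunVK I0).
rewrite /lan_quad zE linearB /= (ipBl hi) !(ipBr hi) -(sI x h) (ipC hi (I x) h) (ipC hi (I x) x).
move: (inner _ _) (inner _ _) (inner _ _) => a b c; lra.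
Qed.

Lemma reduced_scoreE h z : G (active_part (h - I^-1%VF z)) = G (active_part h) - reduced_score z.
Proof. by rewrite /reduced_score /active_part /= linearB /= linearB. Qed.

Lemma lan_quad_le K h z : K (active_part h) -> lan_quad h z <= profile K z.
Proof.
move=> Kh; rewrite lan_quadE /profile lerD2l lerN2 ler_pM2l ?invr_gt0//.
have GKh : (G @` K) (G (active_part h)) by exists (active_part h).
apply: le_trans (info_ge_active _); rewrite reduced_scoreE frob_normB.
have D0 : 0 <= dist_F (reduced_score z) (G @` K).
  by apply: dist_F_ge0; exists (G (active_part h)).
rewrite ler_pXn2r ?nnegrE ?frob_norm_ge0//.
by apply: dist_F_le => //; exists (G (active_part h)).
Qed.

(** A near-projection of the reduced score on the cone is lifted to a direction
    of least information. *)
Lemma lan_quad_adherent K z e : 0 < e -> K !=set0 ->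
  exists2 h, K (active_part h) & profile K z - e < lan_quad h z.
Proof.
move=> e0 [b0 Kb0]; have GK0 : (G @` K) !=set0 by exists (G b0), b0.
set D := dist_F (reduced_score z) (G @` K); have D0 : 0 <= D := dist_F_ge0 GK0 _.
(* With [eta <= 1] one has [(D + eta)^2 - D^2 <= eta (2 D + 1) <= e]. *)
pose eta := Num.min 1 (e / (2 * D + 1)).
have eta0 : 0 < eta by rewrite lt_min ltr01 divr_gt0//; lra.
have [_ [b Kb <-] h] := dist_F_adherent GK0 (reduced_score z) eta0.
have [v vb vE] := active_solution (b - active_part (I^-1%VF z)).
have hb : active_part (I^-1%VF z + v) = b.
  by rewrite /active_part /= linearD /= -/(active_part v) vb addrC subrK.
exists (I^-1%VF z + v); first by rewrite hb.
rewrite lan_quadE (addrC _ v) addrK vE /profile -/D linearB /= -/(reduced_score z) frob_normB.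
move: h (frob_norm_ge0 (reduced_score z - G b)); rewrite -/D.
move: (frob_norm _) (inner _ _) => t c tD t0.
have e1 : eta <= 1 by rewrite ge_min lexx.
have e2 : eta * (2 * D + 1) <= e by rewrite -ler_pdivlMr ?ge_min ?lexx ?orbT//; lra.
have : t ^+ 2 < (D + eta) ^+ 2 by rewrite ltr_pXn2r ?nnegrE//; lra.
move: eta eta0 e1 e2 tD => eta eta0 e1 e2 tD; nra.
Qed.

(** Coercivity: far from the origin the quadratic term dominates, so that a point
    that does not lose more than 1 against the origin is in a ball. *)
Lemma lan_quad_bounded (l : R) h z : 0 < l -> l * inner h h <= inner h (I h) ->
  -1 <= lan_quad h z -> enorm h <= 1 + 2 * (enorm z + 1) / l.
Proof.
move=> l0; rewrite -(ipnorm_sqr hi) -/(enorm h) /lan_quad => lh.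
have := le_trans (ler_norm _) (cauchy_schwarz hi h z).
have := ipnorm_ge0 (@inner R d q) h; have := ipnorm_ge0 (@inner R d q) z.
rewrite /ipnorm -!/(enorm _) in lh *.
move: (enorm h) (enorm z) (inner h z) (inner h (I h)) lh => a b c t lh a0 b0 cab q1.
have r0 : 0 <= 2 * (b + 1) / l by apply: divr_ge0; [lra|exact: ltW].
have [a1|a1] := leP a 1; first by rewrite (le_trans a1)// lerDl.
rewrite -[X in X <= _]add0r lerD// ler_pdivlMr//.
by rewrite -(ler_pM2l (lt_trans ltr01 a1)); nra.
Qed.

(** The limit of the likelihood-ratio statistic as a function of the reduced
    score. *)
Definition distance_lr (m : nat) (y : symmx R k) : R :=
  dist_F y (cone_D m I U) ^+ 2 - dist_F y (cone_C I U) ^+ 2.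

Lemma distance_lrE m z : distance_lr m (reduced_score z) =
  2 * (profile (@psd_cone R k) z - profile (@psd_rank R k m) z).
Proof.
rewrite /distance_lr /profile /cone_D /cone_C -/G.
move: (dist_F _ _) (dist_F _ _) (inner _ _) => a b c; lra.
Qed.

(** Coordinates of the reduced score are the coordinates of [z] along directions
    that are orthonormal for the information. *)
Lemma frob_reduced_score b z :
  frob b (reduced_score z) = inner (active_direction (G b)) z.
Proof.
have [sG _ _] := cov_red_inv_sqrtP.
rewrite /reduced_score -sG (ipC hk) -inner_active_direction -sI (lker0_lfunVK I0).
by rewrite (ipC hi).
Qed.

Lemma info_active_direction b :
  inner (active_direction (G b)) (I (active_direction (G b))) = frob b b.
Proof.
have [sG _ _] := cov_red_inv_sqrtP.
by rewrite inner_active_direction -cov_redE -sG inv_sqrt_cov_red.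
Qed.

Lemma info_active_direction_shift b h :
  inner (active_direction (G b)) (I h) = frob b (G (active_part h)).
Proof.
have [sG _ _] := cov_red_inv_sqrtP.
by rewrite -sI (ipC hi) inner_active_direction (ipC hk) sG.
Qed.

End Information.

(** * Topology of the parameter space *)

Section Topology.
Variables (R : realType) (d q : nat).
Let hi := inner_inner_product R d q.
Let hq := frob_inner_product R q.

Lemma nbhs_symmxP (x : symmx R q) (A : set (symmx R q)) :
  nbhs x A <-> exists2 e, 0 < e & forall y, frob_norm (y - x) < e -> A y.
Proof.
split.
  rewrite nbhsE => -[_ [[C Cop <-] Cx] CA].
  have /nbhs_ballP[e /= e0 eC] := open_nbhs_nbhs (conj Cop Cx).
  exists e => // y yx; apply/CA/eC; split=> // i j; rewrite /ball /=.
  rewrite distrC (le_lt_trans _ yx)//.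
  by rewrite (le_trans _ (entry_le_frob_norm _ i j))// linearB !mxE.
move=> [e e0 eA]; pose f := e / q.+1%:R.
have f0 : 0 < f by rewrite divr_gt0.
have nx : nbhs x (@symval R q @^-1` ball (symval x) f).
  by apply: (@initial_continuous _ _ (@symval R q) x); exact: nbhsx_ballx.
apply: filterS nx => y [_ yx]; apply: eA.
have f2 i j : symval (y - x) i j ^+ 2 <= f ^+ 2.
  rewrite linearB !mxE -(real_normK (num_real _)) ler_pXn2r ?nnegrE ?(ltW f0)//.
  by rewrite distrC; exact/ltW/yx.
rewrite -(ltr_pXn2r (n := 2)) ?nnegrE ?frob_norm_ge0 ?ltW// frob_norm_sqr frobE.
apply: (@le_lt_trans _ _ (\sum_(i < q) \sum_(j < q) f ^+ 2)).
  by apply: ler_sum => i _; apply: ler_sum => j _; rewrite -expr2.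
rewrite !sumr_const !card_ord -mulrnA -mulr_natr natrM -expr2.
rewrite /f expr_div_n mulrAC ltr_pdivrMr ?exprn_gt0// ltr_pM2l ?exprn_gt0//.
by rewrite ltr_pXn2r ?nnegrE ?ler0n// ltr_nat.
Qed.

Lemma nbhs_cVP (x : 'cV[R]_d) (A : set 'cV[R]_d) :
  nbhs x A <-> exists2 e, 0 < e & forall y, ipnorm (@dot R d) (y - x) < e -> A y.
Proof.
split.
  move=> /nbhs_ballP[e /= e0 eC].
  exists e => // y yx; apply/eC; split=> // i j; rewrite /ball /= ord1.
  rewrite distrC (le_lt_trans _ yx)//.
  by rewrite (le_trans _ (entry_le_dot_norm _ i))// !mxE.
move=> [e e0 eA]; pose f := e / d.+1%:R.
have f0 : 0 < f by rewrite divr_gt0.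
have : nbhs x (ball x f) by exact: nbhsx_ballx.
apply: filterS => y [_ yx]; apply: eA.
have f2 i : (y - x) i 0 ^+ 2 <= f ^+ 2.
  rewrite !mxE -(real_normK (num_real _)) ler_pXn2r ?nnegrE ?(ltW f0)//.
  by rewrite distrC; exact/ltW/yx.
rewrite -(ltr_pXn2r (n := 2)) ?nnegrE ?ipnorm_ge0 ?ltW// (ipnorm_sqr (dot_inner_product R d)) dotE.
apply: (@le_lt_trans _ _ (\sum_(i < d) f ^+ 2)).
  by apply: ler_sum => i _; rewrite -expr2.
rewrite !sumr_const !card_ord -mulr_natr /f expr_div_n mulrAC ltr_pdivrMr ?exprn_gt0//.
rewrite ltr_pM2l ?exprn_gt0// -natrX ltr_nat; lia.
Qed.

Lemma enorm_sqr (x : param R d q) : enorm x ^+ 2 = dot x.1 x.1 + frob x.2 x.2.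
Proof. exact: (ipnorm_sqr hi). Qed.
Lemma enorm_ge0 (x : param R d q) : 0 <= enorm x. Proof. exact: sqrtr_ge0. Qed.

Lemma nbhs_paramP (x : param R d q) (A : set (param R d q)) :
  nbhs x A <-> exists2 e, 0 < e & forall y, enorm (y - x) < e -> A y.
Proof.
have hd := dot_inner_product R d; split.
  move=> [[P Q] [/= /nbhs_cVP[e1 e10 P1] /nbhs_symmxP[e2 e20 Q2]] PQ].
  exists (Num.min e1 e2); first by rewrite lt_min e10.
  move=> y; rewrite lt_min => /andP[y1 y2].
  apply: PQ; split; [apply: P1|apply: Q2].
    by apply: le_lt_trans y1; rewrite ler_wsqrtr// innerE lerDl (ip_ge0 hq).
  by apply: le_lt_trans y2; rewrite ler_wsqrtr// innerE lerDr (ip_ge0 hd).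
move=> [e e0 eA]; exists ([set a | ipnorm (@dot R d) (a - x.1) < e / 2],
    [set B | frob_norm (B - x.2) < e / 2]).
  split=> /=; first by apply/nbhs_cVP; exists (e / 2) => //; rewrite divr_gt0.
  by apply/nbhs_symmxP; exists (e / 2) => //; rewrite divr_gt0.
move=> y [/= y1 y2]; apply: eA.
rewrite -(ltr_pXn2r (n := 2)) ?nnegrE ?enorm_ge0 ?ltW// enorm_sqr.
rewrite -(ipnorm_sqr hd) -(ipnorm_sqr hq).
have := ipnorm_ge0 (@dot R d) (y - x).1; have := ipnorm_ge0 (@frob R q) (y - x).2.
move: y1 y2; rewrite /frob_norm -/(ipnorm _ _) /=.
move: (ipnorm _ _) (ipnorm _ _) => a b; nra.
Qed.

End Topology.

Section Continuity.
Variables (R : realType) (d q : nat).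
Let hi := inner_inner_product R d q.
Let hq := frob_inner_product R q.

Lemma continuous_symmxP (F : symmx R q -> R) : continuous F <->
  forall x e, 0 < e -> exists2 t, 0 < t & forall y, frob_norm (y - x) < t -> `|F y - F x| < e.
Proof.
split=> [cF x e e0|h x].
  have : nbhs x [set y | `|F y - F x| < e].
    have /cvgrPdist_lt/(_ e e0) := cF x.
    by apply: filterS => y /=; rewrite distrC.
  by move=> /nbhs_symmxP.
move=> A /nbhs_ballP[e /= e0 eA]; apply/nbhs_symmxP; have [t t0 ht] := h x e e0.
by exists t => // y /ht yx; apply: eA; rewrite /ball /= distrC.
Qed.

Lemma continuous_paramP (F : param R d q -> R) : continuous F <->
  forall x e, 0 < e -> exists2 t, 0 < t & forall y, enorm (y - x) < t -> `|F y - F x| < e.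
Proof.
split=> [cF x e e0|h x].
  have : nbhs x [set y | `|F y - F x| < e].
    have /cvgrPdist_lt/(_ e e0) := cF x.
    by apply: filterS => y /=; rewrite distrC.
  by move=> /nbhs_paramP.
move=> A /nbhs_ballP[e /= e0 eA]; apply/nbhs_paramP; have [t t0 ht] := h x e e0.
by exists t => // y /ht yx; apply: eA; rewrite /ball /= distrC.
Qed.

Lemma lipschitz_symmx (F : symmx R q -> R) (C : R) :
  (forall x y, `|F y - F x| <= C * frob_norm (y - x)) -> continuous F.
Proof.
move=> h; apply/continuous_symmxP => x e e0; exists (e / (`|C| + 1)).
  by rewrite divr_gt0// ltr_wpDl.
move=> y; rewrite ltr_pdivlMr ?ltr_wpDl// => yx; rewrite (le_lt_trans (h x y))//.
apply: le_lt_trans yx; rewrite mulrC ler_wpM2l ?frob_norm_ge0//.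
by rewrite (le_trans (ler_norm _))// lerDl.
Qed.

Lemma lipschitz_param (F : param R d q -> R) (C : R) :
  (forall x y, `|F y - F x| <= C * enorm (y - x)) -> continuous F.
Proof.
move=> h; apply/continuous_paramP => x e e0; exists (e / (`|C| + 1)).
  by rewrite divr_gt0// ltr_wpDl.
move=> y; rewrite ltr_pdivlMr ?ltr_wpDl// => yx; rewrite (le_lt_trans (h x y))//.
apply: le_lt_trans yx; rewrite mulrC ler_wpM2l ?enorm_ge0//.
by rewrite (le_trans (ler_norm _))// lerDl.
Qed.

Lemma frob_continuous (t : symmx R q) : continuous (frob t).
Proof.
apply: (@lipschitz_symmx _ (frob_norm t)) => x y.
by rewrite -(ipBr hq); exact: (cauchy_schwarz hq).
Qed.

Lemma inner_continuous (h : param R d q) : continuous (inner h).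
Proof.
apply: (@lipschitz_param _ (enorm h)) => x y.
by rewrite -(ipBr hi); exact: (cauchy_schwarz hi).
Qed.

Lemma enorm_triangle (y x z : param R d q) : enorm (x - z) <= enorm (x - y) + enorm (y - z).
Proof. exact: (ipnorm_triangle hi). Qed.
Lemma enormB (x y : param R d q) : enorm (x - y) = enorm (y - x).
Proof. exact: (ipnormB hi). Qed.
Lemma enormD (x y : param R d q) : enorm (x + y) <= enorm x + enorm y.
Proof. exact: (ipnormD hi). Qed.
Lemma enormZ a (x : param R d q) : enorm (a *: x) = `|a| * enorm x.
Proof. exact: (ipnormZ hi). Qed.
Lemma enorm0 : enorm (0 : param R d q) = 0.
Proof. exact: (ipnorm0 hi). Qed.
Lemma inner_le (x y : param R d q) : `|inner x y| <= enorm x * enorm y.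
Proof. exact: (cauchy_schwarz hi). Qed.

Lemma enorm_continuous : continuous (@enorm R d q).
Proof.
apply: (@lipschitz_param _ 1) => x y; rewrite mul1r.
have := enormD (y - x) x; have := enormD (x - y) y; rewrite !subrK (enormB x y).
move: (enorm x) (enorm y) (enorm _) => a b c ? ?.
by rewrite ler_norml; apply/andP; split; lra.
Qed.

End Continuity.

Lemma linear_param_symmx_continuous (R : realType) (d q k : nat)
  (L : {linear param R d q -> symmx R k}) : continuous (L : param R d q -> symmx R k).
Proof.
have [C C0 hC] := linear_bounded L (inner_inner_product R d q) (frob_inner_product R k).
move=> x A /nbhs_symmxP[e e0 eA]; apply/nbhs_paramP; exists (e / C); first by rewrite divr_gt0.
move=> y; rewrite ltr_pdivlMr// mulrC => yx; apply: eA; rewrite -linearB.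
exact: le_lt_trans (hC _) yx.
Qed.

Lemma dist_F_continuous (R : realType) (q : nat) (A : set (symmx R q)) :
  A !=set0 -> continuous (fun x => dist_F x A).
Proof.
move=> A0; apply: (@lipschitz_symmx _ _ _ 1) => x y; rewrite mul1r.
exact: dist_F_lipschitz.
Qed.

Lemma random_element_measurable (R : realType) (S : topologicalType)
    (dT : measure_display) (T : measurableType dT) (X : T -> S) (F : S -> R) :
  random_element X -> continuous F -> measurable_fun setT (fun w => F (X w)).
Proof.
move=> rX /continuousP cF; apply: (measurability _ (measurable_realfun.RGenOInfty.measurableE R)).
move=> _ [_ [x ->] <-]; rewrite setTI.
have -> : (fun w => F (X w)) @^-1` `]x, +oo[%classic = X @^-1` (F @^-1` `]x, +oo[%classic) by [].
exact/rX/cF/interval_open.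
Qed.

(** The closed ball is contained in the image of a cube under the coordinates of
    an orthonormal basis. *)
Lemma eball_compact (R : realType) (d q : nat) (M : R) :
  exists2 C : set (param R d q), compact C & @eball R d q M `<=` C.
Proof.
have hi := inner_inner_product R d q.
have [e [eo eb]] := exists_orthonormal_basis hi.
set n := \dim _ in e eo eb.
pose f (v : 'rV[R]_n) : param R d q := \sum_i v 0 i *: e i.
have cf : continuous f.
  move=> v A /nbhs_paramP[r r0 rA]; apply/nbhs_ballP; exists (r / n.+1%:R) => /=.
    by rewrite divr_gt0.
  move=> w [_ vw]; apply: rA; rewrite /f -sumrB.
  rewrite (le_lt_trans (ipnorm_sum _ _ hi))//.
  apply: (@le_lt_trans _ _ (\sum_(i < n) (r / n.+1%:R))).
    apply: ler_sum => i _; rewrite -scalerBl (ipnormZ hi) /ipnorm eo eqxx sqrtr1 mulr1.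
    by rewrite distrC; exact/ltW/vw.
  rewrite sumr_const card_ord -[_ *+ n]mulr_natr mulrAC ltr_pdivrMr//.
  by rewrite ltr_pM2l// ltr_nat.
exists (f @` [set v : 'rV[R]_n | forall i, `[-M, M]%classic (v 0 i)]).
  apply: continuous_compact; first exact: continuous_subspaceT.
  have := @rV_compact R n (fun=> `[-M, M]%classic) (fun=> @segment_compact R (-M) M); exact.
move=> x /= xM; exists (\row_i inner x (e i)) => /=.
  move=> i; rewrite mxE /= in_itv /= -ler_norml (le_trans (cauchy_schwarz hi _ _))//.
  by rewrite {2}/ipnorm eo eqxx sqrtr1 mulr1.
by rewrite /f [RHS]eb; apply: eq_bigr => i _; rewrite mxE.
Qed.

(** * Laplace transforms determine laws *)

(** Two weighted laws on [S] are compared through the class of continuous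
    functions that they integrate to the same finite value. *)
Section EqualIntegrals.
Variables (R : realType) (S : topologicalType).
Variables (d1 : measure_display) (T1 : measurableType d1) (P1 : {measure set T1 -> \bar R}).
Variables (d2 : measure_display) (T2 : measurableType d2) (P2 : {measure set T2 -> \bar R}).
Variables (X1 : T1 -> S) (X2 : T2 -> S) (w1 : T1 -> R) (w2 : T2 -> R).
Hypothesis (rX1 : random_element X1) (rX2 : random_element X2).
Hypothesis (mw1 : measurable_fun setT w1) (mw2 : measurable_fun setT w2).
Hypothesis (w10 : forall t, 0 <= w1 t) (w20 : forall t, 0 <= w2 t).

Definition same_integral (F : S -> R) : Prop :=
  [/\ continuous F,
    P1.-integrable setT (fun t => (F (X1 t) * w1 t)%:E),
    P2.-integrable setT (fun t => (F (X2 t) * w2 t)%:E) &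
    (\int[P1]_t (F (X1 t) * w1 t)%:E = \int[P2]_t (F (X2 t) * w2 t)%:E)%E].

Lemma same_integralZ a F : same_integral F -> same_integral (fun x => a * F x).
Proof.
move=> [cF i1 i2 e]; split.
- by move=> x; apply: cvgM; [exact: cvg_cst|exact: cF].
- under eq_fun do rewrite -mulrA EFinM; exact: integrableZl.
- under eq_fun do rewrite -mulrA EFinM; exact: integrableZl.
- under eq_integral do rewrite -mulrA EFinM.
  under [RHS]eq_integral do rewrite -mulrA EFinM.
  by rewrite !integralZl// e.
Qed.

Lemma same_integralD F G : same_integral F -> same_integral G ->
  same_integral (fun x => F x + G x).
Proof.
move=> [cF i1 i2 e] [cG j1 j2 e']; split.
- by move=> x; apply: cvgD; [exact: cF|exact: cG].
- under eq_fun do rewrite mulrDl EFinD; exact: integrableD.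
- under eq_fun do rewrite mulrDl EFinD; exact: integrableD.
- under eq_integral do rewrite mulrDl EFinD.
  under [RHS]eq_integral do rewrite mulrDl EFinD.
  by rewrite !integralD// e e'.
Qed.

Lemma eq_same_integral F G : F =1 G -> same_integral F -> same_integral G.
Proof. by move=> /funext ->. Qed.

Lemma same_integralB F G : same_integral F -> same_integral G ->
  same_integral (fun x => F x - G x).
Proof.
move=> hF hG; apply: (@eq_same_integral (fun x => F x + (-1) * G x)).
  by move=> x; rewrite mulN1r.
by apply: same_integralD => //; exact: same_integralZ.
Qed.

(** The closure property behind all the approximations below. *)
Lemma same_integral_dominated (F_ : nat -> S -> R) (F D : S -> R) :
  (forall m, same_integral (F_ m)) -> continuous F -> same_integral D ->
  (forall x, F_ ^~ x @ \oo --> F x) -> (forall m x, `|F_ m x| <= D x) ->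
  same_integral F.
Proof.
move=> hF cF [cD iD1 iD2 eD] FF FD.
have main d (T : measurableType d) (P : {measure set T -> \bar R}) (X : T -> S) (w : T -> R) :
    random_element X -> measurable_fun setT w -> (forall t, 0 <= w t) ->
    P.-integrable setT (fun t => (D (X t) * w t)%:E) ->
    P.-integrable setT (fun t => (F (X t) * w t)%:E) /\
    (fun m => \int[P]_t (F_ m (X t) * w t)%:E)%E @ \oo --> (\int[P]_t (F (X t) * w t)%:E)%E.
  move=> rX mw w0 iD.
  have mF (G : S -> R) : continuous G -> measurable_fun setT (fun t => G (X t) * w t).
    move=> cG; apply/measurable_funM => //.
    exact: random_element_measurable rX cG.
  have [] := @dominated_convergence _ _ _ P setT measurableT
    (fun m t => (F_ m (X t) * w t)%:E) (fun t => (F (X t) * w t)%:E)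
    (fun t => (D (X t) * w t)%:E) _ _ _ iD.
  - by move=> m; apply/measurable_EFinP/mF; have [] := hF m.
  - exact/measurable_EFinP/mF.
  - apply: aeW => t _; apply: cvg_EFin; first exact: nearW.
    by apply: cvgM; [exact: FF|exact: cvg_cst].
  - apply: aeW => t m _; rewrite /= lee_fin normrM (ger0_norm (w0 t)).
    by rewrite ler_wpM2r.
  by move=> ? _ ?; split.
have [i1 c1] := main _ _ P1 X1 w1 rX1 mw1 w10 iD1.
have [i2 c2] := main _ _ P2 X2 w2 rX2 mw2 w20 iD2.
split=> //; have E : (fun m => \int[P1]_t (F_ m (X1 t) * w1 t)%:E)%E =
    (fun m => \int[P2]_t (F_ m (X2 t) * w2 t)%:E)%E.
  by apply/funext => m; have [_ _ _ ->] := hF m.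
by rewrite E in c1; rewrite -(cvg_lim _ c1)// -(cvg_lim _ c2).
Qed.

End EqualIntegrals.

Section ElementaryLimits.
Variable R : realType.
Implicit Types u : R.

Lemma cvg_scaled_harmonic u : (fun m : nat => u / m.+1%:R) @ \oo --> (0 : R).
Proof. by rewrite -[0](mulr0 u); apply: cvgM; [exact: cvg_cst|exact: cvg_harmonic]. Qed.

(** Differences are taken along the sequence [u / (m + 1)], as dominated
    convergence is used for sequences. *)
Lemma cvg_difference_quotient (f : R -> R) (l u : R) : is_derive (0 : R) 1 f l ->
  (fun m : nat => m.+1%:R * (f (u / m.+1%:R) - f 0)) @ \oo --> u * l.
Proof.
move=> [df dE]; have [->|u0] := eqVneq u 0.
  by rewrite mul0r; under eq_fun do rewrite mul0r subrr mulr0; exact: cvg_cst.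
have /cvgr_dnbhsP/(_ (fun m : nat => u / m.+1%:R)) := df.
rewrite -/(derive f 0 1) dE => H.
have {}H := H (conj (fun n => mulf_neq0 u0 (invr_neq0 (lt0r_neq0 (ltr0Sn R n))))
  (cvg_scaled_harmonic u)).
apply: cvg_trans; last exact: (cvgM (cvg_cst u) H).
apply: near_eq_cvg; apply: nearW => m /=.
rewrite /GRing.scale /= mulr1 addr0 invf_div mulrA; congr (_ * _).
by rewrite mulrCA divff// mulr1.
Qed.

Lemma normr_expR_sub1 u : `|expR u - 1| <= `|u| * expR `|u|.
Proof.
have e1 := expR_ge1Dx u; have e2 := expR_ge1Dx (- u).
have e3 : expR u <= expR `|u| by rewrite ler_expR ler_norm.
have e4 : 1 <= expR `|u| by have := expR_ge1Dx `|u|; have := normr_ge0 u; lra.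
have e5 : 0 < expR u := expR_gt0 u.
have e6 : expR u * expR (- u) = 1 := expRxMexpNx_1 u.
have [u0|u0] := leP 0 u.
  rewrite ger0_norm; last lra.
  rewrite (ger0_norm u0) in e3 e4 *; nra.
rewrite ler0_norm; last by have := expR_lt1 u; rewrite u0; lra.
rewrite (ltr0_norm u0) in e3 e4 *; nra.
Qed.

Lemma expR_norm_le u : expR `|u| <= expR u + expR (- u).
Proof.
have [u0|u0] := leP 0 u; first by rewrite ger0_norm// lerDl expR_ge0.
by rewrite ltr0_norm// lerDr expR_ge0.
Qed.

Lemma normr_exprn_le u n : `|u| ^+ n.+1 <= n.+1`!%:R * expR `|u|.
Proof.
have := expR_ge1Dxn n (normr_ge0 u) => h.
rewrite mulrC -ler_pdivrMr ?ltr0n ?fact_gt0//; lra.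
Qed.

Lemma series_exp_coeff_le u n : 0 <= u -> series (exp_coeff u) n <= expR u.
Proof.
move=> u0; rewrite /expR; apply: nondecreasing_cvgn_le; last exact: is_cvg_series_exp_coeff.
by apply/nondecreasing_seqP => k; rewrite !seriesEnat /= big_nat_recr//= lerDl exp_coeff_ge0.
Qed.

Lemma series_trig_coeff_le (c : nat -> R) u n : (forall i, `|c i| <= 1) ->
  `|\sum_(i < n) c i * u ^+ i / i`!%:R| <= expR `|u|.
Proof.
move=> c1; apply: le_trans (series_exp_coeff_le n (normr_ge0 u)).
rewrite seriesEord (le_trans (ler_norm_sum _ _ _))//; apply: ler_sum => i _.
rewrite /exp_coeff /= !normrM normfV normrX (@ger0_norm _ (_`!%:R))// ler_wpM2r//.
by rewrite -[X in _ <= X]mul1r ler_wpM2r// exprn_ge0.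
Qed.

End ElementaryLimits.

(** Bernstein polynomials of functions of [n] variables are expectations over [n]
    families of [m] independent coins, the coins of family [i] having bias [y i].
    Their convergence is the weak law of large numbers. *)
Definition coins (n m : nat) : finType := {ffun 'I_n * 'I_m -> bool}.

Section CoinFlips.
Variables (R : realType) (n m : nat) (y : 'I_n -> R).

Definition coin_weight (s : coins n m) : R :=
  \prod_j (if s j then y j.1 else 1 - y j.1).

Definition coin_mean (s : coins n m) (i : 'I_n) : R :=
  (\sum_(l < m) (s (i, l))%:R) / m%:R.

(** Independence of the coins is the distributivity of products over sums. *)
Lemma coin_expectation_prod (g : 'I_n * 'I_m -> bool -> R) :
  \sum_(s : coins n m) (\prod_j g j (s j)) * coin_weight s =
  \prod_j (g j true * y j.1 + g j false * (1 - y j.1)).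
Proof.
rewrite (eq_bigr (fun s : coins n m =>
  \prod_j (g j (s j) * (if s j then y j.1 else 1 - y j.1)))); last first.
  by move=> s _; rewrite big_split.
rewrite -(bigA_distr_bigA (fun j b => g j b * (if b then y j.1 else 1 - y j.1))).
by apply: eq_bigr => j _; rewrite big_bool.
Qed.

Lemma coin_weight_sum : \sum_(s : coins n m) coin_weight s = 1.
Proof.
have E := coin_expectation_prod (fun _ _ => 1).
transitivity (\prod_(j : 'I_n * 'I_m) (1 * y j.1 + 1 * (1 - y j.1))).
  rewrite -E; apply: eq_bigr => s _; rewrite [X in X * _](_ : _ = 1) ?mul1r//.
  by rewrite big1.
by rewrite big1// => j _; rewrite !mul1r addrC subrK.
Qed.

Lemma coin_covariance i l l' : l != l' ->
  \sum_(s : coins n m) ((s (i, l))%:R - y i) * ((s (i, l'))%:R - y i) * coin_weight s = 0.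
Proof.
move=> ll'.
pose z (a j : 'I_n * 'I_m) (b : bool) : R := if j == a then b%:R - y i else 1.
have zE a (s : coins n m) : \prod_(j : 'I_n * 'I_m) z a j (s j) = (s a)%:R - y i.
  rewrite (bigD1 a)//= /z eqxx big1 ?mulr1// => j /negbTE ja.
  by rewrite ja.
rewrite (eq_bigr (fun s : coins n m =>
  (\prod_(j : 'I_n * 'I_m) (z (i, l) j (s j) * z (i, l') j (s j))) * coin_weight s)); last first.
  by move=> s _; rewrite big_split /= !zE.
rewrite (coin_expectation_prod (fun j b => z (i, l) j b * z (i, l') j b)) (bigD1 (i, l))//=.
rewrite /z eqxx xpair_eqE eqxx (negbTE ll') /= !mulr1.
by rewrite [X in X * _](_ : _ = 0) ?mul0r//; ring.
Qed.

Hypothesis y01 : forall i, 0 <= y i <= 1.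

Lemma coin_weight_ge0 s : 0 <= coin_weight s.
Proof.
apply: prodr_ge0 => j _; have /andP[y0 y1] := y01 j.1.
by case: ifP => // _; rewrite subr_ge0.
Qed.

(** The variance of a coin is at most 1 and distinct coins are uncorrelated. *)
Lemma coin_variance i : (0 < m)%N ->
  \sum_(s : coins n m) (coin_mean s i - y i) ^+ 2 * coin_weight s <= m%:R^-1.
Proof.
move=> m0; have m0' : (0 : R) < m%:R by rewrite ltr0n.
have E s : (coin_mean s i - y i) ^+ 2 * coin_weight s = (m%:R ^+ 2)^-1 *
    \sum_(l < m) \sum_(l' < m)
      ((s (i, l))%:R - y i) * ((s (i, l'))%:R - y i) * coin_weight s.
  have -> : coin_mean s i - y i = (\sum_(l < m) ((s (i, l))%:R - y i)) / m%:R.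
    rewrite sumrB sumr_const card_ord mulrBl -[y i *+ m]mulr_natr mulfK//.
    by rewrite gt_eqF.
  rewrite expr_div_n -mulrA mulrC -mulrA [coin_weight s * _]mulrC; congr (_ * _).
  rewrite expr2 -mulrA mulr_suml; apply: eq_bigr => l _.
  by rewrite mulrA mulr_sumr mulr_suml.
rewrite (eq_bigr _ (fun s _ => E s)) -mulr_sumr exchange_big /=.
rewrite [X in _ * X](_ : _ = \sum_(l < m) \sum_(s : coins n m) ((s (i, l))%:R - y i) ^+ 2 * coin_weight s); last first.
  apply: eq_bigr => l _; rewrite exchange_big /= (bigD1 l)//= [X in _ + X]big1 ?addr0//.
  by move=> l' ll'; rewrite coin_covariance// eq_sym.
rewrite mulrC ler_pdivrMr ?exprn_gt0// expr2 mulrA mulVf ?gt_eqF// mul1r.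
have -> : m%:R = \sum_(l < m) (1 : R) by rewrite sumr_const card_ord.
apply: ler_sum => l _; rewrite -[X in _ <= X]coin_weight_sum; apply: ler_sum => s _.
rewrite -[X in _ <= X]mul1r ler_wpM2r ?coin_weight_ge0//.
have /andP[y0 y1] := y01 i; case: (s _) => /=; nra.
Qed.

(** Chebyshev's inequality in the form [|phi x - phi y| <= e + 2 M |x - y|^2 / t^2]. *)
Lemma bernstein_error (phi : ('I_n -> R) -> R) (M e t : R) : (0 < m)%N ->
  (forall x, `|phi x| <= M) -> 0 < t -> 0 <= e ->
  (forall x, (forall i, `|x i - y i| < t) -> `|phi x - phi y| <= e) ->
  `|\sum_(s : coins n m) phi (coin_mean s) * coin_weight s - phi y| <=
    e + 2 * M / t ^+ 2 * n%:R / m%:R.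
Proof.
move=> m0 phiM t0 e0 pe.
have M0 : 0 <= M := le_trans (normr_ge0 _) (phiM y).
have K0 : 0 <= 2 * M / t ^+ 2 by rewrite divr_ge0 ?exprn_ge0 ?mulr_ge0// ltW.
have key x : `|phi x - phi y| <= e + 2 * M / t ^+ 2 * \sum_i (x i - y i) ^+ 2.
  have [xy|/existsNP[i /negP]] := pselect (forall i, `|x i - y i| < t).
    rewrite (le_trans (pe x xy))// lerDl mulr_ge0// sumr_ge0// => i _.
    exact: sqr_ge0.
  rewrite -leNgt => ti; rewrite -[X in X <= _]add0r lerD//.
  apply: (@le_trans _ _ (2 * M)).
    rewrite (le_trans (ler_normB _ _))// mulr_natl mulr2n lerD//.
  rewrite -mulrA ler_peMr ?mulr_ge0// mulrC ler_pdivlMr ?exprn_gt0// mul1r.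
  rewrite (bigD1 i)//= -[X in X <= _]addr0 lerD//.
    by rewrite -[X in _ <= X]real_normK ?num_real// ler_pXn2r// nnegrE ltW.
  by apply: sumr_ge0 => j _; exact: sqr_ge0.
have -> : phi y = \sum_(s : coins n m) phi y * coin_weight s by rewrite -mulr_sumr coin_weight_sum mulr1.
rewrite -sumrB (le_trans (ler_norm_sum _ _ _))//.
apply: (@le_trans _ _ (\sum_(s : coins n m) (e * coin_weight s + 2 * M / t ^+ 2 *
    \sum_i (coin_mean s i - y i) ^+ 2 * coin_weight s))).
  apply: ler_sum => s _; rewrite -mulrBl normrM (ger0_norm (coin_weight_ge0 s)).
  by rewrite -mulr_suml mulrA -mulrDl ler_wpM2r ?coin_weight_ge0.
rewrite big_split /= -!mulr_sumr coin_weight_sum mulr1 lerD2l exchange_big /=.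
rewrite -!mulrA; do 3 (rewrite ler_wpM2l ?invr_ge0 ?exprn_ge0 ?(ltW t0)//).
rewrite mulr_natl -[n in _ *+ n]card_ord -sumr_const; apply: ler_sum => i _.
exact: coin_variance.
Qed.

End CoinFlips.

Section LaplaceUniqueness.
Variables (R : realType) (k : nat).
Variables (d1 : measure_display) (T1 : measurableType d1) (P1 : {measure set T1 -> \bar R}).
Variables (d2 : measure_display) (T2 : measurableType d2) (P2 : {measure set T2 -> \bar R}).
Variables (X1 : T1 -> symmx R k) (X2 : T2 -> symmx R k) (w1 : T1 -> R) (w2 : T2 -> R).
Hypothesis (rX1 : random_element X1) (rX2 : random_element X2).
Hypothesis (mw1 : measurable_fun setT w1) (mw2 : measurable_fun setT w2).
Hypothesis (w10 : forall t, 0 <= w1 t) (w20 : forall t, 0 <= w2 t).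
Let H := same_integral P1 P2 X1 X2 w1 w2.
Hypothesis laplace : forall t, H (fun x => expR (frob t x)).

Let hk := frob_inner_product R k.
Let HD := @same_integral_dominated _ _ _ _ P1 _ _ P2 _ _ _ _ rX1 rX2 mw1 mw2 w10 w20.

Lemma continuous_frob_comp (f : R -> R) t : continuous f -> continuous (fun x : symmx R k => f (frob t x)).
Proof. by move=> cf x; apply: continuous_comp; [exact: frob_continuous|exact: cf]. Qed.

Lemma same_integral_expR t a : H (fun x => expR (a * frob t x)).
Proof.
apply: eq_same_integral (laplace (a *: t)) => x.
by rewrite (ipZl hk).
Qed.

Lemma same_integral_cst c : H (fun=> c).
Proof.
apply: eq_same_integral (same_integralZ c (same_integral_expR 0 0)) => x.
by rewrite mul0r expR0 mulr1.
Qed.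

Lemma same_integral_expR_norm t a c : H (fun x => c * (expR (a * frob t x) + expR (- (a * frob t x)))).
Proof.
apply: same_integralZ; apply: same_integralD; first exact: same_integral_expR.
by apply: eq_same_integral (same_integral_expR t (- a)) => x; rewrite mulNr.
Qed.

Lemma same_integral_sum n (F : 'I_n -> symmx R k -> R) : (forall i, H (F i)) ->
  H (fun x => \sum_i F i x).
Proof.
elim: n F => [|n IH] F hF.
  by apply: eq_same_integral (same_integral_cst 0) => x; rewrite big_ord0.
have h := same_integralD (hF ord0) (IH (fun i => F (lift ord0 i)) (fun i => hF (lift ord0 i))).
by apply: eq_same_integral h => x; rewrite big_ord_recl.
Qed.

(** Powers are derivatives of exponentials: [u^(j+1) e^(a u)] is the limit of
    the difference quotients of [a |-> u^j e^(a u)]. *)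
Lemma same_integral_power_expR t j a : H (fun x => frob t x ^+ j * expR (a * frob t x)).
Proof.
elim: j a => [|j IH] a.
  by apply: eq_same_integral (same_integral_expR t a) => x; rewrite expr0 mul1r.
pose F_ m x := m.+1%:R * (frob t x ^+ j * expR ((a + m.+1%:R^-1) * frob t x)
  - frob t x ^+ j * expR (a * frob t x)).
have F_E m x : F_ m x = frob t x ^+ j * expR (a * frob t x) *
    (m.+1%:R * (expR (frob t x / m.+1%:R) - expR 0)).
  rewrite /F_ mulrDl expRD [_^-1 * _]mulrC expR0; ring.
apply: (@HD F_ _ (fun x => j.+1`!%:R * (expR ((2 + `|a|) * frob t x) +
    expR (- ((2 + `|a|) * frob t x))))).
- by move=> m; exact: (same_integralZ m.+1%:R (same_integralB (IH _) (IH a))).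
- apply: (@continuous_frob_comp (fun u => u ^+ j.+1 * expR (a * u))) => u.
  apply: cvgM; first exact: exprn_continuous.
  apply: continuous_comp; last exact: continuous_expR.
  by apply: cvgM; [exact: cvg_cst|exact: cvg_id].
- exact: same_integral_expR_norm.
- move=> x; under eq_fun do rewrite F_E.
  have -> : frob t x ^+ j.+1 * expR (a * frob t x) =
    frob t x ^+ j * expR (a * frob t x) * (frob t x * expR 0) by rewrite expR0 exprS; ring.
  apply: cvgM; first exact: cvg_cst.
  exact: cvg_difference_quotient.
- move=> m x; rewrite F_E expR0; move: (frob t x) => u.
  apply: (@le_trans _ _ (j.+1`!%:R * expR `|(2 + `|a|) * u|)); last first.
    by rewrite ler_wpM2l// expR_norm_le.
  rewrite !normrM (ger0_norm (expR_ge0 _)) normrX (@ger0_norm _ m.+1%:R)//.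
  apply: (@le_trans _ _ (`|u| ^+ j * expR (a * u) * (`|u| * expR `|u|))).
    rewrite ler_wpM2l ?mulr_ge0 ?exprn_ge0 ?expR_ge0//.
    rewrite mulrC -ler_pdivlMr ?ltr0n// (le_trans (normr_expR_sub1 _))//.
    rewrite mulrAC normrM normfV (@ger0_norm _ m.+1%:R)// ler_wpM2l//.
    by rewrite ler_expR ler_pdivrMr ?ltr0n// ler_peMr// ler1n.
  rewrite mulrACA -exprSr -expRD.
  apply: (@le_trans _ _ (j.+1`!%:R * expR `|u| * expR (a * u + `|u|))).
    by rewrite ler_wpM2r ?expR_ge0// normr_exprn_le.
  rewrite -mulrA -expRD ler_wpM2l// ler_expR (@ger0_norm _ (2 + _)) ?addr_ge0//.
  by rewrite mulrDl; have := ler_norm (a * u); rewrite normrM; lra.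
Qed.

(** The partial sums of the power series are dominated by [exp |u|], hence by
    [exp u + exp (- u)]. *)
Lemma same_integral_series t (c : nat -> R) (f : R -> R) : (forall i, `|c i| <= 1) ->
  continuous f -> (forall u, (fun m => \sum_(i < m) c i * u ^+ i / i`!%:R) @ \oo --> f u) ->
  H (fun x => f (frob t x)).
Proof.
move=> c1 cf cF.
apply: (@HD (fun m x => \sum_(i < m) c i * frob t x ^+ i / i`!%:R) _
  (fun x => 1 * (expR (1 * frob t x) + expR (- (1 * frob t x))))).
- move=> m; apply: same_integral_sum => i.
  apply: eq_same_integral (same_integralZ (c i / i`!%:R) (same_integral_power_expR t i 0)) => x.
  by rewrite mul0r expR0 mulr1 mulrAC.
- exact: continuous_frob_comp.
- exact: same_integral_expR_norm.
- by move=> x; exact: cF.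
- move=> m x; rewrite !mul1r; apply: le_trans (expR_norm_le _).
  exact: series_trig_coeff_le.
Qed.

Lemma same_integral_cos t : H (fun x => cos (frob t x)).
Proof.
apply: (@same_integral_series t (fun i => (~~ odd i)%:R * (-1) ^ i./2)).
- move=> i; rewrite normrM -exprnP normrX normrN1 expr1n mulr1.
  by case: (~~ _); rewrite ?normr1 ?normr0.
- exact: continuous_cos.
- move=> u; rewrite (_ : (fun m => _) = series (cos_coeff u)).
    by rewrite unlock; exact: is_cvg_series_cos_coeff.
  by apply/funext => m; rewrite seriesEord.
Qed.

Lemma same_integral_sin t : H (fun x => sin (frob t x)).
Proof.
apply: (@same_integral_series t (fun i => (odd i)%:R * (-1) ^+ i.-1./2)).
- move=> i; rewrite normrM normrX normrN1 expr1n mulr1.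
  by case: (odd _); rewrite ?normr1 ?normr0.
- exact: continuous_sin.
- move=> u; rewrite (_ : (fun m => _) = series (sin_coeff u)).
    by rewrite unlock; exact: is_cvg_series_sin_coeff.
  by apply/funext => m; rewrite seriesEord.
Qed.

(** [p] is tested against all cosines and sines, so that the class is stable under
    multiplication by a sine: this is what the addition formulas require. *)
Definition trig_multiplier (p : symmx R k -> R) : Prop := forall t,
  H (fun x => p x * cos (frob t x)) /\ H (fun x => p x * sin (frob t x)).

Lemma trig_multiplier_same_integral p : trig_multiplier p -> H p.
Proof.
move=> /(_ 0)[h _]; apply: eq_same_integral h => x.
by rewrite (ip0l hk) cos0 mulr1.
Qed.

Lemma trig_multiplier1 : trig_multiplier (fun=> 1).
Proof.
move=> t; split.
  by apply: eq_same_integral (same_integral_cos t) => x; rewrite mul1r.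
by apply: eq_same_integral (same_integral_sin t) => x; rewrite mul1r.
Qed.

Lemma trig_multiplier_sin p s (a b : R) : trig_multiplier p ->
  trig_multiplier (fun x => p x * (a + b * sin (frob s x))).
Proof.
move=> hp t; have [pc ps] := hp t; have [pc1 ps1] := hp (s + t); have [pc2 ps2] := hp (s - t).
split.
  have h := same_integralD (same_integralZ a pc)
    (same_integralZ (b / 2) (same_integralD ps1 ps2)).
  apply: eq_same_integral h => x; rewrite (ipDl hk s t) (ipBl hk s t) sinD sinB.
  by field.
have h := same_integralD (same_integralZ a ps)
    (same_integralZ (b / 2) (same_integralB pc2 pc1)).
apply: eq_same_integral h => x; rewrite (ipDl hk s t) (ipBl hk s t) cosB cosD.
by field.
Qed.

Lemma trig_multiplier_prod (J : Type) (r : seq J) (s : J -> symmx R k) (a b : J -> R) :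
  trig_multiplier (fun x => \prod_(j <- r) (a j + b j * sin (frob (s j) x))).
Proof.
elim: r => [|j r IH].
  under eq_fun do rewrite big_nil; exact: trig_multiplier1.
under eq_fun do rewrite big_cons mulrC; exact: trig_multiplier_sin.
Qed.

Variable F : symmx R k -> R.
Hypothesis cF : continuous F.
Variable M : R.
Hypothesis FM : forall x, `|F x| <= M.

Let n : nat := \dim {: symmx R k}.
Variable e : 'I_n -> symmx R k.
Hypothesis eo : forall i j, frob (e i) (e j) = (i == j)%:R.
Hypothesis eb : forall x, x = \sum_i frob x (e i) *: e i.

(** Each coordinate [u] of [x] is replaced by [c sin (u / c)], which tends to [u]
    as [c] grows and is bounded; the affine change of variable brings the sine
    into [[0, 1]], where Bernstein polynomials approximate.  [point_of] undoes
    the change of variable. *)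
Definition sine_coord (c : R) (x : symmx R k) (i : 'I_n) : R :=
  (1 + sin (frob (c^-1 *: e i) x)) / 2.

Definition point_of (c : R) (z : 'I_n -> R) : symmx R k :=
  \sum_i (c * (2 * z i - 1)) *: e i.

Lemma sine_coord01 c x i : 0 <= sine_coord c x i <= 1.
Proof.
rewrite /sine_coord; have := sin_geN1 (frob (c^-1 *: e i) x).
have := sin_le1 (frob (c^-1 *: e i) x); lra.
Qed.

Definition bernstein (c : R) (m : nat) (x : symmx R k) : R :=
  \sum_(s : coins n m) F (point_of c (coin_mean R s)) * coin_weight (sine_coord c x) s.

(** A coin weight is a product of affine functions of sines. *)
Lemma same_integral_bernstein c m : H (bernstein c m).
Proof.
rewrite /bernstein.
have hs (s : coins n m) : H (fun x => F (point_of c (coin_mean R s)) * coin_weight (sine_coord c x) s).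
  apply: same_integralZ; apply: trig_multiplier_same_integral.
  have := @trig_multiplier_prod ('I_n * 'I_m)%type (index_enum _)
    (fun j => c^-1 *: e j.1) (fun=> 2^-1) (fun j => if s j then 2^-1 else - 2^-1).
  congr trig_multiplier; apply/funext => x; apply: eq_bigr => j _.
  by rewrite /sine_coord; case: (s j); field.
elim: (index_enum _) => [|s r IH].
  by under eq_fun do rewrite big_nil; exact: same_integral_cst.
by apply: eq_same_integral (same_integralD (hs s) IH) => x; rewrite big_cons.
Qed.

Lemma bernstein_le c m x : `|bernstein c m x| <= M.
Proof.
rewrite (le_trans (ler_norm_sum _ _ _))// -[leRHS]mulr1.
rewrite -(coin_weight_sum m (sine_coord c x)) mulr_sumr; apply: ler_sum => s _.
have w0 := coin_weight_ge0 (@sine_coord01 c x) s.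
by rewrite normrM (ger0_norm w0) ler_wpM2r.
Qed.

Lemma point_of_sine_coord c x : point_of c (sine_coord c x) =
  \sum_i (c * sin (frob (e i) x / c)) *: e i.
Proof.
apply: eq_bigr => i _; rewrite /sine_coord (ipZl hk) [c^-1 * _]mulrC.
by congr (_ *: _); field.
Qed.

Lemma frob_norm_sum_basis (z : 'I_n -> R) : frob_norm (\sum_i z i *: e i) <= \sum_i `|z i|.
Proof.
rewrite (le_trans (ipnorm_sum _ _ hk))//; apply: ler_sum => i _.
by rewrite (ipnormZ hk) /ipnorm eo eqxx sqrtr1 mulr1.
Qed.

(** Continuity of [F] at the single limit point suffices in [bernstein_error]. *)
Lemma cvg_bernstein c x : 0 < c ->
  (fun m => bernstein c m x) @ \oo --> F (point_of c (sine_coord c x)).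
Proof.
move=> c0; set y := sine_coord c x; apply/cvgrPdist_le => eps eps0.
have eps2 : 0 < eps / 2 by rewrite divr_gt0.
have [t t0 ht] := (continuous_symmxP F).1 cF (point_of c y) (eps / 2) eps2.
pose t' := t / (2 * c * n.+1%:R).
have t'0 : 0 < t' by rewrite divr_gt0// !mulr_gt0.
have close z : (forall i, `|z i - y i| < t') -> `|F (point_of c z) - F (point_of c y)| <= eps / 2.
  move=> zy; apply/ltW/ht; rewrite /point_of -sumrB.
  under eq_bigr do rewrite -scalerBl.
  rewrite (le_lt_trans (frob_norm_sum_basis _))//.
  apply: (@le_lt_trans _ _ (\sum_(i < n) (2 * c * t'))).
    apply: ler_sum => i _; rewrite -mulrBr opprB addrA subrK -mulrBr !normrM.
    rewrite (gtr0_norm c0) ger0_norm// mulrA [c * _]mulrC ler_wpM2l ?mulr_ge0 ?(ltW c0)//.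
    exact/ltW/zy.
  rewrite sumr_const card_ord -[_ *+ n]mulr_natr.
  have -> : 2 * c * t' * n%:R = t * (n%:R / n.+1%:R).
    have N0 : (n.+1%:R : R) != 0 by rewrite pnatr_eq0.
    have c0' : c != 0 by rewrite gt_eqF.
    rewrite /t'; move: (n.+1%:R : R) N0 => N N0; field.
    by rewrite N0 c0'.
  by rewrite gtr_pMr// ltr_pdivrMr// mul1r ltr_nat.
pose K := 2 * M / t' ^+ 2 * n%:R.
near=> m.
have m0 : (0 < m)%N by near: m; exact: nbhs_infty_gt.
have Km : K / m%:R <= eps / 2.
  rewrite ler_pdivrMr ?ltr0n// mulrC -ler_pdivrMr//; apply/ltW.
  near: m; exact: nbhs_infty_gtr.
have B := bernstein_error (phi := fun z => F (point_of c z)) (@sine_coord01 c x) m0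
  (fun z => FM _) t'0 (ltW eps2) close.
rewrite distrC (le_trans B)//.
by rewrite [leRHS]splitr lerD2l.
Unshelve. all: by end_near. Qed.

Lemma continuous_sum_basis (z : 'I_n -> symmx R k -> R) : (forall i, continuous (z i)) ->
  continuous (fun x => \sum_i z i x *: e i : symmx R k).
Proof.
move=> cz x A /nbhs_symmxP[eps eps0 eA].
have : \forall y \near x, forall i, `|z i y - z i x| < eps / n.+1%:R.
  apply: (@filter_forall _ _ (fun i y => `|z i y - z i x| < eps / n.+1%:R) (nbhs x) (nbhs_filter x)) => i.
  have /cvgrPdist_lt/(_ _ (divr_gt0 eps0 (ltr0Sn R n))) := cz i x.
  by apply: filterS => y; rewrite distrC.
apply: filterS => y zy; apply: eA; rewrite -sumrB.
under eq_bigr do rewrite -scalerBl.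
rewrite (le_lt_trans (frob_norm_sum_basis _))//.
apply: (@le_lt_trans _ _ (\sum_(i < n) (eps / n.+1%:R))).
  by apply: ler_sum => i _; exact/ltW/zy.
rewrite sumr_const card_ord -[_ *+ n]mulr_natr mulrAC -mulrA gtr_pMr//.
by rewrite ltr_pdivrMr// mul1r ltr_nat.
Qed.

Lemma same_integral_sine c : 0 < c -> H (fun x => F (point_of c (sine_coord c x))).
Proof.
move=> c0; apply: (@HD (bernstein c) _ (fun=> M)).
- exact: same_integral_bernstein.
- under eq_fun do rewrite point_of_sine_coord.
  move=> x; apply: (@continuous_comp _ _ _ (fun x => \sum_i (c * sin (frob (e i) x / c)) *: e i : symmx R k)); last exact: cF.
  apply: continuous_sum_basis => i.
  apply: (@continuous_frob_comp (fun u => c * sin (u / c))) => u.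
  apply: cvgM; first exact: cvg_cst.
  apply: continuous_comp; last exact: continuous_sin.
  by apply: cvgM; [exact: cvg_id|exact: cvg_cst].
- exact: same_integral_cst.
- by move=> x; exact: cvg_bernstein.
- by move=> m x; exact: bernstein_le.
Qed.

(** Dominated convergence as [c] tends to infinity, with the bound [M] as the
    dominating function. *)
Lemma same_integral_bounded : H F.
Proof.
apply: (@HD (fun l x => F (point_of l.+1%:R (sine_coord l.+1%:R x))) _ (fun=> M)).
- by move=> l; apply: same_integral_sine.
- exact: cF.
- exact: same_integral_cst.
- move=> x; apply/cvgrPdist_lt => eps eps0.
  have [t t0 ht] := (continuous_symmxP F).1 cF x eps eps0.
  have : \forall l \near \oo, forall i, `|frob (e i) x - l.+1%:R * sin (frob (e i) x / l.+1%:R)| < t / n.+1%:R.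
    apply: filter_forall => i.
    have := cvg_difference_quotient (u := frob (e i) x) (is_derive_sin (0 : R)).
    rewrite cos0 mulr1 => /cvgrPdist_lt/(_ _ (divr_gt0 t0 (ltr0Sn R n))).
    by apply: filterS => l; rewrite sin0 subr0.
  apply: filterS => l hl; rewrite distrC; apply: ht.
  rewrite point_of_sine_coord {2}(eb x) -sumrB.
  under eq_bigr do rewrite -scalerBl.
  rewrite (le_lt_trans (frob_norm_sum_basis _))//.
  apply: (@le_lt_trans _ _ (\sum_(i < n) (t / n.+1%:R))).
    by apply: ler_sum => i _; rewrite distrC (ipC hk x); exact/ltW/hl.
  rewrite sumr_const card_ord -[_ *+ n]mulr_natr mulrAC -mulrA gtr_pMr//.
  by rewrite ltr_pdivrMr// mul1r ltr_nat.
- by move=> l x.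
Qed.

End LaplaceUniqueness.

(** * Gaussian laws and their exponential tilting *)

Section TransferIntegral.
Import HBNNSimple.
Variables (R : realType) (d1 : measure_display) (T1 : measurableType d1).
Variables (d2 : measure_display) (T2 : measurableType d2).
Variables (mu : {measure set T1 -> \bar R}) (nu : {measure set T2 -> \bar R}).
Variables (f : T1 -> R) (phi : T1 -> T2) (c : R).
Hypothesis (mf : measurable_fun setT f) (f0 : forall t, 0 <= f t).
Hypothesis (mphi : measurable_fun setT phi).
Hypothesis fc : forall B, measurable B ->
  (\int[mu]_t (f t * \1_B (phi t))%:E = c%:E * nu B)%E.

Lemma transfer_integral_nnsfun (h : {nnsfun T2 >-> R}) :
  (\int[mu]_t (f t * h (phi t))%:E = c%:E * \int[nu]_x (h x)%:E)%E.
Proof.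
have mB y : measurable (h @^-1` [set y]) by exact: measurable_sfunP.
transitivity (\int[mu]_t (\sum_(y \in range h) (f t * (y * \1_(h @^-1` [set y]) (phi t)))%:E))%E.
  by apply: eq_integral => t _; rewrite (fimfunE h (phi t)) mulrC mulr_fsuml -fsumEFin//; apply: eq_fsbigr => y _; rewrite mulrC.
have mfi y : measurable_fun setT (fun t => f t * (y * \1_(h @^-1` [set y]) (phi t))).
  apply: measurable_funM => //; apply: measurable_funM => //.
  by apply: measurableT_comp => //; exact: measurable_indic.
rewrite ge0_integral_fsum//; last 2 first.
- by move=> y; exact/measurable_EFinP.
- by move=> y t _; rewrite lee_fin mulr_ge0// -lee_fin EFinM nnfun_muleindic_ge0.
transitivity (c%:E * \int[nu]_x (\sum_(y \in range h) (y * \1_(h @^-1` [set y]) x)%:E))%E; last first.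
  by congr (_ * _)%E; apply: eq_integral => x _; rewrite (fimfunE h x) -fsumEFin.
rewrite ge0_integral_fsum//; last 2 first.
- by move=> y; apply/measurable_EFinP/measurable_funM => //; exact: measurable_indic.
- by move=> y x _; rewrite EFinM nnfun_muleindic_ge0.
rewrite ge0_mule_fsumr; last first.
  by move=> y; apply: integral_ge0 => x _; rewrite EFinM nnfun_muleindic_ge0.
apply: eq_fsbigr => y; rewrite inE => -[x _ <-].
have hx : (0 <= h x)%R by [].
transitivity ((h x)%:E * \int[mu]_t (f t * \1_(h @^-1` [set h x]) (phi t))%:E)%E.
  rewrite -ge0_integralZl_EFin//.
  - by apply: eq_integral => t _; rewrite -EFinM mulrCA.
  - by move=> t _; rewrite lee_fin mulr_ge0.
  - apply/measurable_EFinP/measurable_funM => //.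
    by apply: measurableT_comp => //; exact: measurable_indic.
rewrite fc//; under [in RHS]eq_integral do rewrite EFinM.
rewrite ge0_integralZl_EFin//; last first.
  by apply/measurable_EFinP; exact: measurable_indic.
by rewrite integral_indic// setIT muleCA.
Qed.

(** By monotone approximation by simple functions.  The weight [f] makes it apply
    both to densities and to the factors of an expectation of a product. *)
Lemma transfer_integral (g : T2 -> R) : measurable_fun setT g -> (forall x, 0 <= g x) ->
  (\int[mu]_t (f t * g (phi t))%:E = c%:E * \int[nu]_x (g x)%:E)%E.
Proof.
move=> mg g0; have mG : measurable_fun setT (EFin \o g) by exact/measurable_EFinP.
pose h := nnsfun_approx measurableT mG.
have hg x : (fun n => (h n x)%:E) @ \oo --> (g x)%:E.
  by apply: (@cvg_nnsfun_approx _ _ _ _ measurableT _ mG) => // y _; rewrite lee_fin.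
have nd x : {homo (fun n => h n x) : a b / (a <= b)%N >-> a <= b}.
  by move=> a b ab; exact/lefP/nd_nnsfun_approx.
have c1 : (fun n => \int[mu]_t (f t * h n (phi t))%:E)%E @ \oo -->
    (\int[mu]_t (f t * g (phi t))%:E)%E.
  have E t : (f t * g (phi t))%:E = limn (fun n => (f t * h n (phi t))%:E).
    apply/esym/cvg_lim => //; rewrite EFinM; under eq_fun do rewrite EFinM.
    by apply: cvgeZl => //; exact: hg.
  under [X in _ --> X]eq_integral do rewrite E.
  apply: cvg_monotone_convergence => //.
  - by move=> n; apply/measurable_EFinP/measurable_funM => //; exact: measurableT_comp.
  - by move=> n t _; rewrite lee_fin mulr_ge0.
  - by move=> t _ a b ab; rewrite lee_fin ler_wpM2l// nd.
have c2 : (fun n => \int[nu]_x (h n x)%:E)%E @ \oo --> (\int[nu]_x (g x)%:E)%E.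
  have E x : (g x)%:E = limn (fun n => (h n x)%:E) by apply/esym/cvg_lim => //; exact: hg.
  under [X in _ --> X]eq_integral do rewrite E.
  apply: cvg_monotone_convergence => //.
  - by move=> n; exact/measurable_EFinP.
  - by move=> n x _; rewrite lee_fin.
  - by move=> x _ a b ab; rewrite lee_fin nd.
have c3 : (fun n => \int[mu]_t (f t * h n (phi t))%:E)%E @ \oo -->
    (c%:E * \int[nu]_x (g x)%:E)%E.
  by under eq_fun do rewrite transfer_integral_nnsfun; exact: cvgeZl.
by rewrite -(cvg_lim _ c1)// (cvg_lim _ c3).
Qed.

End TransferIntegral.

Lemma density_integral (R : realType) (dT : measure_display) (T : measurableType dT)
    (nu : {measure set T -> \bar R}) (P : probability T R) (f g : T -> R) :
  measurable_fun setT f -> (forall w, 0 <= f w) ->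
  (forall A, measurable A -> P A = \int[nu]_(w in A) (f w)%:E)%E ->
  measurable_fun setT g -> (forall w, 0 <= g w) ->
  (\int[P]_w (g w)%:E = \int[nu]_w (f w * g w)%:E)%E.
Proof.
move=> mf f0 fP mg g0; rewrite -[LHS]mul1e; apply/esym.
apply: (@transfer_integral _ _ _ _ _ nu P f id 1) => //.
move=> B mB; rewrite mul1e; apply/esym; apply: etrans (fP B mB) _.
rewrite integral_mkcond.
by apply: eq_integral => x _; rewrite epatch_indic EFinM.
Qed.

Section NormalMoments.
Variable R : realType.
Implicit Types (s t : R).

Lemma normal_prob_integral s (g : R -> R) : measurable_fun setT g -> (forall x, 0 <= g x) ->
  (\int[normal_prob 0 s]_x (g x)%:E =
   \int[@lebesgue_measure R]_x (normal_pdf 0 s x * g x)%:E)%E.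
Proof.
move=> mg g0; apply: density_integral => //; first exact: measurable_normal_pdf.
by move=> x; exact: normal_pdf_ge0.
Qed.

(** Completing the square. *)
Lemma normal_mgf s t : s != 0 ->
  (\int[normal_prob 0 s]_x (expR (t * x))%:E = (expR (t ^+ 2 * s ^+ 2 / 2))%:E)%E.
Proof.
move=> s0; rewrite normal_prob_integral => [|x|x]; last 2 first.
- by apply: measurableT_comp => //; exact: measurable_funM.
- exact: expR_ge0.
transitivity (\int[@lebesgue_measure R]_x ((expR (t ^+ 2 * s ^+ 2 / 2))%:E *
    (normal_pdf (t * s ^+ 2) s x)%:E))%E.
  apply: eq_integral => x _; rewrite -EFinM; congr EFin.
  rewrite !normal_pdfE// /normal_fun -[LHS]mulrA [RHS]mulrCA; congr (_ * _).
  by rewrite -!expRD; congr expR; field.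
rewrite integralZl//; last exact: integrable_normal_pdf.
by rewrite integral_normal_pdf mule1.
Qed.

End NormalMoments.

(** Independence, stated for events, extends to expectations of products: the
    factors are replaced one at a time by indicators of arbitrary events. *)
Lemma expectation_prod (R : realType) (J : finType) (P : pred J)
  (dO : measure_display) (O : measurableType dO) (Q : probability O R)
  (V : J -> O -> R) (nu : J -> probability (measurableTypeR R) R)
  (u : J -> R -> R) (c : J -> R) :
  (forall j, measurable_fun setT (V j)) ->
  (forall j, measurable_fun setT (u j)) -> (forall j x, 0 <= u j x) ->
  (forall j, (\int[nu j]_x (u j x)%:E = (c j)%:E)%E) ->
  (forall B : J -> set R, (forall j, measurable (B j)) ->
    Q [set w | forall j, P j -> B j (V j w)] = (\prod_(j | P j) nu j (B j))%E) ->
  (\int[Q]_w (\prod_(j | P j) u j (V j w))%:E = (\prod_(j | P j) c j)%:E)%E.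
Proof.
move=> mV mu u0 uc ind.
pose E (s : seq J) (B : J -> set R) := [set w | forall j, P j -> j \notin s -> B j (V j w)].
have mE s B : (forall j, measurable (B j)) -> measurable (E s B).
  move=> mB; have -> : E s B = \bigcap_(j in [set j | P j && (j \notin s)]) V j @^-1` B j.
    apply/seteqP; split=> w /= h j; first by move=> /andP[]; exact: h.
    by move=> Pj js; apply: h; rewrite /= Pj.
  apply: fin_bigcap_measurable; first exact: finite_finset.
  by move=> j _; rewrite -[_ @^-1` _]setTI; exact: mV.
have fE B : (forall j, measurable (B j)) ->
    (\prod_(j | P j) nu j (B j))%E = (\prod_(j | P j) fine (nu j (B j)))%:E.
  move=> mB; rewrite (big_morph EFin EFinM (erefl _)); apply: eq_bigr => j _.
  by rewrite fineK// fin_num_measure.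
have claim s : uniq s -> all P s -> forall B, (forall j, measurable (B j)) ->
    (\int[Q]_w (\prod_(j <- s) u j (V j w) * \1_(E s B) w)%:E =
     (\prod_(j <- s) c j * \prod_(j | P j && (j \notin s)) fine (nu j (B j)))%:E)%E.
  elim: s => [|i s IH] /=.
    move=> _ _ B mB; under eq_integral do rewrite big_nil mul1r.
    rewrite integral_indic ?setIT//; last exact: mE.
    rewrite big_nil mul1r; under eq_bigl do rewrite andbT.
    by rewrite -fE// -ind//; congr (Q _); apply/seteqP; split=> w h j Pj *; exact: h.
  move=> /andP[is_ us] /andP[Pi Ps] B mB.
  set K := \prod_(j | P j && (j \notin i :: s)) fine (nu j (B j)).
  pose f w := \prod_(j <- s) u j (V j w) * \1_(E (i :: s) B) w.
  have mf : measurable_fun setT f.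
    apply: measurable_funM; last exact: measurable_indic (mE _ _ mB).
    by apply: measurable_prod => j _; exact: measurableT_comp.
  have f0 w : 0 <= f w by rewrite mulr_ge0// prodr_ge0.
  have step X : measurable X ->
      (\int[Q]_w (f w * \1_X (V i w))%:E = (\prod_(j <- s) c j * K)%:E * nu i X)%E.
    move=> mX; pose B' j := if j == i then X else B j.
    have mB' j : measurable (B' j) by rewrite /B'; case: ifP.
    transitivity (\int[Q]_w (\prod_(j <- s) u j (V j w) * \1_(E s B') w)%:E)%E.
      apply: eq_integral => w _; rewrite /f -mulrA; congr EFin; congr (_ * _).
      rewrite !indicE -natrM mulnb; congr ((nat_of_bool _)%:R).
      apply/andP/idP; rewrite !inE.
        move=> [h XV] j Pj js; rewrite /B'; case: eqP => [->//|/eqP ji].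
        by apply: h => //; rewrite inE negb_or ji.
      move=> h; split; last by have := h i Pi is_; rewrite /B' eqxx.
      move=> j Pj; rewrite inE negb_or => /andP[ji js].
      by have := h j Pj js; rewrite /B' (negbTE ji).
    rewrite (IH us Ps B' mB') (bigD1 i) ?Pi//= {1}/B' eqxx.
    rewrite mulrCA mulrC EFinM fineK ?fin_num_measure//; congr (_ * _)%E; congr EFin; congr (_ * _).
    apply: eq_big => [j|j]; first by rewrite inE negb_or -andbA [_ && (_ != _)]andbC.
    by move=> /andP[_ ji]; rewrite /B' (negbTE ji).
  have := @transfer_integral R _ _ _ _ Q (nu i) f (V i) _ mf f0 (mV i) step (u i) (mu i) (u0 i).
  rewrite uc => H; rewrite big_cons.
  transitivity (\int[Q]_w (f w * u i (V i w))%:E)%E.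
    by apply: eq_integral => w _; rewrite big_cons /f; congr EFin; ring.
  by rewrite H -EFinM; congr EFin; ring.
have := claim (enum P) (enum_uniq _) _ (fun=> setT) (fun=> measurableT).
rewrite big_enum /= [X in _ * X]big1 ?mulr1; last first.
  by move=> j /andP[Pj]; rewrite mem_enum [_ \in _]Pj.
move=> <-; last by apply/allP => j; rewrite mem_enum.
apply: eq_integral => w _; rewrite big_enum /= indicE mem_set ?mulr1//.
Qed.

(** The case [h = 0] is apart: the degenerate normal law is not prescribed. *)
Lemma expR_gaussian_mgf (R : realType) (d q : nat) (I : 'End(param R d q))
    (dO : measure_display) (O : measurableType dO) (Q : probability O R)
    (Z : O -> param R d q) (h : param R d q) :
  posdef (@inner R d q) I -> gaussian I Q Z ->
  (\int[Q]_w (expR (inner h (Z w)))%:E = (expR (2^-1 * inner h (I h)))%:E)%E.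
Proof.
have hi := inner_inner_product R d q.
move=> pI [rZ gZ]; have [->|h0] := eqVneq h 0.
  under eq_integral do rewrite (ip0l hi) expR0.
  rewrite integral_cst//; transitivity (1 * 1 : \bar R)%E; last by rewrite mule1 (ip0l hi) mulr0 expR0.
  by congr (_ * _)%E; exact: probability_setT.
set s := Num.sqrt (inner h (I h)).
have s0 : 0 < s by rewrite sqrtr_gt0; exact: pI.
have mX : measurable_fun setT (fun w => inner h (Z w)).
  by apply: random_element_measurable rZ _; exact: inner_continuous.
have := @transfer_integral R _ _ _ _ Q (normal_prob 0 s) (fun=> 1) (fun w => inner h (Z w)) 1
  (measurable_cst _) (fun=> ler01) mX _ (fun x => expR (1 * x)) _ (fun x => expR_ge0 _).
rewrite normal_mgf ?gt_eqF// mul1e expr1n mul1r sqr_sqrtr ?ltW ?pI// mulrC => H.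
rewrite -H.
- by apply: eq_integral => w _; rewrite !mul1r.
- move=> B mB; rewrite mul1e; transitivity (Q [set w | B (inner h (Z w))]); last exact: gZ.
  pose A := (fun w => inner h (Z w)) @^-1` B.
  transitivity (\int[Q]_w (\1_A w)%:E)%E; first by apply: eq_integral => w _; rewrite mul1r.
  rewrite integral_indic ?setIT//.
  by rewrite -[A]setTI; exact: mX.
- by apply: measurableT_comp => //; exact: measurable_funM.
Qed.

Lemma expR_integralZ (R : realType) (dO : measure_display) (O : measurableType dO)
    (Q : probability O R) (c : R) (g : O -> R) : measurable_fun setT g ->
  (\int[Q]_w (expR (c + g w))%:E = (expR c)%:E * \int[Q]_w (expR (g w))%:E)%E.
Proof.
move=> mg; rewrite -ge0_integralZl_EFin ?expR_ge0//.
  by apply: eq_integral => w _; rewrite -EFinM -expRD.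
by apply/measurable_EFinP; exact: measurableT_comp.
Qed.

Section StandardBasis.
Variables (R : realType) (k : nat).
Implicit Types A B : symmx R k.

Lemma frob_basisE A i j :
  frob A (frob_basis R i j) = (if i == j then 1 else Num.sqrt 2) * symval A i j.
Proof.
have sA : symval A j i = symval A i j by rewrite -{1}(symval_tr A) mxE.
have dE (a b : 'I_k) : \sum_i' \sum_j' symval A i' j' * (delta_mx a b : 'M[R]_k) i' j' = symval A a b.
  rewrite (bigD1 a)//= [X in _ + X]big1 => [|i' /negbTE ia]; last first.
    by rewrite big1// => j' _; rewrite mxE ia mulr0.
  rewrite (bigD1 b)//= [X in _ + X + _]big1 => [|j' /negbTE jb]; last first.
    by rewrite mxE jb andbF mulr0.
  by rewrite mxE !eqxx mulr1 !addr0.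
rewrite frobE /frob_basis; case: eqP => [<-|ij].
  by rewrite tosymK ?trmx_delta// dE mul1r.
rewrite tosymK; last by rewrite linearZ linearD /= !trmx_delta addrC.
transitivity ((Num.sqrt 2)^-1 * (\sum_i' \sum_j' symval A i' j' * (delta_mx i j : 'M[R]_k) i' j' +
    \sum_i' \sum_j' symval A i' j' * (delta_mx j i : 'M[R]_k) i' j')).
  rewrite -big_split mulr_sumr; apply: eq_bigr => a _ /=.
  rewrite -big_split mulr_sumr; apply: eq_bigr => b _ /=.
  by rewrite !mxE; ring.
rewrite !dE sA -mulr2n -(mulr_natl (symval A i j)) mulrA; congr (_ * _).
by rewrite -{2}(@sqr_sqrtr _ 2)// expr2 mulKf// gt_eqF// sqrtr_gt0.
Qed.

(** Parseval for the basis indexed by [i <= j]: an off-diagonal coordinate, scaled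
    by the square root of 2, accounts for two equal entries. *)
Lemma frob_basis_expansion A B : frob A B =
  \sum_(p : 'I_k * 'I_k | (p.1 <= p.2)%N) frob A (frob_basis R p.1 p.2) * frob B (frob_basis R p.1 p.2).
Proof.
pose g (p : 'I_k * 'I_k) := symval A p.1 p.2 * symval B p.1 p.2.
have gs p : g (p.2, p.1) = g p.
  by rewrite /g /= -{1}(symval_tr A) -{1}(symval_tr B) !mxE.
have -> : frob A B = \sum_p g p by rewrite frobE pair_big.
rewrite (bigID (fun p : 'I_k * 'I_k => p.1 == p.2)) /= [RHS](bigID (fun p : 'I_k * 'I_k => p.1 == p.2)) /=.
congr (_ + _).
  apply: eq_big => [p|p /eqP pe]; first by case: eqP => [->|]; rewrite ?leqnn ?andbF.
  by rewrite !frob_basisE pe eqxx /g pe !mul1r.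
rewrite (bigID (fun p : 'I_k * 'I_k => (p.1 <= p.2)%N)) /=.
rewrite [X in _ + X](reindex_inj (h := fun p : 'I_k * 'I_k => (p.2, p.1))) /=; last first.
  by move=> [a b] [a' b'] /= [-> ->].
rewrite [X in _ + X](_ : _ = \sum_(p : 'I_k * 'I_k | (p.1 != p.2) && (p.1 <= p.2)%N) g p); last first.
  apply: eq_big => [[a b]|p _] /=; last exact: gs.
  by rewrite -ltnNge ltn_neqAle eq_sym andbA andbb.
rewrite -big_split; apply: eq_big => [p|p /andP[/negbTE pe _]] /=; first by rewrite andbC.
rewrite !frob_basisE pe mulrACA -expr2 sqr_sqrtr//.
by rewrite /g mulr_natl mulr2n.
Qed.

Lemma expR_std_gaussian_mgf (dO : measure_display) (O : measurableType dO)
    (Q : probability O R) (Y : O -> symmx R k) t : std_gaussian Q Y ->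
  (\int[Q]_w (expR (frob t (Y w)))%:E = (expR (2^-1 * frob t t))%:E)%E.
Proof.
move=> [rY gY].
pose c (p : 'I_k * 'I_k) := frob t (frob_basis R p.1 p.2).
have := @expectation_prod R ('I_k * 'I_k)%type (fun p => p.1 <= p.2)%N _ O Q
  (fun p w => frob (Y w) (frob_basis R p.1 p.2)) (fun=> normal_prob 0 1)
  (fun p x => expR (c p * x)) (fun p => expR (c p ^+ 2 * 1 ^+ 2 / 2)).
move=> H.
transitivity (\int[Q]_w (\prod_(p : 'I_k * 'I_k | (p.1 <= p.2)%N)
    expR (c p * frob (Y w) (frob_basis R p.1 p.2)))%:E)%E.
  by apply: eq_integral => w _; rewrite frob_basis_expansion expR_sum.
rewrite H.
- rewrite -expR_sum; congr (EFin (expR _)).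
  rewrite frob_basis_expansion mulr_sumr; apply: eq_bigr => p _.
  by rewrite expr1n mulr1 mulrC expr2.
- move=> p; have -> : (fun w => frob (Y w) (frob_basis R p.1 p.2)) =
      (fun w => frob (frob_basis R p.1 p.2) (Y w)).
    by apply/funext => w; rewrite (ipC (frob_inner_product R k)).
  by apply: random_element_measurable rY _; exact: frob_continuous.
- by move=> p; apply: measurableT_comp => //; exact: measurable_funM.
- by move=> p x; exact: expR_ge0.
- by move=> p; apply: normal_mgf; exact: oner_neq0.
- move=> B mB; apply: etrans (etrans (gY (fun i j => B (i, j)) _) _).
  + by congr (Q _); apply/seteqP; split=> [w h i j ij|w h [i j] ij]; [exact: (h (i, j))|exact: h].
  + by move=> i j; exact: mB.
  + by apply: eq_bigr => -[i j].
Qed.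

End StandardBasis.

Section ReducedLaw.
Variables (R : realType) (d q k : nat) (I : 'End(param R d q)) (U : 'M[R]_(q, k)).
Hypothesis sI : selfadjoint (@inner R d q) I.
Hypothesis pI : posdef (@inner R d q) I.
Hypothesis UU : U^T *m U = 1%:M.
Let hi := inner_inner_product R d q.
Let hk := frob_inner_product R k.

Lemma reduced_score_continuous : continuous (reduced_score I U).
Proof.
pose L := (cov_red_inv_sqrt I U \o active U \o linfun (@proj_sigma R d q) \o I^-1)%VF.
have -> : reduced_score I U = L.
  by apply/funext => z; rewrite [RHS]comp_lfunE [RHS]comp_lfunE [RHS]comp_lfunE (lfunE (@proj_sigma R d q)).
exact: linear_param_symmx_continuous.
Qed.

Lemma lan_quad_continuous h : continuous (lan_quad I h).
Proof.
by move=> z; apply: cvgB; [exact: inner_continuous|exact: cvg_cst].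
Qed.

Lemma translation_continuous (m : symmx R k) : continuous (fun x : symmx R k => x + m).
Proof.
move=> x A /nbhs_symmxP[e e0 eA]; apply/nbhs_symmxP; exists e => // y yx.
by apply: eA; rewrite opprD addrACA subrr addr0.
Qed.

Variables (dZ : measure_display) (OZ : measurableType dZ) (QZ : probability OZ R).
Variables (Z : OZ -> param R d q) (dY : measure_display) (OY : measurableType dY).
Variables (QY : probability OY R) (Y : OY -> symmx R k).
Hypothesis (gZ : gaussian I QZ Z) (gY : std_gaussian QY Y).

(** The limiting likelihood ratio is a probability density. *)
Lemma lan_quad_mgf h : (\int[QZ]_w (expR (lan_quad I h (Z w)))%:E = 1)%E.
Proof.
transitivity (\int[QZ]_w (expR (- (2^-1 * inner h (I h)) + inner h (Z w)))%:E)%E.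
  by apply: eq_integral => w _; rewrite addrC.
rewrite expR_integralZ; last first.
  by apply: random_element_measurable gZ.1 _; exact: inner_continuous.
by rewrite (expR_gaussian_mgf _ pI gZ) -EFinM -expRD addNr expR0.
Qed.

(** Both sides have the same Laplace transform: [<t, y z>] is the coordinate of
    [z] along [v], whose information is [|t|^2] and whose inner product with [h]
    for the information is [<t, mu>]; so [exp <t, y z>] shifts the direction of
    the tilt from [h] to [v + h]. *)
Lemma reduced_score_law (h : param R d q) (F : symmx R k -> R) (M : R) :
  continuous F -> (forall x, `|F x| <= M) ->
  (\int[QZ]_w (F (reduced_score I U (Z w)) * expR (lan_quad I h (Z w)))%:E =
   \int[QY]_w (F (Y w + active_shift I U h.2))%:E)%E.
Proof.
move=> cF FM; set mu := active_shift I U h.2.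
have rX1 : random_element (fun w => reduced_score I U (Z w)).
  move=> A oA; apply: (gZ.1 (reduced_score I U @^-1` A)).
  by have /continuousP/(_ A oA) := reduced_score_continuous.
have rX2 : random_element (fun w => Y w + mu).
  move=> A oA; apply: (gY.1 ((fun x => x + mu) @^-1` A)).
  by have /continuousP/(_ A oA) := @translation_continuous mu.
have mw1 : measurable_fun setT (fun w => expR (lan_quad I h (Z w))).
  apply: measurableT_comp => //.
  by apply: random_element_measurable gZ.1 _; exact: lan_quad_continuous.
have [e [eo eb]] := exists_orthonormal_basis hk.
have cexp t : continuous (fun x : symmx R k => expR (frob t x)).
  by move=> x; apply: continuous_comp; [exact: frob_continuous|exact: continuous_expR].
have laplace t : same_integral QZ QY (fun w => reduced_score I U (Z w)) (fun w => Y w + mu)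
    (fun w => expR (lan_quad I h (Z w))) (fun=> 1) (fun x => expR (frob t x)).
  pose v := active_direction I U (cov_red_inv_sqrt I U t).
  have E1 : (\int[QZ]_w (expR (frob t (reduced_score I U (Z w))) * expR (lan_quad I h (Z w)))%:E =
      (expR (2^-1 * frob t t + frob t mu))%:E)%E.
    transitivity (\int[QZ]_w (expR (2^-1 * inner (v + h) (I (v + h)) - 2^-1 * inner h (I h) +
        lan_quad I (v + h) (Z w)))%:E)%E.
      apply: eq_integral => w _; rewrite -expRD frob_reduced_score// -/v.
      congr EFin; congr expR; rewrite /lan_quad (ipDl hi v h (Z w)).
      by move: (inner _ _) (inner _ _) (inner _ _) (inner _ _) => *; ring.
    rewrite expR_integralZ; last first.
      by apply: random_element_measurable gZ.1 _; exact: lan_quad_continuous.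
    rewrite lan_quad_mgf mule1 linearD /= (ipDl hi) !(ipDr hi) info_active_direction//.
    rewrite info_active_direction_shift// -(sI h) (ipC hi (I h)) info_active_direction_shift//.
    by congr (EFin (expR _)); rewrite /mu /active_shift /active_part; field.
  have E2 : (\int[QY]_w (expR (frob t (Y w + mu)) * 1)%:E =
      (expR (2^-1 * frob t t + frob t mu))%:E)%E.
    transitivity (\int[QY]_w (expR (frob t mu + frob t (Y w)))%:E)%E.
      by apply: eq_integral => w _; rewrite mulr1 (ipDr hk) addrC.
    rewrite expR_integralZ; last by apply: random_element_measurable gY.1 _; exact: frob_continuous.
    by rewrite expR_std_gaussian_mgf// -EFinM -expRD addrC.
  split=> //; last by rewrite E1 E2.
    apply/integrableP; split.
      apply/measurable_EFinP/measurable_funM => //.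
      exact: (random_element_measurable rX1 (cexp t)).
    under eq_integral do rewrite gee0_abs ?lee_fin ?mulr_ge0 ?expR_ge0//.
    by rewrite E1 ltry.
  apply/integrableP; split.
    apply/measurable_EFinP/measurable_funM => //.
    exact: (random_element_measurable rX2 (cexp t)).
  under eq_integral do rewrite gee0_abs ?lee_fin ?mulr_ge0 ?expR_ge0//.
  by rewrite E2 ltry.
have [_ _ _ ->] := @same_integral_bounded R k _ _ QZ _ _ QY _ _ _ _ rX1 rX2 mw1
  (measurable_cst _) (fun w => expR_ge0 _) (fun=> ler01) laplace F cF M FM e eo eb.
by apply: eq_integral => w _; rewrite mulr1.
Qed.

End ReducedLaw.

(** * Inner integrals and negligible events *)

Section InnerIntegral.
Import HBNNSimple.
Variables (R : realType) (dT : measure_display) (T : measurableType dT).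
Local Open Scope ereal_scope.

(** The integral of a nonnegative function is a supremum over simple minorants, so
    no measurability is involved. *)
Lemma le_inner_integral (mu : {measure set T -> \bar R}) (f g : T -> \bar R) :
  (forall x, 0 <= f x) -> (forall x, f x <= g x) -> \int[mu]_x f x <= \int[mu]_x g x.
Proof.
move=> f0 fg; have g0 x : 0 <= g x := le_trans (f0 x) (fg x).
rewrite !ge0_integralTE//; apply: le_ereal_sup => _ [h /= hf <-].
by exists h => // x; exact: le_trans (hf x) (fg x).
Qed.

(** The sum of simple minorants of [G] and of [M - G] is a simple minorant of [M].
    For functions that need not be measurable only this inequality holds. *)
Lemma inner_integral_superadditive (P : probability T R) (G : T -> R) (M : R) :
  (forall x, 0 <= G x)%R -> (forall x, G x <= M)%R ->
  \int[P]_x (G x)%:E + \int[P]_x (M - G x)%:E <= M%:E.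
Proof.
move=> G0 GM.
have H0 x : (0 <= M - G x)%R by rewrite subr_ge0.
have M0 : (0 <= M)%R.
  have /set0P[x _] : [set: T] != set0.
    apply/eqP => T0; have : P setT = 1 := probability_setT P.
    by rewrite T0 measure0 => /eqP; rewrite eq_sym onee_eq0.
  exact: le_trans (G0 x) (GM x).
rewrite !ge0_integralTE//.
have key (h h' : {nnsfun T >-> R}) : (forall x, (h x)%:E <= (G x)%:E) ->
    (forall x, (h' x)%:E <= (M - G x)%:E) -> sintegral P h + sintegral P h' <= M%:E.
  move=> hG hG'; rewrite -sintegralD.
  have -> : M%:E = sintegral P (cst_nnsfun T (NngNum M0)).
    rewrite -integralT_nnsfun /= integral_cst//.
    by transitivity (M%:E * 1); [rewrite mule1|congr (_ * _); apply/esym; exact: probability_setT].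
  apply: (@le_sintegral _ _ _ P (add_nnsfun h h')) => x /=.
  have := hG x; have := hG' x; rewrite !lee_fin; lra.
have fin (h : {nnsfun T >-> R}) (B : R) : sintegral P h <= B%:E -> sintegral P h \is a fin_num.
  move=> hB; rewrite ge0_fin_numE ?sintegral_ge0//; exact: le_lt_trans hB (ltry _).
have bnd (h : {nnsfun T >-> R}) : (forall x, (h x)%:E <= (G x)%:E) -> sintegral P h \is a fin_num.
  move=> hG; apply: (fin _ M); have := key h nnsfun0 hG.
  by rewrite (_ : sintegral P nnsfun0 = 0) ?adde0; [apply=> x; rewrite lee_fin|exact: sintegral0].
have bnd' (h : {nnsfun T >-> R}) : (forall x, (h x)%:E <= (M - G x)%:E) -> sintegral P h \is a fin_num.
  move=> hG; apply: (fin _ M); have := key nnsfun0 h _ hG.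
  by rewrite (_ : sintegral P nnsfun0 = 0) ?add0e; [apply=> x; rewrite lee_fin|exact: sintegral0].
set S := ereal_sup _; set S' := ereal_sup _.
have S'0 : 0 <= S'.
  by apply: ereal_sup_ubound; exists nnsfun0; [move=> x /=; rewrite lee_fin|exact: sintegral0].
have S0 : 0 <= S.
  by apply: ereal_sup_ubound; exists nnsfun0; [move=> x /=; rewrite lee_fin|exact: sintegral0].
have SM : S <= M%:E.
  apply: ge_ereal_sup => _ [h hG <-]; have := key h nnsfun0 hG.
  by rewrite (_ : sintegral P nnsfun0 = 0) ?adde0; [apply=> x; rewrite lee_fin|exact: sintegral0].
have Sfin : S \is a fin_num by rewrite ge0_fin_numE// (le_lt_trans SM)// ltry.
rewrite -leeBrDl//; apply: ge_ereal_sup => _ [h' hG' <-].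
rewrite leeBrDr// -leeBrDl ?bnd'//; apply: ge_ereal_sup => _ [h hG <-].
by rewrite leeBrDr ?bnd'//; exact: key.
Qed.

End InnerIntegral.

Section Negligible.
Variables (R : realType) (dT : nat -> measure_display) (T : forall n, measurableType (dT n)).
Variable P : forall n, probability (T n) R.
Local Notation negligible := (@asymp_negligible R dT T P).

Lemma outer_prob_ge0 n (A : set (T n)) : (0 <= ((P n)^*)%mu A)%E.
Proof. exact: mu_ext_ge0. Qed.

Lemma le_outer_prob n (A B : set (T n)) : A `<=` B -> (((P n)^*)%mu A <= ((P n)^*)%mu B)%E.
Proof. exact: le_mu_ext. Qed.

Lemma outer_prob_le1 n (A : set (T n)) : (((P n)^*)%mu A <= 1)%E.
Proof.
apply: (@le_trans _ _ (((P n)^*)%mu setT)); first exact: le_outer_prob.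
rewrite measurable_mu_extE//; exact: probability_le1.
Qed.

Lemma outer_probU n (A B : set (T n)) :
  (((P n)^*)%mu (A `|` B) <= ((P n)^*)%mu A + ((P n)^*)%mu B)%E.
Proof. exact: outer_measureU2. Qed.

Lemma negligibleP A : negligible A <->
  forall e : R, 0 < e -> \forall n \near \oo, (((P n)^*)%mu (A n) <= e%:E)%E.
Proof.
have fin n : (((P n)^*)%mu (A n)) \is a fin_num.
  by rewrite ge0_fin_numE ?outer_prob_ge0// (le_lt_trans (outer_prob_le1 _))// ltry.
split.
  move=> /fine_cvgP[_ /cvgrPdist_le c] e e0; have := c e e0; apply: filterS => n /=.
  by rewrite sub0r normrN -lee_fin -abse_EFin fineK// gee0_abs// outer_prob_ge0.
move=> c; apply/fine_cvgP; split; first exact: nearW.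
apply/cvgrPdist_le => e e0; have := c e e0; apply: filterS => n /=.
by rewrite sub0r normrN -lee_fin -abse_EFin fineK// gee0_abs// outer_prob_ge0.
Qed.

Lemma negligible_sub A B : negligible B -> (\forall n \near \oo, A n `<=` B n) -> negligible A.
Proof.
move=> /negligibleP nB AB; apply/negligibleP => e e0.
near=> n; apply: (@le_trans _ _ (((P n)^*)%mu (B n))).
  by apply: le_outer_prob; near: n.
by near: n; exact: nB.
Unshelve. all: by end_near. Qed.

Lemma negligibleU A B : negligible A -> negligible B -> negligible (fun n => A n `|` B n).
Proof.
move=> /negligibleP nA /negligibleP nB; apply/negligibleP => e e0.
have e2 : 0 < e / 2 by rewrite divr_gt0.
near=> n; rewrite (le_trans (outer_probU _ _))// [e]splitr EFinD leeD//; near: n.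
  exact: nA.
exact: nB.
Unshelve. all: by end_near. Qed.

(** Combines events of vanishing probability with tail events whose probability
    is merely small, the cut-off being allowed to depend on [e]. *)
Lemma negligible_approx A : (forall e : R, 0 < e -> exists B C : forall n, set (T n),
    [/\ negligible B, \forall n \near \oo, (((P n)^*)%mu (C n) <= e%:E)%E
      & \forall n \near \oo, A n `<=` B n `|` C n]) -> negligible A.
Proof.
move=> h; apply/negligibleP => e e0; have e2 : 0 < e / 2 by rewrite divr_gt0.
have [B [C [/negligibleP nB nC ABC]]] := h _ e2.
near=> n; apply: (@le_trans _ _ (((P n)^*)%mu (B n `|` C n))).
  by apply: le_outer_prob; near: n.
rewrite (le_trans (outer_probU _ _))// [e]splitr EFinD leeD//; near: n => //.
exact: nB.
Unshelve. all: by end_near. Qed.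

(** The outer measure is an infimum over measurable covers; the slack [1 / (n + 1)]
    vanishes in the limit. *)
Lemma negligible_cover A : negligible A -> exists B : forall n, set (T n),
  [/\ forall n, measurable (B n), forall n, A n `<=` B n & negligible B].
Proof.
move=> nA.
have cov n : exists B : set (T n), [/\ measurable B, A n `<=` B &
    (P n B <= ((P n)^*)%mu (A n) + (n.+1%:R^-1)%:E)%E].
  have fin : (((P n)^*)%mu (A n)) \is a fin_num.
    by rewrite ge0_fin_numE ?outer_prob_ge0// (le_lt_trans (outer_prob_le1 _))// ltry.
  have n0 : 0 < n.+1%:R^-1 :> R by rewrite invr_gt0.
  have [_ [F [mF AF] <-] h] := lb_ereal_inf_adherent n0 fin.
  exists (\bigcup_k F k); split=> //; first exact: bigcup_measurable.
  apply: le_trans (ltW h); apply: (measure_sigma_subadditive) => //.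
  exact: bigcup_measurable.
exists (fun n => projT1 (cid (cov n))).
have H n := projT2 (cid (cov n)).
split=> [n|n|]; [by case: (H n)|by case: (H n)|].
apply/negligibleP => e e0; have e2 : 0 < e / 2 by rewrite divr_gt0.
move/negligibleP: nA => /(_ _ e2) nA.
near=> n; have [mB _ hB] := H n; rewrite measurable_mu_extE//.
rewrite (le_trans hB)// [e]splitr EFinD leeD//; first by near: n.
rewrite lee_fin -[leRHS]invrK lef_pV2 ?posrE ?invr_gt0//.
rewrite (@le_trans _ _ n%:R) ?ler_nat//; near: n; exact: nbhs_infty_ger.
Unshelve. all: by end_near. Qed.

End Negligible.

(** * Le Cam's third lemma *)

Lemma continuous_maxr_cst (R : realType) (S : topologicalType) (f : S -> R) (c : R) :
  continuous f -> continuous (fun z => Num.max (f z) c).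
Proof.
move=> cf z; apply/cvgrPdist_lt => e e0.
have /cvgrPdist_lt/(_ e e0) := cf z; apply: filterS => y; apply: le_lt_trans.
have := ler_norm (f z - f y); have := ler_norm (f y - f z); rewrite (distrC (f y)).
move: (f z) (f y) => a b h1 h2; rewrite ler_norml !maxEle.
by case: ifPn; case: ifPn; rewrite -?ltNge => ? ?; apply/andP; split; lra.
Qed.

Lemma continuous_minr_cst (R : realType) (S : topologicalType) (f : S -> R) (c : R) :
  continuous f -> continuous (fun z => Num.min (f z) c).
Proof.
move=> cf; have -> : (fun z => Num.min (f z) c) = (fun z => - Num.max (- f z) (- c)).
  by apply/funext => z; rewrite oppr_max !opprK.
move=> z; apply: cvgN.
by apply: (@continuous_maxr_cst _ _ (fun z => - f z)) => y; apply: cvgN; exact: cf.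
Qed.

Section ThirdLemma.
Variables (R : realType) (dT : nat -> measure_display) (T : forall n, measurableType (dT n)).
Variables (P P' : forall n, probability (T n) R).
Variables (S : topologicalType).
Unset Implicit Arguments.
Variable Z : forall n, T n -> S.
Set Implicit Arguments.
Variables (dZ : measure_display) (OZ : measurableType dZ) (QZ : probability OZ R).
Variables (Zlim : OZ -> S) (l : S -> R).
Hypothesis rZ : forall n : nat, random_element (Z n).
Hypothesis rZlim : random_element Zlim.
Hypothesis ZZ : cvg_in_law P Z QZ Zlim.
Hypothesis cl : continuous l.
Hypothesis mass : (\int[QZ]_w (expR (l (Zlim w)))%:E = 1)%E.
(* Likelihood ratio bounded below by [exp (l Z_n - e)] off a negligible event,
   in integrated form. *)
Hypothesis ratio : forall e : R, 0 < e -> exists A : forall n, set (T n),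
  [/\ forall n, measurable (A n), asymp_negligible P A &
    \forall n \near \oo, forall g : T n -> R, measurable_fun setT g -> (forall w, 0 <= g w) ->
      ((expR (- e))%:E * \int[P n]_w (g w * expR (l (Z n w)) * \1_(~` A n) w)%:E
        <= \int[P' n]_w (g w)%:E)%E].

Section LowerBound.
Variables (M : R) (phi : S -> R).
Hypothesis (M0 : 0 <= M) (cphi : continuous phi) (phi0 : forall z, 0 <= phi z) (phiM : forall z, phi z <= M).

(** The integrand [phi exp l] is approached from below by bounded continuous
    functions, to which weak convergence applies: [phi] is lowered so that it
    lies below [G], the exponential is truncated, and a factor close to 1 absorbs
    the error in the likelihood ratio. *)
Definition shrunk (m : nat) (z : S) : R := Num.max (phi z - m.+1%:R^-1) 0.
Definition truncated_ratio (m : nat) (z : S) : R := Num.min (expR (l z)) m%:R.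
Definition minorant (m : nat) (z : S) : R :=
  expR (- m.+1%:R^-1) * (shrunk m z * truncated_ratio m z).

Let inv_le (a b : nat) : (a <= b)%N -> (b.+1%:R^-1 <= a.+1%:R^-1 :> R).
Proof. by move=> ab; rewrite lef_pV2 ?posrE// ler_nat. Qed.

Lemma shrunk_ge0 m z : 0 <= shrunk m z. Proof. by rewrite le_max lexx orbT. Qed.
Lemma shrunk_le m z : shrunk m z <= phi z.
Proof. by rewrite ge_max phi0 andbT lerBlDr lerDl invr_ge0. Qed.
Lemma truncated_ratio_ge0 m z : 0 <= truncated_ratio m z.
Proof. by rewrite le_min expR_ge0 ler0n. Qed.
Lemma minorant_ge0 m z : 0 <= minorant m z.
Proof. by rewrite !mulr_ge0 ?expR_ge0 ?shrunk_ge0 ?truncated_ratio_ge0. Qed.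
Lemma minorant_le m z : minorant m z <= M * m%:R.
Proof.
rewrite /minorant (@le_trans _ _ (shrunk m z * truncated_ratio m z))//.
  by rewrite ler_piMl ?mulr_ge0 ?shrunk_ge0 ?truncated_ratio_ge0// expR_le1 oppr_le0 invr_ge0.
rewrite ler_pM ?shrunk_ge0 ?truncated_ratio_ge0//.
  exact: le_trans (shrunk_le _ _) (phiM z).
by rewrite ge_min lexx orbT.
Qed.
Lemma minorant_nondecreasing z : {homo minorant^~ z : a b / (a <= b)%N >-> a <= b}.
Proof.
move=> a b ab; rewrite /minorant ler_pM ?expR_ge0 ?mulr_ge0 ?shrunk_ge0 ?truncated_ratio_ge0//.
  by rewrite ler_expR lerN2 inv_le.
rewrite ler_pM ?shrunk_ge0 ?truncated_ratio_ge0//.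
  by rewrite ge_max !le_max lexx orbT andbT lerD2l lerN2 inv_le.
by rewrite le_min !ge_min lexx /= ler_nat ab orbT.
Qed.

Lemma shrunk_continuous m : continuous (shrunk m).
Proof.
apply: continuous_maxr_cst => z.
by apply: cvgB; [exact: cphi|exact: cvg_cst].
Qed.

Lemma expR_l_continuous : continuous (fun z => expR (l z)).
Proof. by move=> z; apply: continuous_comp; [exact: cl|exact: continuous_expR]. Qed.

Lemma truncated_ratio_continuous m : continuous (truncated_ratio m).
Proof.
apply: continuous_minr_cst; exact: expR_l_continuous.
Qed.

Lemma minorant_continuous m : continuous (minorant m).
Proof.
move=> z; apply: cvgM; first exact: cvg_cst.
by apply: cvgM; [exact: shrunk_continuous|exact: truncated_ratio_continuous].
Qed.

Lemma cvg_minorant z : minorant^~ z @ \oo --> phi z * expR (l z).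
Proof.
rewrite -[X in _ --> X]mul1r -expR0 -oppr0; apply: cvgM.
  apply: (@cvg_comp _ _ _ (fun m : nat => - m.+1%:R^-1) expR); last exact: continuous_expR.
  by apply: cvgN; exact: cvg_harmonic.
apply: cvgM.
  apply: (@squeeze_cvgr _ _ _ _ (fun m : nat => phi z - m.+1%:R^-1) (fun=> phi z)).
  - by apply: nearW => m; rewrite shrunk_le andbT le_max lexx.
  - by rewrite -[X in _ --> X]subr0; apply: cvgB; [exact: cvg_cst|exact: cvg_harmonic].
  - exact: cvg_cst.
apply: cvg_near_cst; near=> m; apply/min_idPl; near: m; exact: nbhs_infty_ger.
Unshelve. all: by end_near. Qed.

Lemma cvg_integral_minorant :
  (fun m => \int[QZ]_w (minorant m (Zlim w))%:E)%E @ \oo -->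
  (\int[QZ]_w (phi (Zlim w) * expR (l (Zlim w)))%:E)%E.
Proof.
have E w : (phi (Zlim w) * expR (l (Zlim w)))%:E = limn (fun m => (minorant m (Zlim w))%:E).
  apply/esym/cvg_lim => //; apply: cvg_EFin; first exact: nearW.
  exact: cvg_minorant.
under [X in _ --> X]eq_integral do rewrite E.
apply: cvg_monotone_convergence => //.
- move=> m; apply/measurable_EFinP.
  by apply: random_element_measurable rZlim _; exact: minorant_continuous.
- by move=> m w _; rewrite lee_fin minorant_ge0.
- by move=> w _ a b ab; rewrite lee_fin minorant_nondecreasing.
Qed.

Unset Implicit Arguments.
Variable G : forall n, T n -> R.
Set Implicit Arguments.
Hypothesis G0 : forall n w, 0 <= G n w.
Hypothesis Gphi : forall e : R, 0 < e ->
  asymp_negligible P (fun n => [set w | e < `|G n w - phi (Z n w)|]).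

(** Off the negligible event [C] one has [shrunk m (Z n) <= G n], and the ratio
    bound moves the integral from [P'] to [P]; weak convergence under [P] gives
    the limit of the integral of [minorant m]. *)
Lemma third_lemma_lower (c : R) :
  (c%:E < \int[QZ]_w (phi (Zlim w) * expR (l (Zlim w)))%:E)%E ->
  \forall n \near \oo, (c%:E <= \int[P' n]_w (G n w)%:E)%E.
Proof.
move=> clt.
have [m cm] : exists m, (c%:E < \int[QZ]_w (minorant m (Zlim w))%:E)%E.
  apply: contrapT => /forallNP h; move: clt; rewrite ltNge => /negP; apply.
  by apply: cvge_le cvg_integral_minorant; apply: nearW => m; rewrite leNgt; apply/negP.
pose e : R := m.+1%:R^-1; have e0 : 0 < e by rewrite invr_gt0.
have [A [mA nA hA]] := ratio e0.
have [B [mB GB nB]] := negligible_cover (Gphi e0).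
pose C n := A n `|` B n.
have mC n : measurable (C n) by exact: measurableU.
have nC : asymp_negligible P C by exact: negligibleU.
have [b bE] : exists b : R, (\int[QZ]_w (minorant m (Zlim w))%:E = b%:E)%E.
  have : (\int[QZ]_w (minorant m (Zlim w))%:E \is a fin_num)%E.
    rewrite ge0_fin_numE; last first.
      by apply: integral_ge0 => w _; rewrite lee_fin minorant_ge0.
    apply: (@le_lt_trans _ _ (\int[QZ]_w (cst (M * m%:R)%:E w))%E).
      apply: le_inner_integral => w; rewrite lee_fin ?minorant_ge0//.
      exact: minorant_le.
    rewrite integral_cst//= -ge0_fin_numE ?mule_ge0 ?lee_fin ?mulr_ge0//.
    by rewrite fin_numM// fin_num_measure.
  by move=> /fineK <-; eexists.
move: cm; rewrite bE lte_fin => cb.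
pose K := M * m%:R; have K0 : 0 <= K by rewrite mulr_ge0.
pose eta := (b - c) / 2; have eta0 : 0 < eta by rewrite divr_gt0// subr_gt0.
have lim : \forall n \near \oo, ((b - eta)%:E <= \int[P n]_w (minorant m (Z n w))%:E)%E.
  have := ZZ (f := minorant m) (@minorant_continuous m) _.
  rewrite bE => /(_ _)/fine_cvgP[|fin /cvgrPdist_le/(_ _ eta0)].
    exists K => z; rewrite ger0_norm ?minorant_ge0//; exact: minorant_le.
  move=> near1; near=> n.
  have fn : (\int[P n]_w (minorant m (Z n w))%:E \is a fin_num)%E by near: n.
  have : `|b - fine (\int[P n]_w (minorant m (Z n w))%:E)%E| <= eta by near: n.
  by rewrite -(fineK fn) lee_fin ler_distlC => /andP[+ _]; rewrite lerBlDr.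
have smallC : \forall n \near \oo, (K%:E * P n (C n) <= eta%:E)%E.
  have K1 : 0 < eta / (K + 1) by rewrite divr_gt0// ltr_wpDl.
  have := (negligibleP P C).1 nC _ K1; apply: filterS => n.
  rewrite measurable_mu_extE// => hC.
  apply: (@le_trans _ _ (K%:E * (eta / (K + 1))%:E)%E); first by rewrite lee_wpmul2l.
  rewrite -EFinM lee_fin mulrA ler_pdivrMr ?ltr_wpDl//.
  by rewrite mulrC ler_wpM2l ?(ltW eta0)// lerDl.
near=> n.
have hn : forall g : T n -> R, measurable_fun setT g -> (forall w, 0 <= g w) ->
      ((expR (- e))%:E * \int[P n]_w (g w * expR (l (Z n w)) * \1_(~` A n) w)%:E
        <= \int[P' n]_w (g w)%:E)%E by near: n.
have mind D : measurable D -> measurable_fun setT (\1_D : T n -> R) by move=> mD; exact: measurable_indic.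
have mfun (F : S -> R) : continuous F -> measurable_fun setT (fun w => F (Z n w)).
  by move=> cF; exact: random_element_measurable (rZ n) cF.
pose g w := shrunk m (Z n w) * \1_(~` C n) w.
have mg : measurable_fun setT g.
  apply: measurable_funM; first exact: mfun (@shrunk_continuous m).
  by apply: mind; exact: measurableC.
have g0 w : 0 <= g w by rewrite mulr_ge0 ?shrunk_ge0.
have step1 : (\int[P' n]_w (g w)%:E <= \int[P' n]_w (G n w)%:E)%E.
  apply: le_inner_integral => w; rewrite lee_fin// /g indicE.
  have [Cw|/negP] := boolP (w \in C n); first by rewrite in_setC Cw mulr0.
  move=> nCw; rewrite in_setC; move/negP: (nCw) => -> /=; rewrite mulr1.
  have nb : `|G n w - phi (Z n w)| <= e.
    rewrite leNgt; apply/negP => h; apply: nCw; rewrite inE; right; exact: GB.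
  move: nb; rewrite ler_distl => /andP[h _]; rewrite /shrunk ge_max G0 andbT.
  exact: h.
have step2 := le_trans (hn g mg g0) step1.
have step3 : (\int[P n]_w (minorant m (Z n w) * \1_(~` C n) w)%:E <=
    (expR (- e))%:E * \int[P n]_w (g w * expR (l (Z n w)) * \1_(~` A n) w)%:E)%E.
  rewrite -ge0_integralZl_EFin ?expR_ge0//; last first.
    apply/measurable_EFinP; apply: measurable_funM; last by apply: mind; exact: measurableC.
    by apply: measurable_funM => //; exact: mfun expR_l_continuous.
    by move=> w _; rewrite lee_fin (mulr_ge0 (mulr_ge0 (g0 w) (expR_ge0 _))) // indicE ler0n.
  apply: le_inner_integral => w; first by rewrite lee_fin mulr_ge0 ?minorant_ge0.
  rewrite -EFinM lee_fin /minorant /g -!mulrA ler_wpM2l ?expR_ge0// ler_wpM2l ?shrunk_ge0//.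
  rewrite /C !indicE !in_setC in_setU; case: (w \in A n) => /=; first by rewrite !mulr0.
  case: (w \in B n) => /=; first by rewrite !(mulr0, mul0r).
  by rewrite !mulr1 mul1r ge_min lexx.
have step4 : (\int[P n]_w (minorant m (Z n w))%:E <=
    \int[P n]_w (minorant m (Z n w) * \1_(~` C n) w)%:E + K%:E * P n (C n))%E.
  have -> : (K%:E * P n (C n) = \int[P n]_w (K * \1_(C n) w)%:E)%E.
    under eq_integral do rewrite EFinM.
    rewrite ge0_integralZl_EFin//; last exact/measurable_EFinP/mind.
    by rewrite integral_indic// setIT.
  rewrite -ge0_integralD//; last 4 first.
  - by move=> w _; rewrite lee_fin mulr_ge0 ?minorant_ge0.
  - apply/measurable_EFinP/measurable_funM; first exact: mfun (@minorant_continuous m).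
    by apply: mind; exact: measurableC.
  - by move=> w _; rewrite lee_fin mulr_ge0.
  - by apply/measurable_EFinP/measurable_funM => //; exact: mind.
  apply: le_inner_integral => w; first by rewrite lee_fin minorant_ge0.
  rewrite -EFinD lee_fin !indicE in_setC; case: (w \in C n) => /=.
    by rewrite mulr0 add0r mulr1 minorant_le.
  by rewrite mulr1 mulr0 addr0.
apply: le_trans (le_trans step3 step2).
have h1 : ((b - eta)%:E <= \int[P n]_w (minorant m (Z n w))%:E)%E by near: n.
have h2 : (K%:E * P n (C n) <= eta%:E)%E by near: n.
have := le_trans h1 (le_trans step4 (leeD2l _ h2)).
rewrite -leeBlDr// -EFinB; apply: le_trans; rewrite lee_fin /eta; lra.
Unshelve. all: by end_near. Qed.

End LowerBound.

(** Le Cam's third lemma for outer integrals. The lower bound is applied both to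
    [G] and to [M - G]; no mass escapes because the limiting likelihood ratio
    has expectation one. *)
Lemma third_lemma (M : R) (phi : S -> R) (G : forall n, T n -> R) :
  continuous phi -> (forall z, 0 <= phi z <= M) -> (forall n w, 0 <= G n w <= M) ->
  (forall e : R, 0 < e ->
    asymp_negligible P (fun n => [set w | e < `|G n w - phi (Z n w)|])) ->
  (fun n => \int[P' n]_w (G n w)%:E)%E @ \oo -->
    (\int[QZ]_w (phi (Zlim w) * expR (l (Zlim w)))%:E)%E.
Proof.
move=> cphi phiM GM nG.
have M0 : 0 <= M.
  have [w _] : [set: OZ] !=set0.
    apply/set0P/eqP => T0; have : QZ setT = 1%E := probability_setT QZ.
    by rewrite T0 measure0 => /eqP; rewrite eq_sym onee_eq0.
  by have /andP[a b] := phiM (Zlim w); exact: le_trans a b.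
have mass2 : (\int[QZ]_w (phi (Zlim w) * expR (l (Zlim w)))%:E +
    \int[QZ]_w ((M - phi (Zlim w)) * expR (l (Zlim w)))%:E = M%:E)%E.
  have me : measurable_fun setT (fun w => expR (l (Zlim w))).
    exact: random_element_measurable rZlim expR_l_continuous.
  have mp : measurable_fun setT (fun w => phi (Zlim w)).
    exact: random_element_measurable rZlim cphi.
  rewrite -ge0_integralD//; last 4 first.
  - by move=> w _; have /andP[a _] := phiM (Zlim w); rewrite lee_fin mulr_ge0 ?expR_ge0.
  - exact/measurable_EFinP/measurable_funM.
  - by move=> w _; have /andP[_ a] := phiM (Zlim w); rewrite lee_fin mulr_ge0 ?expR_ge0 ?subr_ge0.
  - by apply/measurable_EFinP/measurable_funM => //; exact: measurable_funB.
  under eq_integral do rewrite -EFinD -mulrDl addrC subrK EFinM.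
  rewrite ge0_integralZl_EFin//; last first.
    exact/measurable_EFinP.
  by rewrite mass mule1.
set L := (\int[QZ]_w (phi (Zlim w) * expR (l (Zlim w)))%:E)%E in mass2 *.
set L' := (\int[QZ]_w ((M - phi (Zlim w)) * expR (l (Zlim w)))%:E)%E in mass2.
have L0 : (0 <= L)%E.
  by apply: integral_ge0 => w _; have /andP[a _] := phiM (Zlim w); rewrite lee_fin mulr_ge0 ?expR_ge0.
have L'0 : (0 <= L')%E.
  by apply: integral_ge0 => w _; have /andP[_ a] := phiM (Zlim w); rewrite lee_fin mulr_ge0 ?expR_ge0 ?subr_ge0.
have Lfin : L \is a fin_num.
  by rewrite ge0_fin_numE// (@le_lt_trans _ _ (M%:E))// ?ltry// -mass2 leeDl.
have L'E : L' = (M - fine L)%:E by rewrite EFinB fineK// -mass2 addeAC subee// add0e.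
rewrite -(fineK Lfin).
have lo e : 0 < e -> \forall n \near \oo, ((fine L - e)%:E <= \int[P' n]_w (G n w)%:E)%E.
  move=> e0; apply: (@third_lemma_lower M phi) => //.
  - by move=> z; have /andP[] := phiM z.
  - by move=> z; have /andP[] := phiM z.
  - by move=> n w; have /andP[] := GM n w.
  - by rewrite -/L -[X in (_ < X)%E](fineK Lfin) lte_fin ltrBlDr ltrDl.
have hi e : 0 < e -> \forall n \near \oo, ((M - fine L - e)%:E <= \int[P' n]_w (M - G n w)%:E)%E.
  move=> e0; apply: (@third_lemma_lower M (fun z => M - phi z)) => //.
  - by move=> z; apply: cvgB; [exact: cvg_cst|exact: cphi].
  - by move=> z; rewrite subr_ge0; have /andP[] := phiM z.
  - by move=> z; rewrite gerBl; have /andP[] := phiM z.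
  - by move=> n w; rewrite subr_ge0; have /andP[] := GM n w.
  - move=> e' e'0; apply: negligible_sub (nG e' e'0) _; apply: nearW => n w /=.
    by rewrite (_ : M - G n w - (M - phi (Z n w)) = phi (Z n w) - G n w) ?(distrC (phi _))//; ring.
  - by rewrite -/L' L'E lte_fin ltrBlDr ltrDl.
have sup n : (\int[P' n]_w (G n w)%:E + \int[P' n]_w (M - G n w)%:E <= M%:E)%E.
  by apply: inner_integral_superadditive => w; have /andP[] := GM n w.
have I0 n : (0 <= \int[P' n]_w (G n w)%:E)%E.
  by apply: integral_ge0 => w _; have /andP[a _] := GM n w; rewrite lee_fin.
have I'0 n : (0 <= \int[P' n]_w (M - G n w)%:E)%E.
  by apply: integral_ge0 => w _; have /andP[_ a] := GM n w; rewrite lee_fin subr_ge0.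
have Ifin n : (\int[P' n]_w (G n w)%:E)%E \is a fin_num.
  by rewrite ge0_fin_numE// (@le_lt_trans _ _ (M%:E))// ?ltry// (le_trans _ (sup n))// leeDl.
apply/fine_cvgP; split; first exact: nearW.
apply/cvgrPdist_le => e e0; near=> n.
have h1 : ((fine L - e)%:E <= \int[P' n]_w (G n w)%:E)%E by near: n; exact: lo.
have h2 : ((M - fine L - e)%:E <= \int[P' n]_w (M - G n w)%:E)%E by near: n; exact: hi.
have h3 := le_trans (leeD2l _ h2) (sup n).
move: h1 h3; rewrite /= -(fineK (Ifin n)) -EFinD !lee_fin /=.
by move: (fine _) (fine _) => x y h1 h3; rewrite ler_distl; apply/andP; split; lra.
Unshelve. all: by end_near. Qed.

End ThirdLemma.

(** * The statistic as a function of the score *)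

(** [y] need not be in the interval, hence a covering argument with balls of half
    the radius of continuity rather than uniform continuity on a compact set. *)
Lemma uniformly_continuous_on_bounded (R : realType) (F : R -> R) (B e : R) :
  continuous F -> 0 < e ->
  exists2 t, 0 < t & forall x y, `|x| <= B -> `|x - y| <= t -> `|F x - F y| <= e.
Proof.
move=> cF e0; have e2 : 0 < e / 2 by rewrite divr_gt0.
have /compact_near_coveringP/(_ _ (0 : R)^'+ (fun t x => forall y, `|x - y| <= t -> `|F x - F y| <= e)) :=
  @segment_compact R (- B) B.
move=> /(_ _)[x xB|t /= t0 ht].
- have /cvgrPdist_le/(_ _ e2)/nbhs_ballP[s /= s0 hs] := cF x.
  have s2 : 0 < s / 2 by rewrite divr_gt0.
  exists (ball x (s / 2), [set t | t < s / 2]) => /=.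
    by split; [exact: nbhsx_ballx|exact: nbhs_right_lt].
  move=> [x' t] /= [xx' ts] y x'y.
  have h1 := hs x' _; have h2 := hs y _.
  have b1 : ball x s x' by apply: le_ball xx'; rewrite ler_pdivrMr// mulr_natr mulr2n lerDl ltW.
  have b2 : ball x s y.
    rewrite [s]splitr; apply: (ball_triangle xx').
    by rewrite /ball /=; exact: le_lt_trans x'y ts.
  rewrite (le_trans (ler_distD (F x) _ _))// [e]splitr lerD//; last exact: h2.
  by rewrite distrC; exact: h1.
- exists (t / 2); first by rewrite divr_gt0.
  move=> x y xB xy; apply: (ht (t / 2) _ _ x) => //=.
  + by rewrite sub0r normrN gtr0_norm ?divr_gt0// ltr_pdivrMr// mulr_natr mulr2n ltrDl.
  + by rewrite divr_gt0.
  + by rewrite in_itv /= -ler_norml.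
Qed.

Section Tightness.
Variables (R : realType) (d q : nat).
Variables (dT : nat -> measure_display) (T : forall n, measurableType (dT n)).
Variable P : forall n, probability (T n) R.
Unset Implicit Arguments.
Variable Z : forall n, T n -> param R d q.
Set Implicit Arguments.
Variables (dZ : measure_display) (OZ : measurableType dZ) (QZ : probability OZ R).
Variable Zlim : OZ -> param R d q.
Hypothesis rZ : forall n : nat, random_element (Z n).
Hypothesis rZlim : random_element Zlim.
Hypothesis ZZ : cvg_in_law P Z QZ Zlim.

Let cutoff (m : nat) (z : param R d q) : R := Num.min (Num.max (enorm z - m%:R) 0) 1.

Let cutoff01 m z : 0 <= cutoff m z <= 1.
Proof. by rewrite /cutoff le_min ler01 le_max lexx orbT ge_min lexx orbT. Qed.

Let cutoff_continuous m : continuous (cutoff m).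
Proof.
apply: continuous_minr_cst; apply: continuous_maxr_cst => z.
by apply: cvgB; [exact: enorm_continuous|exact: cvg_cst].
Qed.

(** The continuous function [cutoff m] dominates the indicator of the complement
    of the ball of radius [m + 1], and its expectation in the limit is small. *)
Lemma cvg_in_law_tight (e : R) : 0 < e -> exists M : R,
  \forall n \near \oo, (((P n)^*)%mu [set w | (M < enorm (Z n w))%R] <= e%:E)%E.
Proof.
move=> e0; have e2 : 0 < e / 2 by rewrite divr_gt0.
have c0 : (fun m => \int[QZ]_w (cutoff m (Zlim w))%:E)%E @ \oo --> 0%E.
  have [] := @dominated_convergence _ _ _ QZ setT measurableT
    (fun m w => (cutoff m (Zlim w))%:E) (cst 0%E) (cst 1%E) _ _ _ _ _.
  - move=> m; apply/measurable_EFinP.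
    by apply: random_element_measurable rZlim _; exact: cutoff_continuous.
  - exact: measurable_cst.
  - apply: aeW => w _; apply: cvg_EFin; first exact: nearW.
    apply: cvg_near_cst; near=> m; rewrite /cutoff /=.
    rewrite (_ : Num.max _ _ = 0) ?min_l//; apply/max_idPr.
    by rewrite subr_le0; near: m; exact: nbhs_infty_ger.
  - by apply: finite_measure_integrable_cst.
  - apply: aeW => w m _ /=; have /andP[a b] := cutoff01 m (Zlim w).
    by rewrite lee_fin ger0_norm.
  by move=> _ _; rewrite integral0.
have [m hm] : exists m, (\int[QZ]_w (cutoff m (Zlim w))%:E < (e / 2)%:E)%E.
  have /fine_cvgP[fin /cvgrPdist_lt/(_ _ e2) h] := c0.
  have := filter_ex (filterI fin h); move=> [m [/= mfin]]; rewrite sub0r normrN => h2.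
  exists m; rewrite -(fineK mfin) lte_fin; apply: le_lt_trans h2; exact: ler_norm.
exists (m%:R + 1).
have := ZZ (f := cutoff m) (@cutoff_continuous m) _.
have [b bE] : exists b : R, (\int[QZ]_w (cutoff m (Zlim w))%:E = b%:E)%E.
  exists (fine (\int[QZ]_w (cutoff m (Zlim w))%:E)%E); rewrite fineK// ge0_fin_numE.
    exact: lt_trans hm (ltry _).
  by apply: integral_ge0 => w _; rewrite lee_fin; have /andP[] := cutoff01 m (Zlim w).
rewrite bE in hm *; rewrite lte_fin in hm.
move=> /(_ _)/fine_cvgP[|fin /cvgrPdist_le/(_ _ e2) near1].
  by exists 1 => z; have /andP[a c] := cutoff01 m z; rewrite ger0_norm.
near=> n.
have fn : (\int[P n]_w (cutoff m (Z n w))%:E \is a fin_num)%E by near: n.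
have h : `|b - fine (\int[P n]_w (cutoff m (Z n w))%:E)%E| <= e / 2 by near: n.
have mA : measurable [set w | m%:R + 1 < enorm (Z n w)].
  have := random_element_measurable (rZ n) (@enorm_continuous R d q) measurableT (measurable_itv `]m%:R + 1, +oo[).
  by rewrite setTI; congr measurable; apply/seteqP; split=> w /=; rewrite in_itv /= andbT.
rewrite measurable_mu_extE//.
apply: (@le_trans _ _ (\int[P n]_w (cutoff m (Z n w))%:E)%E); last first.
  rewrite -(fineK fn) lee_fin; move: h; rewrite ler_distl => /andP[h _].
  by move: h hm; move: (fine _) => x; lra.
apply: (@le_trans _ _ (\int[P n]_w (\1_[set w | m%:R + 1 < enorm (Z n w)] w)%:E)%E).
  by rewrite integral_indic// setIT.
apply: le_inner_integral => w; rewrite lee_fin ?indicE//.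
have [|_] := boolP (w \in _); last by have /andP[] := cutoff01 m (Z n w).
rewrite inE /= => wm; rewrite /cutoff le_min lexx andbT le_max; apply/orP; left; lra.
Unshelve. all: by end_near. Qed.

End Tightness.

(** A difference of log-likelihoods at bounded distance from a real number forces
    both to be finite: an infinite one would make the absolute value infinite. *)
Lemma abse_lt_fin (R : realType) (x y : \bar R) (r s e : R) :
  (`|x - y - r%:E + s%:E| < e%:E)%E ->
  exists a b, [/\ x = b%:E, y = a%:E & `|b - a - r + s| < e].
Proof. by case: x y => [b||] [a||] //= h; exists a, b; split. Qed.

Section LikelihoodRatio.
Variables (R : realType) (d q : nat).
Variables (dT : nat -> measure_display) (T : forall n, measurableType (dT n)).
Unset Implicit Arguments.
Variable Pr : forall n, param R d q -> probability (T n) R.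
Variable f : forall n, param R d q -> T n -> R.
Variable Z : forall n, T n -> param R d q.
Set Implicit Arguments.
Variables (theta0 : param R d q) (I : 'End(param R d q)).
Variables (dZ : measure_display) (OZ : measurableType dZ) (QZ : probability OZ R).
Variable Zlim : OZ -> param R d q.
Hypothesis rZ : forall n : nat, random_element (Z n).
Hypothesis rZlim : random_element Zlim.
Hypothesis ZZ : cvg_in_law (fun n => Pr n theta0) Z QZ Zlim.
Hypothesis sI : selfadjoint (@inner R d q) I.
Hypothesis pI : posdef (@inner R d q) I.
Hypothesis lan : LAN Pr f theta0 I Z.
Let hi := inner_inner_product R d q.
Local Notation negligible := (asymp_negligible (fun n => Pr n theta0)).

(** Closed balls are contained in compact sets, on which the expansion is uniform. *)
Lemma lan_on_ball (rho e : R) : 0 < e ->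
  negligible (fun n => [set w | ~ forall h, enorm h <= rho -> exists a b,
     [/\ loglik f (theta0 + rate R n *: h) w = b%:E, loglik f theta0 w = a%:E &
         `|b - a - lan_quad I h (Z n w)| < e]]).
Proof.
move=> e0; have [C cC rC] := eball_compact d q rho.
apply: negligible_sub (lan cC e0) _; apply: nearW => n w /=; apply: contra_notP => /negP.
rewrite -ltNge => h g gr.
have := le_lt_trans (ereal_sup_ubound _) h.
move=> /(_ _ (ex_intro2 _ _ g (rC _ gr) erefl)) /abse_lt_fin[a [b [-> -> ab]]].
by exists a, b; split=> //; rewrite /lan_quad opprB addrA addrAC.
Qed.

(** The quadratic terms differ by [<g - h, I g + I h> / 2], as [I] is
    self-adjoint. *)
Lemma lan_quad_dist : exists2 C : R, 0 < C & forall (g h z : param R d q) (rho M : R),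
  enorm g <= rho -> enorm h <= rho -> enorm z <= M ->
  `|lan_quad I g z - lan_quad I h z| <= enorm (g - h) * (M + C * rho).
Proof.
have [C C0 hC] := linear_bounded I hi hi; exists C => // g h z rho M gr hr zM.
have -> : lan_quad I g z - lan_quad I h z =
    inner (g - h) z - 2^-1 * (inner (g - h) (I g) + inner (g - h) (I h)).
  rewrite /lan_quad !(ipBl hi) -(sI g h) (ipC hi (I g) h).
  move: (inner _ _) (inner _ _) (inner _ _) (inner _ _) (inner _ _) => *; ring.
have a1 : `|inner (g - h) z| <= enorm (g - h) * M.
  by rewrite (le_trans (inner_le _ _))// ler_wpM2l ?enorm_ge0.
have aI x : enorm x <= rho -> `|inner (g - h) (I x)| <= enorm (g - h) * (C * rho).
  move=> xr; rewrite (le_trans (inner_le _ _))// ler_wpM2l ?enorm_ge0//.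
  by rewrite (le_trans (hC x))// ler_wpM2l// ltW.
have a2 := aI g gr; have a3 := aI h hr.
move: (inner _ _) (inner _ _) (inner _ _) a1 a2 a3 => x y t.
rewrite !ler_norml => /andP[? ?] /andP[? ?] /andP[? ?].
by rewrite mulrDr; apply/andP; split; lra.
Qed.

Lemma hausdorff_close (A B : set (param R d q)) (e : R) : (hausdorff A B < e%:E)%E ->
  (forall x, A x -> exists2 y, B y & enorm (x - y) < e) /\
  (forall y, B y -> exists2 x, A x & enorm (y - x) < e).
Proof.
have key (X Y : set (param R d q)) (x : param R d q) : (ereal_sup [set Defs.edist z Y | z in X] < e%:E)%E -> X x ->
    exists2 y, Y y & enorm (x - y) < e.
  move=> h Xx; have : (Defs.edist x Y < e%:E)%E.
    by apply: le_lt_trans h; apply: ereal_sup_ubound; exists x.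
  by move=> /ereal_inf_lt[_ [y Yy <-]]; rewrite lte_fin => ?; exists y.
by rewrite /hausdorff gt_max => /andP[h1 h2]; split=> x; exact: key.
Qed.

Lemma cvg_on_bounded_near (A : nat -> set (param R d q)) (B : set (param R d q)) (rho t : R) :
  cvg_on_bounded A B -> 0 < rho -> 0 < t ->
  \forall n \near \oo, (hausdorff (A n `&` @eball R d q rho) (B `&` @eball R d q rho) < t%:E)%E.
Proof.
move=> AB rho0 t0; have /fine_cvgP[hfin /cvgrPdist_lt/(_ _ t0) h] := AB rho rho0.
apply: filterS (filterI hfin h) => n [nfin].
rewrite /= sub0r normrN -{2}(fineK nfin) lte_fin; apply: le_lt_trans.
exact: ler_norm.
Qed.

Variables (k : nat) (U : 'M[R]_(q, k)).
Hypothesis UU : U^T *m U = 1%:M.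

(** The event that the supremum is not within [e] of its approximation; it
    contains the event that one of the log-likelihoods is infinite. *)
Definition profile_error (Theta : set (param R d q)) (K : set (symmx R k)) (e : R) n :=
  [set w : T n | ~ exists a D, [/\ loglik f theta0 w = a%:E,
     ereal_sup [set loglik f theta w | theta in Theta] = (a + D)%:E &
     `|D - profile I U K (Z n w)| <= e]].

(** The maximiser and a near-maximiser of the quadratic over the cone are in a
    common ball with high probability.  Each is close to a point of the other
    set, by set convergence, and the quadratic changes little between them. *)
Lemma profile_approximation (Theta : set (param R d q)) (K : set (symmx R k)) (e : R) :
  K 0 ->
  cvg_on_bounded (local_set theta0 Theta) [set h : param R d q | K (active U h.2)] ->
  localised Pr f theta0 Theta -> 0 < e ->
  negligible (profile_error Theta K e).
Proof.
move=> K0 setcvg [hh [hmax htight]] e0; apply: negligible_approx => eta eta0.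
have eta2 : 0 < eta / 2 by rewrite divr_gt0.
(* The radius [b0] is the bound of [lan_quad_bounded] for near-maximisers. *)
have [M1 hM1] := htight _ eta2.
have [M2 hM2] := cvg_in_law_tight rZ rZlim ZZ eta2.
have [l l0 hl] := posdef_lower_bound hi sI pI.
pose M2' := Num.max M2 0.
pose b0 := 1 + 2 * (M2' + 1) / l.
have M2'0 : 0 <= M2' by rewrite le_max lexx orbT.
have b01 : 1 <= b0 by rewrite lerDl divr_ge0 ?(ltW l0)// mulr_ge0// addr_ge0.
pose rho := Num.max M1 b0.
have rho0 : 0 < rho by rewrite lt_max (lt_le_trans ltr01 b01) orbT.
have e4 : 0 < e / 4 by rewrite divr_gt0.
have [C C0 hC] := lan_quad_dist.
pose t := e / 4 / (M2' + C * rho + 1).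
have S0 : 0 <= M2' + C * rho by rewrite addr_ge0// mulr_ge0// ltW.
have t0 : 0 < t by rewrite divr_gt0// ltr_wpDl.
have close g h z : enorm g <= rho -> enorm h <= rho -> enorm z <= M2' -> enorm (g - h) < t ->
    `|lan_quad I g z - lan_quad I h z| <= e / 4.
  move=> gr hr zM gh; rewrite (le_trans (hC _ _ _ _ _ gr hr zM))//.
  apply: (@le_trans _ _ (t * (M2' + C * rho + 1))).
    by rewrite ler_pM ?enorm_ge0// ?(ltW gh)// lerDl.
  by rewrite /t divfK// gt_eqF// ltr_wpDl.
exists (fun n => [set w | ~ (local_set theta0 Theta n (hh n w) /\
        forall g, local_set theta0 Theta n g ->
          (loglik f (theta0 + rate R n *: g)%R w
             <= loglik f (theta0 + rate R n *: hh n w)%R w)%E)] `|`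
   [set w | ~ forall h, enorm h <= rho -> exists a b,
     [/\ loglik f (theta0 + rate R n *: h) w = b%:E, loglik f theta0 w = a%:E &
         `|b - a - lan_quad I h (Z n w)| < e / 4]]),
  (fun n => [set w | (M1 < enorm (hh n w))%R] `|` [set w | (M2 < enorm (Z n w))%R]).
split.
- by apply: negligibleU => //; exact: lan_on_ball.
- near=> n; apply: (le_trans (outer_probU (fun n => Pr n theta0) _ _)); rewrite [eta]splitr EFinD leeD//; near: n => //.
near=> n => w; apply: contraPP => /not_orP[/not_orP[/contrapT[hin hopt] /contrapT lanw]].
move=> /not_orP[/negP]; rewrite -leNgt => wM1 /negP; rewrite -leNgt => wM2.
have zM : enorm (Z n w) <= M2' by rewrite le_max wM2.
have hr : enorm (hh n w) <= rho by rewrite le_max wM1.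
have n0 : (0 < n)%N by near: n; exact: nbhs_infty_gt.
have rn0 : rate R n != 0 by rewrite /rate invr_eq0 sqrtr_eq0 -ltNge ltr0n.
have [a [b [hb ha hab]]] := lanw _ hr.
have supE : ereal_sup [set loglik f theta w | theta in Theta] = b%:E.
  apply/eqP; rewrite eq_le; apply/andP; split.
    apply: ge_ereal_sup => _ [theta th <-]; rewrite -hb.
    have thE : theta = theta0 + rate R n *: ((rate R n)^-1 *: (theta - theta0)).
      by rewrite scalerA divff// scale1r addrC subrK.
    by rewrite thE; apply: hopt; rewrite /local_set /= -thE.
  by rewrite -hb; apply: ereal_sup_ubound; exists (theta0 + rate R n *: hh n w).
have hd : (hausdorff (local_set theta0 Theta n `&` @eball R d q rho)
    ([set h : param R d q | K (active U h.2)] `&` @eball R d q rho) < t%:E)%E.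
  by near: n; exact: cvg_on_bounded_near.
have [cl1 cl2] := hausdorff_close hd.
move=> nope; apply: nope; exists a, (b - a); split=> //; first by rewrite supE addrC subrK.
have [y [Ky yr] hy] := cl1 (hh n w) (conj hin hr).
have up : lan_quad I y (Z n w) <= profile I U K (Z n w) by exact: lan_quad_le.
have c1 := close _ _ _ hr yr zM hy.
have e1 : 0 < Num.min (e / 4) 1 by rewrite lt_min e4 ltr01.
have [hs Khs lows] := lan_quad_adherent sI pI UU (Z n w) e1 (ex_intro _ _ K0).
have prof0 : 0 <= profile I U K (Z n w).
  have := @lan_quad_le R d q k I U sI pI UU K 0 (Z n w).
  rewrite /active_part linear0 => /(_ K0); apply: le_trans.
  by rewrite /lan_quad (ip0l hi) linear0 (ip0l hi) mulr0 subr0.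
have hsr : enorm hs <= rho.
  rewrite le_max; apply/orP; right.
  apply: le_trans (lan_quad_bounded l0 (hl hs) _) _; last first.
    rewrite /b0 lerD2l ler_wpM2r ?invr_ge0 ?(ltW l0)// ler_wpM2l// lerD2r; exact: zM.
  rewrite (le_trans _ (ltW lows))// lerBrDr (le_trans _ prof0)// addrC subr_le0 ge_min lexx orbT//.
have [g [gin gr] hg] := cl2 hs (conj Khs hsr).
have c2 := close _ _ _ hsr gr zM hg.
have [a' [b' [hb' ha' hab']]] := lanw _ gr.
have aa : a' = a by move: ha'; rewrite ha => -[].
have bb : b' <= b by rewrite -lee_fin -hb -hb'; exact: hopt.
have em : Num.min (e / 4) 1 <= e / 4 by rewrite ge_min lexx.
subst a'.
move: e0 hab hab' c1 c2 up lows em bb.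
move: (lan_quad _ _ _) (lan_quad _ _ _) (lan_quad _ _ _) (lan_quad _ _ _) (profile _ _ _ _) (Num.min _ _).
move=> x1 x2 x3 x4 x5 x6; rewrite !ltr_norml !ler_norml; clear=> e0.
move=> /andP[? ?] /andP[? ?] /andP[? ?] /andP[? ?] ? ? ? ?.
by apply/andP; split; lra.
Unshelve. all: by end_near. Qed.

End LikelihoodRatio.

Lemma sqr_le (R : realType) (x y : R) : 0 <= x -> x <= y -> x ^+ 2 <= y ^+ 2.
Proof. by move=> x0 xy; rewrite ler_pXn2r// nnegrE (le_trans x0). Qed.

Lemma double_difference_bound (R : realType) (e a b x y : R) : 0 < e ->
  `|a - x| <= e / 4 -> `|b - y| <= e / 4 -> `|2 * (b - a) - 2 * (y - x)| <= e.
Proof.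
move=> e0; rewrite !ler_norml => /andP[? ?] /andP[? ?]; apply/andP; split; lra.
Qed.

Lemma abs_difference_bound (R : realType) (x y c : R) :
  x <= c -> y <= c -> 0 <= x -> 0 <= y -> `|x - y| <= c.
Proof. by move=> *; rewrite ler_norml; apply/andP; split; lra. Qed.

Section LikelihoodRatioStatistic.
Variables (R : realType) (d q k m : nat).
Variables (dT : nat -> measure_display) (T : forall n, measurableType (dT n)).
Unset Implicit Arguments.
Variable Pr : forall n, param R d q -> probability (T n) R.
Variable f : forall n, param R d q -> T n -> R.
Variable Z : forall n, T n -> param R d q.
Set Implicit Arguments.
Variables (Theta0 Theta1 : set (param R d q)) (theta0 : param R d q) (I : 'End(param R d q)).
Variables (U : 'M[R]_(q, k)).
Variables (dZ : measure_display) (OZ : measurableType dZ) (QZ : probability OZ R).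
Variable Zlim : OZ -> param R d q.
Hypothesis UU : U^T *m U = 1%:M.
Hypothesis rZ : forall n : nat, random_element (Z n).
Hypothesis rZlim : random_element Zlim.
Hypothesis ZZ : cvg_in_law (fun n => Pr n theta0) Z QZ Zlim.
Hypothesis sI : selfadjoint (@inner R d q) I.
Hypothesis pI : posdef (@inner R d q) I.
Hypothesis lan : LAN Pr f theta0 I Z.
Hypothesis cvg0 : cvg_on_bounded (local_set theta0 Theta0)
    [set h : param R d q | tangent0 m U h.2].
Hypothesis cvg1 : cvg_on_bounded (local_set theta0 Theta1)
    [set h : param R d q | tangent1 U h.2].
Hypothesis loc0 : localised Pr f theta0 Theta0.
Hypothesis loc1 : localised Pr f theta0 Theta1.
Let hi := inner_inner_product R d q.
Let hk := frob_inner_product R k.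
Local Notation negligible := (asymp_negligible (fun n => Pr n theta0)).

Lemma psd0 : psd (0 : symmx R k).
Proof.
have s0 : symval (0 : symmx R k) = 0 by exact: linear0.
by move=> x; rewrite s0 mulmx0 mul0mx mxE.
Qed.

Lemma psd_rank0 : @psd_rank R k m 0.
Proof.
have s0 : symval (0 : symmx R k) = 0 by exact: linear0.
by split; [exact: psd0|rewrite s0 mxrank0].
Qed.

(** The two suprema share the value of the log-likelihood at [theta0], which
    cancels, as does the common term of the two profiles. *)
Lemma LR_stat_approximation (e : R) : 0 < e ->
  negligible (fun n => [set w | ~ exists x : R, LR_stat f Theta1 Theta0 w = x%:E /\
    `|x - distance_lr I U m (reduced_score I U (Z n w))| <= e]).
Proof.
move=> e0; have e4 : 0 < e / 4 by rewrite divr_gt0.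
have n0 := profile_approximation rZ rZlim ZZ sI pI lan UU psd_rank0 cvg0 loc0 e4.
have n1 := profile_approximation rZ rZlim ZZ sI pI lan UU psd0 cvg1 loc1 e4.
apply: negligible_sub (negligibleU n0 n1) _; apply: nearW => n w /=.
apply: contra_notP => /not_orP[/contrapT[a0 [D0 [h0 s0 p0]]] /contrapT[a1 [D1 [h1 s1 p1]]]].
have aa : a1 = a0 by move: h1; rewrite h0 => -[].
subst a1; exists (2 * (D1 - D0)); split.
  by rewrite /LR_stat s0 s1 -EFinB -EFinM; congr EFin; ring.
rewrite distance_lrE//; move: e0 p0 p1.
move: (profile _ _ _ _) (profile _ _ _ _) => x y; exact: double_difference_bound.
Qed.

Lemma cone_D0 : cone_D m I U 0.
Proof. by exists 0; [exact: psd_rank0|rewrite linear0]. Qed.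
Lemma cone_C0 : cone_C I U 0.
Proof. by exists 0; [exact: psd0|rewrite linear0]. Qed.

Lemma distance_lr_continuous : continuous (distance_lr I U m).
Proof.
have D0 : cone_D m I U !=set0 by exists 0; exact: cone_D0.
have C0 : cone_C I U !=set0 by exists 0; exact: cone_C0.
have sq A : A !=set0 -> continuous (fun y : symmx R k => dist_F y A ^+ 2).
  move=> A0 y; apply: (@continuous_comp _ _ _ (fun y => dist_F y A) (fun x => x ^+ 2)).
    exact: dist_F_continuous.
  exact: exprn_continuous.
by move=> y; apply: (cvgB (sq _ D0 y) (sq _ C0 y)).
Qed.

(** Both cones contain the origin. *)
Lemma distance_lr_bound y : `|distance_lr I U m y| <= frob_norm y ^+ 2.
Proof.
have D0 : cone_D m I U !=set0 by exists 0; exact: cone_D0.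
have C0 : cone_C I U !=set0 by exists 0; exact: cone_C0.
have a := dist_F_ge0 D0 y; have b := dist_F_ge0 C0 y.
have := dist_F_le D0 y cone_D0; have := dist_F_le C0 y cone_C0; rewrite subr0 => c e.
have e1 : dist_F y (cone_D m I U) ^+ 2 <= frob_norm y ^+ 2.
  by rewrite ler_pXn2r ?nnegrE ?frob_norm_ge0.
have e2 : dist_F y (cone_C I U) ^+ 2 <= frob_norm y ^+ 2.
  by rewrite ler_pXn2r ?nnegrE ?frob_norm_ge0.
have e3 := sqr_ge0 (dist_F y (cone_D m I U)); have e4 := sqr_ge0 (dist_F y (cone_C I U)).
rewrite /distance_lr; move: e1 e2 e3 e4; move: (_ ^+ 2) (_ ^+ 2) (_ ^+ 2) => x1 x2 x3.
exact: abs_difference_bound.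
Qed.

(** [F] is not assumed uniformly continuous; tightness of the score confines its
    arguments to a bounded interval, up to a small probability. *)
Lemma test_function_approximation (F : \bar R -> R) (e : R) : continuous F -> 0 < e ->
  negligible (fun n => [set w | e < `|F (LR_stat f Theta1 Theta0 w) -
     F (distance_lr I U m (reduced_score I U (Z n w)))%:E|]).
Proof.
move=> cF e0; apply: negligible_approx => eta eta0.
have [M hM] := cvg_in_law_tight rZ rZlim ZZ eta0.
pose L := (cov_red_inv_sqrt I U \o active U \o linfun (@proj_sigma R d q) \o I^-1)%VF.
have LE z : reduced_score I U z = L z.
  by rewrite [RHS]comp_lfunE [RHS]comp_lfunE [RHS]comp_lfunE (lfunE (@proj_sigma R d q)).
have [C C0 hC] := linear_bounded L hi hk.
have cF' : continuous (fun x : R => F x%:E).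
  by move=> x; apply: continuous_comp; [by apply: cvg_EFin; [exact: nearW|exact: cvg_id]|exact: cF].
have [t t0 ht] := uniformly_continuous_on_bounded ((C * M) ^+ 2) cF' e0.
exists (fun n => [set w | ~ exists x : R, LR_stat f Theta1 Theta0 w = x%:E /\
    `|x - distance_lr I U m (reduced_score I U (Z n w))| <= t]), (fun n => [set w | (M < enorm (Z n w))%R]).
split=> //; first exact: LR_stat_approximation.
apply: nearW => n w /=; apply: contraPP => /not_orP[/contrapT[x [-> xp]] /negP].
rewrite -leNgt => zM; apply/negP; rewrite -leNgt distrC.
apply: ht; last by rewrite distrC.
apply: le_trans (distance_lr_bound _) _; rewrite LE; apply: sqr_le.
  exact: frob_norm_ge0.
by apply: le_trans (hC _) _; rewrite ler_wpM2l ?(ltW C0).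
Qed.

End LikelihoodRatioStatistic.

(** * Change of measure along a null path *)

Lemma cvg_rate (R : realType) : rate R n @[n --> \oo] --> (0 : R)^'+.
Proof.
move=> A [e /= e0 hA]; suff : \forall n \near \oo, A (rate R n) by [].
near=> n.
have n0 : (0 < n)%N by near: n; exact: nbhs_infty_gt.
have s0 : 0 < Num.sqrt (n%:R : R) by rewrite sqrtr_gt0 ltr0n.
have r0 : 0 < rate R n by rewrite invr_gt0.
apply: hA => //=; rewrite sub0r normrN gtr0_norm// /rate invf_plt ?posrE//.
rewrite -[X in X < _]gtr0_norm ?invr_gt0// -sqrtr_sqr ltr_sqrt ?ltr0n//.
by near: n; exact: nbhs_infty_gtr.
Unshelve. all: by end_near. Qed.

Section NullPath.
Variables (R : realType) (d q : nat) (Theta : set (param R d q)) (theta0 h : param R d q).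
Variable theta : R -> param R d q.
Hypothesis path : null_path Theta theta0 h theta.

Definition local_path (n : nat) : param R d q := (rate R n)^-1 *: (theta (rate R n) - theta0).

Lemma local_path_spec : \forall n \near \oo, Theta (theta (rate R n)) /\
  theta (rate R n) = theta0 + rate R n *: local_path n.
Proof.
have [nT _] := path; have := cvg_rate nT; apply: filterS2 (nbhs_infty_gt 0) => n n0 /= ?; split=> //.
rewrite /local_path scalerA divff ?scale1r 1?addrC ?subrK//.
by rewrite invr_eq0 sqrtr_eq0 -ltNge ltr0n.
Qed.

Lemma local_path_cvg (e : R) : 0 < e -> \forall n \near \oo, enorm (local_path n - h) < e.
Proof.
move=> e0; have [_ lim] := path.
have /cvgrPdist_lt/(_ _ e0) := cvg_comp _ _ (@cvg_rate R) lim.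
apply: filterS2 (nbhs_infty_gt 0) => n n0 /=; rewrite sub0r normrN => lt_e.
have r0 : 0 < rate R n by rewrite invr_gt0 sqrtr_gt0 ltr0n.
have -> : local_path n - h = (rate R n)^-1 *: (theta (rate R n) - theta0 - rate R n *: h).
  by rewrite scalerBr scalerA mulVf ?scale1r// gt_eqF.
rewrite enormZ mulrC gtr0_norm; first exact: le_lt_trans (ler_norm _) lt_e.
by rewrite invr_gt0.
Qed.

End NullPath.

Section LikelihoodLowerBound.
Variables (R : realType) (d q : nat).
Variables (dT : nat -> measure_display) (T : forall n, measurableType (dT n)).
Variable nu : forall n, {measure set (T n) -> \bar R}.
Unset Implicit Arguments.
Variable Pr : forall n, param R d q -> probability (T n) R.
Variable f : forall n, param R d q -> T n -> R.
Variable Z : forall n, T n -> param R d q.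
Set Implicit Arguments.
Variables (theta0 : param R d q) (I : 'End(param R d q)).
Variables (dZ : measure_display) (OZ : measurableType dZ) (QZ : probability OZ R).
Variable Zlim : OZ -> param R d q.
Hypothesis rZ : forall n : nat, random_element (Z n).
Hypothesis rZlim : random_element Zlim.
Hypothesis ZZ : cvg_in_law (fun n => Pr n theta0) Z QZ Zlim.
Hypothesis sI : selfadjoint (@inner R d q) I.
Hypothesis lan : LAN Pr f theta0 I Z.
Variables (D : set (param R d q)) (h : param R d q) (hn : nat -> param R d q).
Hypothesis model : is_model nu Pr f D.
Hypothesis D0 : D theta0.
Hypothesis hnD : \forall n \near \oo, D (theta0 + rate R n *: hn n).
Hypothesis hnh : forall e : R, 0 < e -> \forall n \near \oo, enorm (hn n - h) < e.
Let hi := inner_inner_product R d q.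
Local Notation negligible := (asymp_negligible (fun n => Pr n theta0)).

(** The directions [hn n] lie in a ball on which the expansion is uniform, and
    converge to [h], along which the quadratic is continuous uniformly for
    bounded scores. *)
Lemma density_lower_bound (e : R) : 0 < e ->
  negligible (fun n => [set w | ~ (f n theta0 w * expR (lan_quad I h (Z n w) - e) <=
    f n (theta0 + rate R n *: hn n) w)]).
Proof.
move=> e0; apply: negligible_approx => eta eta0.
have [M hM] := cvg_in_law_tight rZ rZlim ZZ eta0.
have e2 : 0 < e / 2 by rewrite divr_gt0.
have [C C0 hC] := lan_quad_dist sI.
pose rho := enorm h + 1; pose B := `|M| + C * rho + 1.
have rho0 : 0 <= rho by rewrite addr_ge0 ?enorm_ge0.
have B1 : 0 < B by rewrite ltr_wpDl// addr_ge0// mulr_ge0// ltW.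
exists (fun n => [set w | ~ forall h, enorm h <= rho -> exists a b,
     [/\ loglik f (theta0 + rate R n *: h) w = b%:E, loglik f theta0 w = a%:E &
         `|b - a - lan_quad I h (Z n w)| < e / 2]]), (fun n => [set w | (M < enorm (Z n w))%R]).
split=> //; first exact: lan_on_ball.
near=> n => w /=; apply: contraPP => /not_orP[/contrapT lanw /negP].
rewrite -leNgt => zM; apply; have zM' := le_trans zM (ler_norm M).
have near1 : enorm (hn n - h) < 1 by near: n; exact: hnh.
have near2 : enorm (hn n - h) < e / 2 / B by near: n; apply: hnh; rewrite divr_gt0.
have Dn : D (theta0 + rate R n *: hn n) by near: n.
have hr : enorm (hn n) <= rho.
  by rewrite -(subrK h (hn n)) (le_trans (enormD _ _))// addrC lerD2l ltW.
have hr' : enorm h <= rho by rewrite lerDl.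
have [a [b [lb la ab]]] := lanw _ hr.
have := hC _ _ _ _ _ hr hr' zM'.
have : enorm (hn n - h) * (`|M| + C * rho) <= e / 2.
  rewrite (@le_trans _ _ (e / 2 / B * B))//; last by rewrite divfK ?gt_eqF.
  by rewrite ler_pM ?enorm_ge0 ?(ltW near2)// ?addr_ge0 ?mulr_ge0 ?(ltW C0)// lerDl.
have expE theta (c : R) : D theta -> loglik f theta w = c%:E -> f n theta w = expR c.
  move=> Dt; have [f0 _ _] := model n Dt; rewrite /loglik.
  have := f0 w; rewrite le_eqVlt => /predU1P[<-|fp]; first by rewrite le0_lneNy.
  by rewrite lne_EFin// => -[<-]; rewrite lnK.
rewrite (expE _ _ D0 la) (expE _ _ Dn lb) -expRD ler_expR.
move: ab; move: (lan_quad _ _ _) (lan_quad _ _ _) (enorm _ * _) => x y t.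
rewrite ltr_norml ler_norml => /andP[? ?] ? /andP[? ?]; lra.
Unshelve. all: by end_near. Qed.

(** The pointwise bound is integrated off a measurable cover of the event where it
    fails. *)
Lemma likelihood_ratio_lower_bound (e : R) : 0 < e -> exists A : forall n, set (T n),
  [/\ forall n, measurable (A n), negligible A &
    \forall n \near \oo, forall g : T n -> R, measurable_fun setT g -> (forall w, 0 <= g w) ->
      ((expR (- e))%:E * \int[Pr n theta0]_w (g w * expR (lan_quad I h (Z n w)) * \1_(~` A n) w)%:E
        <= \int[Pr n (theta0 + rate R n *: hn n)%R]_w (g w)%:E)%E].
Proof.
move=> e0; have [A [mA subA nA]] := negligible_cover (density_lower_bound e0).
exists A; split=> //; near=> n => g mg g0.
have Dn : D (theta0 + rate R n *: hn n) by near: n.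
have [f0 mf fP] := model n Dn; have [f00 mf0 fP0] := model n D0.
pose u w := g w * expR (lan_quad I h (Z n w)) * \1_(~` A n) w.
have mu : measurable_fun setT u.
  apply: measurable_funM; last by apply: measurable_indic; exact: measurableC.
  apply: measurable_funM => //; apply: measurableT_comp => //.
  by apply: random_element_measurable (rZ n) _; exact: lan_quad_continuous.
have u0 w : 0 <= u w by rewrite !mulr_ge0 ?expR_ge0.
rewrite (density_integral mf f0 fP mg g0) (density_integral mf0 f00 fP0 mu u0).
rewrite -ge0_integralZl_EFin ?expR_ge0//; last 2 first.
- move=> w _; rewrite lee_fin; exact: mulr_ge0 (f00 w) (u0 w).
- exact/measurable_EFinP/measurable_funM.
apply: le_inner_integral => w; first by rewrite -EFinM lee_fin !mulr_ge0 ?expR_ge0.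
rewrite -EFinM lee_fin /u indicE in_setC.
have [Aw|/negP] := boolP (w \in A n); first by rewrite !mulr0 mulr_ge0.
move=> nAw; have := contra_not (@subA n w); rewrite -[A n w]inE => /(_ nAw)/contrapT.
rewrite expRD /= mulr1; move: (g0 w) (expR_ge0 (lan_quad I h (Z n w))).
move: (f n theta0 w) (f n (_ + _) w) (g w) (expR (lan_quad _ _ _)) (expR (- _)) => x y a b c a0 b0 xy.
have -> : c * (x * (a * b)) = a * (x * (b * c)) by ring.
by rewrite [leRHS]mulrC ler_wpM2l.
Unshelve. all: by end_near. Qed.

End LikelihoodLowerBound.

(** * The limit law *)

Section WeakLimit.
Variables (R : realType) (d q k m : nat).
Variables (dT : nat -> measure_display) (T : forall n, measurableType (dT n)).
Variable nu : forall n, {measure set (T n) -> \bar R}.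
Unset Implicit Arguments.
Variable Pr : forall n, param R d q -> probability (T n) R.
Variable f : forall n, param R d q -> T n -> R.
Variable Z : forall n, T n -> param R d q.
Set Implicit Arguments.
Variables (Theta0 Theta1 D : set (param R d q)) (theta0 : param R d q) (I : 'End(param R d q)).
Variables (U : 'M[R]_(q, k)).
Variables (dZ : measure_display) (OZ : measurableType dZ) (QZ : probability OZ R).
Variable Zlim : OZ -> param R d q.
Hypothesis UU : U^T *m U = 1%:M.
Hypothesis rZ : forall n : nat, random_element (Z n).
Hypothesis gZ : gaussian I QZ Zlim.
Hypothesis ZZ : cvg_in_law (fun n => Pr n theta0) Z QZ Zlim.
Hypothesis sI : selfadjoint (@inner R d q) I.
Hypothesis pI : posdef (@inner R d q) I.
Hypothesis lan : LAN Pr f theta0 I Z.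
Hypothesis cvg0 : cvg_on_bounded (local_set theta0 Theta0)
    [set h : param R d q | tangent0 m U h.2].
Hypothesis cvg1 : cvg_on_bounded (local_set theta0 Theta1)
    [set h : param R d q | tangent1 U h.2].
Hypothesis loc0 : localised Pr f theta0 Theta0.
Hypothesis loc1 : localised Pr f theta0 Theta1.
Hypothesis model : is_model nu Pr f D.
Hypothesis D0 : D theta0.
Variables (h : param R d q) (hn thetan : nat -> param R d q).
Hypothesis thetanE : \forall n \near \oo, D (thetan n) /\ thetan n = theta0 + rate R n *: hn n.
Hypothesis hnh : forall e : R, 0 < e -> \forall n \near \oo, enorm (hn n - h) < e.
Variables (dY : measure_display) (OY : measurableType dY) (QY : probability OY R).
Variable Y : OY -> symmx R k.
Hypothesis gY : std_gaussian QY Y.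

Let rZlim : random_element Zlim := gZ.1.

(** [third_lemma] with the statistic as a function of the score, followed by
    [reduced_score_law]. *)
Lemma ge0_integral_statistic_cvg (F : \bar R -> R) (M : R) : continuous F -> (forall x, 0 <= F x <= M) ->
  (\int[Pr n (thetan n)]_w (F (LR_stat f Theta1 Theta0 w))%:E)%E @[n --> \oo] -->
  (\int[QY]_w (F (limit_stat m I U h.2 (Y w))%:E)%:E)%E.
Proof.
move=> cF F0M.
have cF' : continuous (fun y => F (distance_lr I U m y)%:E).
  move=> y; apply: (@continuous_comp _ _ _ (distance_lr I U m) (fun x => F x%:E)).
    exact: distance_lr_continuous.
  apply: (@continuous_comp _ _ _ EFin F); last exact: cF.
  by apply: cvg_EFin; [exact: nearW|exact: cvg_id].
have FM x : `|F x| <= M by have /andP[a b] := F0M x; rewrite ger0_norm.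
rewrite -(@reduced_score_law R d q k I U sI pI UU _ _ QZ Zlim _ _ QY Y gZ gY h _ M cF')//.
have ratio (e : R) : 0 < e -> exists A : forall n, set (T n),
    [/\ forall n, measurable (A n), asymp_negligible (fun n => Pr n theta0) A &
    \forall n \near \oo, forall g : T n -> R, measurable_fun setT g -> (forall w, 0 <= g w) ->
      ((expR (- e))%:E * \int[Pr n theta0]_w (g w * expR (lan_quad I h (Z n w)) * \1_(~` A n) w)%:E
        <= \int[Pr n (thetan n)]_w (g w)%:E)%E].
  move=> e0.
  have hnD : \forall n \near \oo, D (theta0 + rate R n *: hn n).
    by apply: filterS thetanE => n [+ E]; rewrite E.
  have [A [mA nA hA]] := likelihood_ratio_lower_bound rZ rZlim ZZ sI lan model D0 hnD hnh e0.
  exists A; split=> //; apply: filterS2 thetanE hA => n [_ ->]; exact.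
pose phi z := F (distance_lr I U m (reduced_score I U z))%:E.
have cphi : continuous phi.
  move=> z; apply: (@continuous_comp _ _ _ (reduced_score I U)
    (fun y => F (distance_lr I U m y)%:E)); last exact: cF'.
  exact: reduced_score_continuous.
have nphi (e : R) : 0 < e -> asymp_negligible (fun n => Pr n theta0)
    (fun n => [set w | e < `|F (LR_stat f Theta1 Theta0 w) - phi (Z n w)|]).
  by move=> e0; exact: (test_function_approximation UU rZ rZlim ZZ sI pI lan cvg0 cvg1 loc0 loc1 cF e0).
have cl : continuous (lan_quad I h) by move=> z; exact: lan_quad_continuous.
have := third_lemma rZ rZlim ZZ cl (lan_quad_mgf pI gZ h) ratio cphi
  (fun z => F0M _) (fun n w => F0M _) nphi.
exact.
Qed.

(** The integral of a function that need not be measurable is defined through its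
    positive and negative parts, to which the nonnegative case applies. *)
Lemma statistic_cvg : cvg_in_law (fun n => Pr n (thetan n))
  (fun n => @LR_stat R d q dT T f Theta1 Theta0 n)
  QY (fun w => (limit_stat m I U h.2 (Y w))%:E).
Proof.
move=> F cF [M FM].
have pos : (\int[Pr n (thetan n)]_w (Num.max (F (LR_stat f Theta1 Theta0 w)) 0)%:E)%E @[n --> \oo] -->
  (\int[QY]_w (Num.max (F (limit_stat m I U h.2 (Y w))%:E) 0)%:E)%E.
  apply: (@ge0_integral_statistic_cvg (fun x => Num.max (F x) 0) M).
    exact: continuous_maxr_cst.
  move=> x; rewrite le_max lexx orbT ge_max (le_trans (ler_norm _) (FM x)) /=.
  exact: le_trans (normr_ge0 _) (FM x).
have neg : (\int[Pr n (thetan n)]_w (Num.max (- F (LR_stat f Theta1 Theta0 w)) 0)%:E)%E @[n --> \oo] -->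
  (\int[QY]_w (Num.max (- F (limit_stat m I U h.2 (Y w))%:E) 0)%:E)%E.
  apply: (@ge0_integral_statistic_cvg (fun x => Num.max (- F x) 0) M).
    by apply: continuous_maxr_cst => x; apply: cvgN; exact: cF.
  move=> x; rewrite le_max lexx orbT ge_max (le_trans (ler_norm _)) ?normrN//=.
  exact: le_trans (normr_ge0 _) (FM x).
have split_integral (dO : measure_display) (O : measurableType dO) (P : probability O R) (G : O -> R) :
    (\int[P]_w (G w)%:E = \int[P]_w (Num.max (G w) 0)%:E - \int[P]_w (Num.max (- G w) 0)%:E)%E.
  rewrite integralE; congr (_ - _)%E; apply: eq_integral => w _.
    by rewrite funeposE EFin_max.
  by rewrite funenegE EFin_max.
rewrite split_integral; under eq_fun do rewrite split_integral.
have fin (G : OY -> R) : (forall w, G w <= M) -> (\int[QY]_w (Num.max (G w) 0)%:E \is a fin_num)%E.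
  move=> GM; rewrite ge0_fin_numE; last first.
    by apply: integral_ge0 => w _; rewrite lee_fin le_max lexx orbT.
  apply: (@le_lt_trans _ _ (\int[QY]_w (cst `|M|%:E w))%E).
    apply: le_inner_integral => w; rewrite lee_fin ?le_max ?lexx ?orbT//.
    by rewrite ge_max normr_ge0 andbT (le_trans (GM w)) ?ler_norm.
  rewrite integral_cst//= -ge0_fin_numE ?mule_ge0 ?lee_fin//.
  by rewrite fin_numM// fin_num_measure.
apply: cvgeB pos neg; apply: fin_num_adde_defl; rewrite fin_numN; apply: fin => w.
by rewrite (le_trans (ler_norm _))// normrN.
Qed.

End WeakLimit.

(** * Directions of null paths *)

Section RankConeClosed.
Variables (R : realType) (k : nat).
Implicit Types X Y : symmx R k.
Let hk := frob_inner_product R k.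

Lemma quadratic_form_frob X (x : 'cV[R]_k) :
  (x^T *m symval X *m x) 0 0 = frob X (tosym (x *m x^T)).
Proof.
rewrite /frob tosymK; last by rewrite trmx_mul trmxK.
by rewrite mulmxA mxtrace_mulC mulmxA /mxtrace big_ord1.
Qed.

(** For fixed [x] the quadratic form is a bounded linear function of the matrix. *)
Lemma psd_limit X : (forall e : R, 0 < e -> exists2 Y, psd Y & frob_norm (X - Y) < e) -> psd X.
Proof.
move=> h x; rewrite leNgt; apply/negP; rewrite quadratic_form_frob => neg.
pose N := tosym (x *m x^T).
pose e := - frob X N / (frob_norm N + 1).
have e0 : 0 < e by rewrite divr_gt0 ?oppr_gt0 ?ltr_wpDl ?frob_norm_ge0.
have [Y pY XY] := h e e0; have := pY x; rewrite quadratic_form_frob -/N leNgt => /negP; apply.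
have : `|frob (X - Y) N| < - frob X N.
  apply: le_lt_trans (cauchy_schwarz hk _ _) _.
  have -> : - frob X N = e * (frob_norm N + 1) by rewrite /e divfK ?gt_eqF ?ltr_wpDl ?frob_norm_ge0.
  rewrite (@le_lt_trans _ _ (e * frob_norm N))//.
    by rewrite ler_wpM2r ?frob_norm_ge0 ?ltW.
  by rewrite ltr_pM2l// ltrDl.
by rewrite (ipBl hk) ltr_norml => /andP[+ _]; rewrite opprK ltrBrDr addrC -ltrBrDr subrr.
Qed.

Lemma minor_continuous m (L : 'M[R]_(m, k)) (N : 'M[R]_(k, m)) :
  continuous (fun X => \det (L *m symval X *m N)).
Proof.
have centry a b : continuous (fun X => symval X a b).
  apply: (@lipschitz_symmx _ _ _ 1) => X Y; rewrite mul1r.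
  by apply: le_trans (entry_le_frob_norm _ a b); rewrite linearB !mxE.
have csum (J : finType) (P : pred J) (F : J -> symmx R k -> R) :
    (forall j, continuous (F j)) -> continuous (fun X => \sum_(j | P j) F j X).
  by move=> cF X; have FX := nbhs_filter X; apply: cvg_big => [|j _]; [exact: add_continuous|exact: cF].
have cprod (J : finType) (P : pred J) (F : J -> symmx R k -> R) :
    (forall j, continuous (F j)) -> continuous (fun X => \prod_(j | P j) F j X).
  by move=> cF X; have FX := nbhs_filter X; apply: cvg_big => [|j _]; [exact: mul_continuous|exact: cF].
have cmul (F G : symmx R k -> R) : continuous F -> continuous G -> continuous (fun X => F X * G X).
  by move=> cF cG X; exact: cvgM (cF X) (cG X).
have ccst (c : R) : continuous (fun _ : symmx R k => c) by move=> X; have FX := nbhs_filter X; exact: cvg_cst.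
have cprodentry i j : continuous (fun X => (L *m symval X *m N) i j).
  have -> : (fun X => (L *m symval X *m N) i j) =
      (fun X => \sum_b (\sum_a L i a * symval X a b) * N b j).
    by apply/funext => X; rewrite mxE; apply: eq_bigr => b _; rewrite mxE.
  apply: (csum) => b; apply: (cmul); last exact: ccst.
  by apply: (csum) => a; apply: (cmul); [exact: ccst|exact: centry].
rewrite /determinant; apply: csum => s; apply: cmul; first exact: ccst.
by apply: cprod => i.
Qed.

(** If the rank exceeds [m], Gaussian elimination gives [L] and [N] for which the
    determinant of [L X N], of size [m + 1], is 1; it stays nonzero near [X]. *)
Lemma rank_limit m X : (forall e : R, 0 < e ->
    exists2 Y, (\rank (symval Y) <= m)%N & frob_norm (X - Y) < e) ->
  (\rank (symval X) <= m)%N.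
Proof.
move=> h; rewrite leqNgt; apply/negP => mX.
pose L : 'M[R]_(m.+1, k) := pid_mx m.+1 *m invmx (col_ebase (symval X)).
pose N : 'M[R]_(k, m.+1) := invmx (row_ebase (symval X)) *m pid_mx m.+1.
have one : L *m symval X *m N = 1%:M.
  rewrite -[in symval X](mulmx_ebase (symval X)) /L /N !mulmxA.
  rewrite mulmxKV ?col_ebase_unit// mulmxK ?row_ebase_unit//.
  have rk := rank_leq_row (symval X).
  by rewrite !mul_pid_mx -pid_mx_1; congr pid_mx; lia.
have /continuous_symmxP/(_ X 1 ltr01)[t t0 ht] := minor_continuous (L := L) (N := N).
have [Y rY XY] := h t t0.
have := ht Y; rewrite -/(frob_norm _) frob_normB => /(_ XY).
have -> : \det (L *m symval Y *m N) = 0.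
  apply/eqP; apply: contraTT rY; rewrite -unitfE -/(_ \in unitmx) => u.
  rewrite -ltnNge -(mxrank_unit u); apply: leq_trans (mxrankM_maxl _ _) _.
  exact: mxrankM_maxr.
by rewrite one det1 sub0r normrN1 ltxx.
Qed.

End RankConeClosed.

Section NullPathDirections.
Variables (R : realType) (d q k m : nat).
Variables (Theta0 : set (param R d q)) (theta0 : param R d q) (U : 'M[R]_(q, k)).

(** Each [local_path n] is in the rescaled null set, hence close to a point of
    the tangent cone, and it converges to [h]. *)
Lemma null_path_active (h : param R d q) (theta : R -> param R d q) :
  cvg_on_bounded (local_set theta0 Theta0) [set g : param R d q | tangent0 m U g.2] ->
  null_path Theta0 theta0 h theta -> @psd_rank R k m (active U h.2).
Proof.
move=> setcvg path.
pose L := (active U \o linfun (@proj_sigma R d q))%VF.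
have LE (g : param R d q) : L g = active U g.2.
  by rewrite [LHS]comp_lfunE (lfunE (@proj_sigma R d q)).
have [C C0 hC] := linear_bounded L (inner_inner_product R d q) (frob_inner_product R k).
suff close e : 0 < e -> exists2 B, @psd_rank R k m B & frob_norm (active U h.2 - B) < e.
  by split; [apply: psd_limit|apply: rank_limit] => e /close[B [pB rB] hB]; exists B.
move=> e0; pose t := e / 2 / C.
have t0 : 0 < t by rewrite !divr_gt0.
pose rho := enorm h + 1; have rho0 : 0 < rho by rewrite ltr_wpDl ?enorm_ge0.
have hd : \forall n \near \oo, (hausdorff (local_set theta0 Theta0 n `&` @eball R d q rho)
    ([set g : param R d q | tangent0 m U g.2] `&` @eball R d q rho) < t%:E)%E.
  exact: cvg_on_bounded_near.
have [n [[[Tn En] [ht h1]] hdn]] := filter_ex (filterI (filterI (local_path_spec path)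
  (filterI (local_path_cvg path t0) (local_path_cvg path ltr01))) hd).
set g := local_path theta0 theta n in En ht h1.
have gr : enorm g <= rho.
  by rewrite -(subrK h g) (le_trans (enormD _ _))// addrC lerD2l ltW.
have gin : local_set theta0 Theta0 n g by rewrite /local_set /= -En.
have [y [Ty _] gy] := (hausdorff_close hdn).1 g (conj gin gr).
exists (active U y.2) => //.
rewrite -!LE -linearB; apply: le_lt_trans (hC _) _.
rewrite mulrC -ltr_pdivlMr//; apply: le_lt_trans (enorm_triangle g _ _) _.
rewrite -[_ / C]/(e / C) enormB.
have -> : e / C = t + t by rewrite /t -mulrDl -splitr.
exact: ltrD.
Qed.

(** The segment from [theta0] in the direction [U B U^T]. *)
Lemma null_path_exists r (B : symmx R k) : U^T *m U = 1%:M ->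
  restricted_to (@psd_rank R q r) theta0 Theta0 ->
  psd theta0.2 -> (\rank (symval theta0.2) + m <= r)%N -> @psd_rank R k m B ->
  exists theta, null_path Theta0 theta0 (0, active_adj U B) theta.
Proof.
move=> UU [_ /nbhs_paramP[e e0 he]] psd0 rk [pB rB].
set h : param R d q := (0, active_adj U B).
exists (fun t => theta0 + t *: h); split; last first.
  apply: cvg_near_cst; apply: nearW => t.
  by rewrite -addrA -opprD subrr enorm0 mul0r.
near=> t; have t0 : 0 < t by near: t; exact: nbhs_right_gt.
apply: he => /=.
  rewrite addrAC subrr add0r enormZ gtr0_norm//.
  apply: (@le_lt_trans _ _ (t * (enorm h + 1))).
    by rewrite ler_wpM2l ?(ltW t0)// lerDl.
  rewrite -ltr_pdivlMr ?ltr_wpDl ?enorm_ge0//; near: t; apply: nbhs_right_lt.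
  by rewrite divr_gt0 ?ltr_wpDl ?enorm_ge0.
have E : symval (theta0 + t *: h).2 = symval theta0.2 + t *: (U *m symval B *m U^T).
  by rewrite -symval_active_adj -linearZ -linearD.
split=> [x|]; rewrite E.
  rewrite mulmxDr mulmxDl mxE addr_ge0//.
  rewrite -scalemxAr -scalemxAl mxE mulr_ge0 ?(ltW t0)//.
  by have := pB (U^T *m x); rewrite trmx_mul trmxK !mulmxA.
apply: leq_trans (mxrank_add _ _) _; apply: leq_trans rk; rewrite leq_add2l.
apply: leq_trans (mxrank_scale _ _) _; apply: leq_trans (mxrankM_maxl _ _) _.
exact: leq_trans (mxrankM_maxr _ _) rB.
Unshelve. all: by end_near. Qed.

End NullPathDirections.

Theorem corollary3p5 (R : realType) (d q r s : nat)
  (dT : nat -> measure_display) (T : forall n, measurableType (dT n))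
  (nu : forall n, {measure set (T n) -> \bar R})
  (Pr : forall n, param R d q -> probability (T n) R)
  (f : forall n, param R d q -> T n -> R)
  (Theta0 Theta1 N : set (param R d q)) (theta0 : param R d q)
  (U : 'M[R]_(q, q - s)) (I : 'End(param R d q))
  (Z : forall n, T n -> param R d q)
  (dZ : measure_display) (OZ : measurableType dZ) (QZ : probability OZ R)
  (Zlim : OZ -> param R d q) :
  (r < q)%N ->
  Theta0 `<=` Theta1 ->
  restricted_to (@psd_rank R q r) theta0 Theta0 ->
  restricted_to (@psd_cone R q) theta0 Theta1 ->
  Theta0 theta0 ->
  psd theta0.2 -> \rank (symval theta0.2) = s -> (s <= r)%N ->
  orthonormal_kernel_basis theta0.2 U ->
  open N -> N theta0 ->
  is_model nu Pr f (Theta1 `|` N) ->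
  (forall n, random_element (Z n)) ->
  selfadjoint (@inner R d q) I -> posdef (@inner R d q) I ->
  LAN Pr f theta0 I Z ->
  gaussian I QZ Zlim ->
  cvg_in_law (fun n => Pr n theta0) Z QZ Zlim ->
  cvg_on_bounded (local_set theta0 Theta0)
    [set h : param R d q | tangent0 (r - s) U h.2] ->
  cvg_on_bounded (local_set theta0 Theta1)
    [set h : param R d q | tangent1 U h.2] ->
  localised Pr f theta0 Theta0 ->
  localised Pr f theta0 Theta1 ->
  (forall (theta : R -> param R d q) (a : 'cV[R]_d) (H : symmx R q),
    null_path Theta0 theta0 (a, H) theta ->
    (forall (dY : measure_display) (OY : measurableType dY)
       (QY : probability OY R) (Y : OY -> symmx R (q - s)),
      std_gaussian QY Y ->
      cvg_in_law (fun n => Pr n (theta (rate R n)))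
        (fun n => @LR_stat R d q dT T f Theta1 Theta0 n)
        QY (fun w => (limit_stat (r - s) I U H (Y w))%:E)) /\
    @psd_rank R (q - s) (r - s) (active U H)) /\
  (forall B : symmx R (q - s), @psd_rank R (q - s) (r - s) B ->
    exists (theta : R -> param R d q) (a : 'cV[R]_d) (H : symmx R q),
      null_path Theta0 theta0 (a, H) theta /\ active U H = B).
Proof.
move=> _ Theta01 restr0 _ Theta0_theta0 psd0 rank0 sr [UU _] _ Ntheta0 model rZ sI pI lan gZ ZZ cvg0 cvg1 loc0 loc1.
split=> [theta a H path|B B_in].
  split; last exact: null_path_active cvg0 path.
  move=> dY OY QY Y gY.
  apply: (@statistic_cvg R d q (q - s) (r - s) dT T nu Pr f Z Theta0 Theta1 (Theta1 `|` N) theta0 I U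
    dZ OZ QZ Zlim UU rZ gZ ZZ sI pI lan cvg0 cvg1 loc0 loc1 model _ (a, H)
    (local_path theta0 theta) (fun n => theta (rate R n)) _ _ dY OY QY Y gY).
  - by right.
  - apply: filterS (local_path_spec path) => n [? ?]; split=> //.
    by left; exact: Theta01.
  - exact: local_path_cvg path.
have [|theta path] := null_path_exists (r := r) UU restr0 psd0 _ B_in.
  by rewrite rank0 subnKC.
by exists theta, 0, (active_adj U B); split=> //; exact: active_adjK.
Qed.
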